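(* Let $m,k,\ell\in\mathbb N$ with $k+\ell$ even, and let $\hbar\in\mathbb R\setminus\{0\}$. The Schrödinger representation $(\mathcal H_S,U_0,U)$ of the Heisenberg supergroup $\mathrm H_{2m|k,\ell}$ with parameter $\hbar$ is irreducible.
   Context: **Superspaces.** Fix a unital supercommutative real $\mathbb Z_2$-graded algebra $\mathcal A=\mathcal A_0\oplus\mathcal A_1$ with $\mathcal A/\mathcal N_{\mathcal A}\simeq\mathbb R$ ($\mathcal N_{\mathcal A}$ = nilpotent elements; the quotient map is the body map) and such that for each $n\ge1$ there are $a_1,\dots,a_n\in\mathcal A_1$ with $a_1\cdots a_n\ne0$. $\mathbb R^{m|n}=(\mathcal A_0)^m\times(\mathcal A_1)^n$. **Heisenberg supergroup.** Let $\varepsilon\in\{\pm1\}$, $r,s\in\mathbb N$ with $2\varepsilon s=k-\ell$, $2r+2s=k+\ell$. $\mathrm H_{2m|k,\ell}$ is the supermanifold of $(\mathbf x,t)$, $\mathbf x=(q,p,\xi)\in\mathbb R^{m|r}\times\mathbb R^{m|r}\times\mathbb R^{0|2s}$, $t\in\mathbb R^{1|0}=\mathcal A_0$, with law $(\mathbf x,t)(\mathbf x',t')=(\mathbf x+\mathbf x',t+t'+\tfrac12\omega(\mathbf x,\mathbf x'))$, $\omega(\mathbf x,\mathbf x')=\sum_i(q^ip'^i-q'^ip^i)+\varepsilon\sum_c\xi^c\xi'^c$. Its body is the classical Heisenberg group $\mathrm H_{2m}$ (real $q,p\in\mathbb R^m$, $t\in\mathbb R$). **Schrödinger representation.** Put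 $\zeta^c=\xi^c+i\xi^{c+s}$ ($1\le c\le s$). $\mathcal H_S=L^2(\mathbb R^{m|r})\otimes Hol(\mathbb C^{0|s})\simeq L^2(\mathbb R^m)\otimes\bigwedge\mathbb C^{r+s}$, i.e. functions $\varphi(q,\zeta)$ whose components along the odd variables $q^{m+1},\dots,q^{m+r},\zeta^1,\dots,\zeta^s$ lie in $L^2(\mathbb R^m)$, with its natural Hilbert topology. (As a Hilbert superspace, of parity $r$ mod 2, it carries the superhermitian inner product $\langle\varphi,\psi\rangle=(2i)^s\int dq\,d\zeta\,d\bar\zeta\,\overline{\varphi}\psi e^{\frac{i\hbar\varepsilon}{2}\zeta\bar\zeta}$, Berezin integral.) For $g=(q,p,\xi,t)$, $$(U(g)\varphi)(q_0,\zeta_0)=e^{i\hbar\left(t+(\frac12q-q_0)p+\frac\varepsilon2(\frac12\zeta-\zeta_0)\bar\zeta\right)}\varphi(q_0-q,\zeta_0-\zeta)$$ for $\varphi$ in the space $\mathcal H_S^\infty$ of smooth vectors of $U_0$, where $U_0$ is the representation of the body $\mathrm H_{2m}$ on $\mathcal H_S$ given by the same formula: $(U_0(q,p,t)\varphi)(q_0,\zeta_0)=e^{i\hbar(t+(\frac12q-q_0)p)}\varphi(q_0-q,\zeta_0)$. **Irreducibility.** The infinitesimal representation $U_*$ on $\mathcal H_S^\infty$ is $dU_0$ on the Lie algebra of the body; for an odd coordinate direction $e$, $U_*(e)$ is defined by $U(ae)=\mathbf 1+a\,U_*(e)$, where $ae$ is the group element with the single non-zero coordinate $a\in\mathcal A_1$.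 The representation is irreducible if there is no closed subspace $F$ (graded or not) with $0\ne F\ne\mathcal H_S$, $U_0(g)F\subseteq F$ for all $g\in\mathrm H_{2m}$, and $U_*(X)(F\cap\mathcal H_S^\infty)\subseteq F\cap\mathcal H_S^\infty$ for all even and odd $X$. *)

(* Defs.v *)
From HB Require Import structures.
From mathcomp Require Import all_boot all_order all_algebra.
From mathcomp Require Import all_classical all_reals all_analysis.
From mathcomp Require Import complex ring.

Set Implicit Arguments.
Unset Strict Implicit.
Unset Printing Implicit Defensive.
Import Order.TTheory GRing.Theory Num.Theory.
Import numFieldNormedType.Exports.

Local Open Scope classical_set_scope.
Local Open Scope ring_scope.

Definition rV_display : measure_display -> measure_display.
Proof. exact. Qed.

Section measurable_rV.
Context {d} {T : measurableType d} (n : nat).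

Let coors : 'I_n -> 'rV[T]_n -> T := fun i x => x ord0 i.

Let rV_set0 : g_sigma_preimage coors set0.
Proof. exact: sigma_algebra0. Qed.

Let rV_setC A : g_sigma_preimage coors A -> g_sigma_preimage coors (~` A).
Proof. exact: sigma_algebraC. Qed.

Let rV_bigcup (F : _^nat) : (forall i, g_sigma_preimage coors (F i)) ->
  g_sigma_preimage coors (\bigcup_i (F i)).
Proof. exact: sigma_algebra_bigcup. Qed.

HB.instance Definition _ := @isMeasurable.Build (rV_display d)
  'rV[T]_n (g_sigma_preimage coors) rV_set0 rV_setC rV_bigcup.

Lemma measurable_coord (i : 'I_n) :
  measurable_fun [set: 'rV[T]_n] (fun x : 'rV[T]_n => x ord0 i).
Proof.
move=> _ Y mY; rewrite setTI; apply: sub_sigma_algebra => /=.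
rewrite -bigcup_seq/=; exists i => /=; first by rewrite mem_index_enum.
by exists Y => //; rewrite setTI.
Qed.

Lemma measurable_fun_rVP d' (T' : measurableType d') (f : T' -> 'rV[T]_n) :
  (forall i, measurable_fun [set: T'] (fun x => f x ord0 i)) ->
  measurable_fun [set: T'] f.
Proof.
move=> mf _ A mA; rewrite setTI.
have : (g_sigma_preimage coors `<=` [set B | measurable (f @^-1` B)]) by
  apply: smallest_sub; [split => [|B /= mB|F /= mF]|];
  [exact: measurable0 | by rewrite setTD preimage_setC; apply: measurableC
  | by rewrite preimage_bigcup; apply: bigcup_measurable => k _
  | rewrite -bigcup_seq => B [i _ [Y mY <-]] /=; rewrite setTI -[X in measurable X]setTI;
    exact: mf].
exact.
Qed.

End measurable_rV.

Section lebesgue_rV.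
Context {R : realType}.

Definition rVcons n (u : measurableTypeR R * 'rV[R]_n) : 'rV[R]_n.+1 :=
  \row_j oapp (fun k => u.2 ord0 k) u.1 (unlift ord0 j).

Definition rVuncons n (x : 'rV[R]_n.+1) : measurableTypeR R * 'rV[R]_n :=
  (x ord0 ord0, \row_k x ord0 (lift ord0 k)).

Lemma rVconsK n : cancel (@rVcons n) (@rVuncons n).
Proof.
move=> [a x]; congr (_, _); first by rewrite mxE unlift_none.
by apply/rowP => k; rewrite !mxE liftK.
Qed.

Lemma measurable_rVcons n : measurable_fun [set: _] (@rVcons n).
Proof.
apply: measurable_fun_rVP => i.
under eq_fun do rewrite mxE.
case: unliftP => [k|] _ /=.
  by apply: (measurableT_comp (measurable_coord k)); exact: measurable_snd.
exact: measurable_fst.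
Qed.

Lemma measurable_rVuncons n : measurable_fun [set: _] (@rVuncons n).
Proof.
apply: measurable_fun_pair; first exact: measurable_coord.
apply: measurable_fun_rVP => i.
by under eq_fun do rewrite mxE; exact: measurable_coord.
Qed.

Section cons_measure.
Context (n : nat) (mu : {sigma_finite_measure set 'rV[R]_n -> \bar R}).
Local Open Scope ereal_scope.

Definition cons_measure := pushforward (lebesgue_measure \x mu) (@rVcons n).

Let cons_measure0 : cons_measure set0 = 0.
Proof. by rewrite /cons_measure/pushforward preimage_set0 measure0. Qed.

Let cons_measure_ge0 A : 0 <= cons_measure A.
Proof. by rewrite /cons_measure /pushforward measure_ge0. Qed.

Let cons_measure_sigma_additive : semi_sigma_additive cons_measure.
Proof.
have m_ A : measurable A -> measurable (@rVcons n @^-1` A).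
  by move=> mA; rewrite -[X in measurable X]setTI; exact: measurable_rVcons.
move=> F mF tF mUF; rewrite /cons_measure /pushforward preimage_bigcup.
apply: measure_semi_sigma_additive.
- by move=> k; exact: m_.
- apply/trivIsetP => /= i j _ _ ij; rewrite -preimage_setI.
  by move/trivIsetP : tF => /(_ _ _ _ _ ij) ->//; rewrite preimage_set0.
- by rewrite -preimage_bigcup; exact: m_.
Qed.

HB.instance Definition _ := isMeasure.Build _ _ _ cons_measure
  cons_measure0 cons_measure_ge0 cons_measure_sigma_additive.

Let cons_measure_sigma_finite : sigma_finite setT cons_measure.
Proof.
have /sigma_finiteP[F [TF ndF Foo]] := sigma_finiteT (@lebesgue_measure R).
have /sigma_finiteP[G [TG ndG Goo]] := sigma_finiteT mu.
exists (fun k => @rVuncons n @^-1` (F k `*` G k)).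
  rewrite -preimage_bigcup (_ : \bigcup_k _ = setT) ?preimage_setT//.
  apply/seteqP; split=> // -[x y] _.
  have [i _ Fix] : (\bigcup_i F i) x by rewrite -TF.
  have [j _ Gjy] : (\bigcup_i G i) y by rewrite -TG.
  exists (maxn i j) => //; split.
  - by move: x Fix; exact/subsetPset/ndF/leq_maxl.
  - by move: y Gjy; exact/subsetPset/ndG/leq_maxr.
move=> k; have [mF Fk] := Foo k; have [mG Gk] := Goo k; split.
  rewrite -[X in measurable X]setTI; apply: measurable_rVuncons => //.
  exact: measurableX.
rewrite /cons_measure /pushforward -comp_preimage.
rewrite (_ : _ \o _ = id) ?preimage_id; last by apply/funext => u; exact: rVconsK.
by rewrite product_measure1E// lte_mul_pinfty// ge0_fin_numE.
Qed.

HB.instance Definition _ := Measure_isSigmaFinite.Build _ _ _ cons_measure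
  cons_measure_sigma_finite.

End cons_measure.

Fixpoint lebesgue_rV n : {sigma_finite_measure set 'rV[R]_n -> \bar R} :=
  match n with
  | 0 => \d_(0 : 'rV[R]_0)
  | n'.+1 => cons_measure (lebesgue_rV n')
  end.

Lemma lebesgue_rV_box n (A : 'I_n -> set (measurableTypeR R)) :
  (forall i, measurable (A i)) ->
  lebesgue_rV n [set x | forall i, A i (x ord0 i)] =
  (\prod_(i < n) lebesgue_measure (A i))%E.
Proof.
elim: n A => [|n IHn] A mA.
  by rewrite big_ord0 /= diracE mem_set// => -[].
rewrite big_ord_recl -(IHn (fun i => A (lift ord0 i)))//.
rewrite /= /cons_measure /pushforward.
have -> : @rVcons n @^-1` [set x | forall i, A i (x ord0 i)] =
    A ord0 `*` [set x : 'rV[R]_n | forall i, A (lift ord0 i) (x ord0 i)].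
  apply/seteqP; split=> -[a x] /=.
    move=> h; split; first by have := h ord0; rewrite mxE unlift_none.
    by move=> i; have := h (lift ord0 i); rewrite mxE liftK.
  by move=> [h0 h] i; rewrite mxE; case: unliftP => [k|] ->.
rewrite product_measure1E//.
rewrite (_ : [set _ | _] = \bigcap_(i in [set: 'I_n])
  ((fun x : 'rV[R]_n => x ord0 i) @^-1` A (lift ord0 i))); last first.
  by apply/seteqP; split=> x /= h i; [move=> _|]; exact: h.
apply: fin_bigcap_measurable => // i _.
by rewrite -[X in measurable X]setTI; exact: (measurable_coord i _ (mA _)).
Qed.

End lebesgue_rV.

Record superalgebra (R : realType) := SuperAlgebra {
  sa_sort :> algType R;
  (* homogeneous components, indexed by parity ([true] is odd) *)
  sa_deg : bool -> set sa_sort;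
  sa_deg0 : forall b, sa_deg b 0;
  sa_degP : forall b (c : R) x y,
    sa_deg b x -> sa_deg b y -> sa_deg b (c *: x + y);
  sa_direct : forall x, exists! y : sa_sort * sa_sort,
    [/\ sa_deg false y.1, sa_deg true y.2 & x = y.1 + y.2];
  sa_deg1 : sa_deg false 1;
  sa_degM : forall b b' x y,
    sa_deg b x -> sa_deg b' y -> sa_deg (b (+) b') (x * y);
  sa_supercomm : forall b b' x y,
    sa_deg b x -> sa_deg b' y -> x * y = (-1) ^+ (b && b') * (y * x);
  (* the quotient by the nilpotent elements is the field of real numbers *)
  sa_body : {lrmorphism sa_sort -> R^o};
  sa_bodyP : forall x, sa_body x = 0 <-> exists n, x ^+ n = 0;
  sa_free : forall n, (0 < n)%N -> exists a : 'I_n -> sa_sort,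
    (forall i, sa_deg true (a i)) /\ \prod_(i < n) a i != 0
}.

(* [cpx A] is the complexification of A; (a, b) stands for a + i b. *)
Definition cpx (A : Type) : Type := (A * A)%type.

Section complexification.
Context {A : nzRingType}.

HB.instance Definition _ := GRing.Zmodule.copy (cpx A) (A * A)%type.

Definition cpx_one : cpx A := (1, 0).

Definition cpx_mul (x y : cpx A) : cpx A :=
  (x.1 * y.1 - x.2 * y.2, x.1 * y.2 + x.2 * y.1).

Let cpx_mulA : associative cpx_mul.
Proof.
move=> [a b] [c d] [e f]; rewrite /cpx_mul /=.
congr (_, _); rewrite !(mulrBl, mulrBr, mulrDl, mulrDr) !mulrA.
  by rewrite !opprD [in LHS](addrC (- (b * c * f))) [LHS]addrACA.
by rewrite [RHS]addrACA (addrC (- (b * d * f))).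
Qed.

Let cpx_mul1 : left_id cpx_one cpx_mul.
Proof. by move=> [a b]; rewrite /cpx_mul/= !mul0r !mul1r subr0 addr0. Qed.

Let cpx_mulr1 : right_id cpx_one cpx_mul.
Proof. by move=> [a b]; rewrite /cpx_mul/= !mulr0 !mulr1 subr0 add0r. Qed.

Let cpx_mulDl : left_distributive cpx_mul +%R.
Proof.
move=> [a b] [c d] [e f]; congr (_, _) => /=; rewrite !mulrDl.
  by rewrite opprD addrACA.
by rewrite addrACA.
Qed.

Let cpx_mulDr : right_distributive cpx_mul +%R.
Proof.
move=> [a b] [c d] [e f]; congr (_, _) => /=; rewrite !mulrDr.
  by rewrite opprD addrACA.
by rewrite addrACA.
Qed.

Let cpx_oner_neq0 : cpx_one != 0 :> cpx A.
Proof. by apply/eqP => -[/eqP]; rewrite oner_eq0. Qed.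

HB.instance Definition _ := GRing.Zmodule_isNzRing.Build (cpx A)
  cpx_mulA cpx_mul1 cpx_mulr1 cpx_mulDl cpx_mulDr cpx_oner_neq0.

Definition cpx_real (a : A) : cpx A := (a, 0).

Definition cpx_conj (x : cpx A) : cpx A := (x.1, - x.2).

End complexification.

Section superfunctions.
Context {R : realType} (A : superalgebra R).

Definition cpx_const (z : R[i]) : cpx A :=
  ((complex.Re z)%:A, (complex.Im z)%:A).

Definition cpx_body (x : cpx A) : R[i] :=
  ((sa_body A x.1 : R) +i* (sa_body A x.2 : R))%C.

Definition cis (x : R) : R[i] := (cos x +i* sin x)%C.

(* All sums over infinite index sets below have finitely many nonzero terms,
   because even elements of A with zero body are nilpotent and commute. *)
Definition cpx_exp (x : cpx A) : cpx A :=
  let b := cpx_body x in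
  cpx_const ((expR (complex.Re b))%:C%C * cis (complex.Im b)) *
  \sum_(k \in [set: nat])
    cpx_const (k`!%:R^-1) * (x - cpx_const b) ^+ k.

Section body_functions.
Context {m : nat}.

Fixpoint Ck (k : nat) (f : 'rV[R]_m -> R) : Prop :=
  continuous f /\
  if k is k'.+1 then
    forall v, (forall x, derivable f x v) /\ Ck k' ('D_v f)
  else True.

Definition smooth (f : 'rV[R]_m -> R[i]) : Prop :=
  forall k, Ck k (fun x => complex.Re (f x)) /\ Ck k (fun x => complex.Im (f x)).

Definition mderive (al : {ffun 'I_m -> nat}) (f : 'rV[R]_m -> R) :
    'rV[R]_m -> R :=
  foldr (fun i g => iter (al i) (fun h => 'D_(delta_mx ord0 i) h) g) f
    (enum 'I_m).

Definition mderiveC al (f : 'rV[R]_m -> R[i]) (x : 'rV[R]_m) : R[i] :=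
  (mderive al (fun y => complex.Re (f y)) x +i*
   mderive al (fun y => complex.Im (f y)) x)%C.

(* the value of a smooth function at a point with coordinates in the even
   part of A, by Taylor expansion at the body of that point *)
Definition taylor (f : 'rV[R]_m -> R[i]) (x : 'I_m -> A) : cpx A :=
  \sum_(al \in [set: {ffun 'I_m -> nat}])
    cpx_const (mderiveC al f (\row_i sa_body A (x i)) *
               ((\prod_i (al i)`!)%:R^-1)) *
    cpx_real (\prod_i (x i - (sa_body A (x i) : R)%:A) ^+ al i).

End body_functions.

Section heisenberg_supergroup.
Context {m r s : nat}.

Record heis := Heis {
  hq : 'I_m -> A; hqo : 'I_r -> A;
  hp : 'I_m -> A; hpo : 'I_r -> A;
  hxi : 'I_(s + s) -> A;
  ht : A }.

Definition in_heis (g : heis) : Prop :=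
  [/\ (forall i, sa_deg false (hq g i)) /\ (forall j, sa_deg true (hqo g j)),
      (forall i, sa_deg false (hp g i)) /\ (forall j, sa_deg true (hpo g j)),
      (forall c, sa_deg true (hxi g c)) &
      sa_deg false (ht g)].

Definition heis_omega (eps : int) (g h : heis) : A :=
  \sum_i (hq g i * hp h i - hq h i * hp g i) +
  \sum_j (hqo g j * hpo h j - hqo h j * hpo g j) +
  (\sum_c hxi g c * hxi h c) *~ eps.

Definition heis_mul (eps : int) (g h : heis) : heis := {|
  hq := fun i => hq g i + hq h i; hqo := fun j => hqo g j + hqo h j;
  hp := fun i => hp g i + hp h i; hpo := fun j => hpo g j + hpo h j;
  hxi := fun c => hxi g c + hxi h c;
  ht := ht g + ht h + (2^-1 : R) *: heis_omega eps g h |}.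

Lemma sa_degD b (x y : A) : sa_deg b x -> sa_deg b y -> sa_deg b (x + y).
Proof. by move=> hx hy; rewrite -[x]scale1r; exact: sa_degP. Qed.

Lemma sa_degZ b (c : R) (x : A) : sa_deg b x -> sa_deg b (c *: x).
Proof. by move=> hx; rewrite -[_ *: _]addr0; exact/sa_degP/sa_deg0. Qed.

Lemma sa_degB b (x y : A) : sa_deg b x -> sa_deg b y -> sa_deg b (x - y).
Proof. by move=> hx hy; rewrite addrC -scaleN1r; exact: sa_degP. Qed.

Lemma sa_deg_sum b (I : finType) (F : I -> A) :
  (forall i, sa_deg b (F i)) -> sa_deg b (\sum_i F i).
Proof.
by move=> hF; elim/big_ind : _ => // [|x y]; [exact: sa_deg0|exact: sa_degD].
Qed.

Lemma sa_body_odd (x : A) : sa_deg true x -> sa_body A x = 0.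
Proof.
move=> hx; apply/sa_bodyP; exists 2; rewrite expr2.
have /eqP := sa_supercomm hx hx.
rewrite expr1 mulN1r -addr_eq0 -mulr2n -scaler_nat scaler_eq0 pnatr_eq0 /=.
by move/eqP.
Qed.

Lemma in_heis_mul (eps : int) (g h : heis) :
  in_heis g -> in_heis h -> in_heis (heis_mul eps g h).
Proof.
move=> [[q0 q1] [p0 p1] x1 t0] [[q0' q1'] [p0' p1'] x1' t0'].
split=> /=; [split=> i; exact: sa_degD|split=> i; exact: sa_degD| |].
  by move=> c; exact: sa_degD.
have M b (x y : A) : sa_deg b x -> sa_deg b y -> sa_deg false (x * y).
  by move=> hx hy; rewrite -(addbb b); exact: sa_degM.
apply: sa_degD; first exact: sa_degD.
apply: sa_degZ; rewrite /heis_omega -scaler_int; apply: sa_degD.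
  by apply: sa_degD; apply: sa_deg_sum => i; apply: sa_degB; exact: M.
by apply: sa_degZ; apply: sa_deg_sum => c; exact: M.
Qed.

Definition hzeta (g : heis) (c : 'I_s) : cpx A :=
  (hxi g (lshift s c), hxi g (rshift s c)).

(* odd coordinate directions, in the order q, p, xi *)
Definition odd_dir : finType := ('I_r + 'I_r + 'I_(s + s))%type.

(* the group element whose only non-zero coordinate is a, along e *)
Definition odd_elt (e : odd_dir) (a : A) : heis := {|
  hq := fun=> 0;
  hqo := fun j => if e is inl (inl j') then (if j == j' then a else 0) else 0;
  hp := fun=> 0;
  hpo := fun j => if e is inl (inr j') then (if j == j' then a else 0) else 0;
  hxi := fun c => if e is inr c' then (if c == c' then a else 0) else 0;
  ht := 0 |}.

Lemma in_heis_odd_elt e (a : A) : sa_deg true a -> in_heis (odd_elt e a).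
Proof.
move=> ha; have h0 b : sa_deg b (0 : A) by exact: sa_deg0.
by split; [split|split| |] => // i /=; case: e => [[j|j]|j] //=; case: eqP.
Qed.

(* the points (q0, zeta0) on which the functions of the representation space
   are defined *)
Record spoint := Spoint {
  pq : 'I_m -> A; pqo : 'I_r -> A; pzeta : 'I_s -> cpx A }.

Definition in_spoint (z : spoint) : Prop :=
  [/\ forall i, sa_deg false (pq z i), forall j, sa_deg true (pqo z j) &
      forall c, sa_deg true (pzeta z c).1 /\ sa_deg true (pzeta z c).2].

Definition spoint_sub (z : spoint) (g : heis) : spoint := {|
  pq := fun i => pq z i - hq g i; pqo := fun j => pqo z j - hqo g j;
  pzeta := fun c => pzeta z c - hzeta g c |}.

Definition schrodinger_phase (hbar : R) (eps : int) (g : heis) (z : spoint) :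
    cpx A :=
  cpx_const (0 +i* hbar)%C *
  (cpx_real (ht g
     + \sum_i ((2^-1 : R) *: hq g i - pq z i) * hp g i
     + \sum_j ((2^-1 : R) *: hqo g j - pqo z j) * hpo g j)
   + cpx_const (eps%:~R / 2) *
     \sum_c (cpx_const 2^-1 * hzeta g c - pzeta z c) * cpx_conj (hzeta g c)).

Definition schrodinger_U (hbar : R) (eps : int) (g : heis)
    (Phi : spoint -> cpx A) (z : spoint) : cpx A :=
  cpx_exp (schrodinger_phase hbar eps g z) * Phi (spoint_sub z g).

End heisenberg_supergroup.
End superfunctions.
Arguments heis {R} A m r s.
Arguments in_heis {R A m r s} g.
Arguments spoint {R} A m r s.
Arguments odd_elt {R A m r s} e a.

(* A function of (q0, zeta0) is the family, indexed by the subsets I of the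
   r + s odd variables, of its coefficients phi I (q0) in front of the
   monomial in these variables with indices I taken in increasing order;
   the first r odd variables are those of q0. *)
Notation sfun R m r s := ({set 'I_(r + s)} -> 'rV[R]_m -> R[i]).

Section representation_space.
Context {R : realType} {m r s : nat}.
Implicit Types phi psi : sfun R m r s.

Definition superfun (A : superalgebra R) phi (z : spoint A m r s) : cpx A :=
  let theta (i : 'I_(r + s)) := match fintype.split i with
    | inl j => cpx_real (pqo z j)
    | inr c => pzeta z c
    end in
  \sum_(I : {set 'I_(r + s)})
    taylor (phi I) (pq z) * \prod_(i in I) theta i.

(* square of the Hilbert norm *)
Definition L2sq phi : \bar R :=
  (\sum_(I : {set 'I_(r + s)}) \int[lebesgue_rV m]_x
     (complex.Re (phi I x) ^+ 2 + complex.Im (phi I x) ^+ 2)%:E)%E.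

(* Elements of the representation space are square-integrable functions;
   equality there is equality almost everywhere, i.e. L2sq (phi - psi) = 0. *)
Definition HS : set (sfun R m r s) := [set phi |
  [/\ forall I, measurable_fun setT (fun x => complex.Re (phi I x)),
      forall I, measurable_fun setT (fun x => complex.Im (phi I x)) &
      (L2sq phi < +oo)%E]].

Definition L2cvg {T : Type} (F : set_system T) (u : T -> sfun R m r s) phi :=
  L2sq (u x - phi) @[x --> F] --> 0%E.

Definition closed_subspace (F : set (sfun R m r s)) : Prop :=
  [/\ F `<=` HS, F 0,
      forall (c : R[i]) phi psi, F phi -> F psi -> F (c *: phi + psi) &
      forall (u : nat -> sfun R m r s) phi,
        (forall n, F (u n)) -> HS phi -> L2cvg \oo u phi -> F phi].

(* The body group: points (q, p, t); it is also its own Lie algebra. *)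
Definition bheis := ('rV[R]_m * 'rV[R]_m * R)%type.

Definition dot (q p : 'rV[R]_m) : R := \sum_i q ord0 i * p ord0 i.

Definition bheis_mul (g h : bheis) : bheis :=
  (g.1.1 + h.1.1, g.1.2 + h.1.2,
   g.2 + h.2 + 2^-1 * (dot g.1.1 h.1.2 - dot h.1.1 g.1.2)).

Definition heis_body (A : superalgebra R) (g : heis A m r s) : bheis :=
  (\row_i (sa_body A (hq g i) : R), \row_i (sa_body A (hp g i) : R),
   sa_body A (ht g) : R).

Lemma heis_body_mul (A : superalgebra R) (eps : int) (g h : heis A m r s) :
  in_heis g -> in_heis h ->
  heis_body (heis_mul eps g h) = bheis_mul (heis_body g) (heis_body h).
Proof.
move=> [[_ qo] [_ po] xo _] [[_ qo'] [_ po'] xo' _].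
congr (_, _, _); try by apply/rowP => i; rewrite !mxE rmorphD.
rewrite /= !rmorphD/= linearZ/=; congr (_ + _ * _).
rewrite /heis_omega 2!rmorphD/= rmorphMz/= !rmorph_sum/=.
rewrite [X in _ + X + _]big1 ?addr0; last first.
  by move=> j _; rewrite rmorphB !rmorphM/= !sa_body_odd// !mul0r subr0.
rewrite [X in X *~ _]big1/= ?mul0rz ?addr0; last first.
  by move=> j _; rewrite rmorphM/= !sa_body_odd// mul0r.
rewrite /dot -sumrB; apply: eq_bigr => i _.
by rewrite rmorphB !rmorphM/= !mxE.
Qed.

Definition U0 (hbar : R) (g : bheis) phi : sfun R m r s := fun I x =>
  cis (hbar * (g.2 + dot (2^-1 *: g.1.1 - x) g.1.2)) * phi I (x - g.1.1).

Lemma cisD (x y : R) : cis (x + y) = cis x * cis y.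
Proof.
rewrite /cis cosD sinD; apply/eqP; rewrite eq_complex/=.
by rewrite eqxx/= addrC.
Qed.

Lemma U0_mul (hbar : R) (g h : bheis) phi :
  U0 hbar (bheis_mul g h) phi = U0 hbar g (U0 hbar h phi).
Proof.
apply/funext => I; apply/funext => x; rewrite /U0 mulrA -cisD -mulrDr.
congr (cis (hbar * _) * phi I _); last by rewrite opprD addrA.
have dD u v w : dot (u + v) w = dot u w + dot v w.
  by rewrite /dot -big_split/=; apply: eq_bigr => i _; rewrite mxE mulrDl.
have dDr u v w : dot w (u + v) = dot w u + dot w v.
  by rewrite /dot -big_split/=; apply: eq_bigr => i _; rewrite mxE mulrDr.
have dN u w : dot (- u) w = - dot u w.
  by rewrite /dot -sumrN; apply: eq_bigr => i _; rewrite mxE mulNr.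
have dZ c u w : dot (c *: u) w = c * dot u w.
  by rewrite /dot mulr_sumr; apply: eq_bigr => i _; rewrite mxE mulrA.
rewrite /= !(dD, dDr, dN, dZ); by field.
Qed.

Fixpoint L2Ck (k : nat) (f : bheis -> sfun R m r s) : Prop :=
  [/\ forall g, HS (f g), forall g, L2cvg (nbhs g) f (f g) &
  if k is k'.+1 then
    forall X : bheis, exists f' : bheis -> sfun R m r s,
      (forall g, L2cvg (0 : R)^'
        (fun h => (h^-1)%:C%C *: (f (h *: X + g) - f g)) (f' g)) /\
      L2Ck k' f'
  else True].

Definition smooth_vector (hbar : R) : set (sfun R m r s) :=
  [set phi | forall k, L2Ck k (fun g => U0 hbar g phi)].

(* [Ueven hbar X phi psi]: psi represents dU0(X) phi *)
Definition Ueven (hbar : R) (X : bheis) phi psi : Prop :=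
  HS psi /\ L2cvg (0 : R)^'
    (fun h => (h^-1)%:C%C *: (U0 hbar (h *: X) phi - phi)) psi.

Definition ae_eq_sfun phi psi : Prop :=
  forall I, {ae lebesgue_rV m, forall x, phi I x = psi I x}.

(* [Uodd1 A hbar eps e phi psi]: psi represents U_*(e) phi, as defined by
   U(ae) = 1 + a U_*(e); superfunctions are evaluated through the smooth
   representatives phi' and psi'. *)
Definition Uodd1 (A : superalgebra R) (hbar : R) (eps : int)
    (e : @odd_dir r s) phi psi : Prop :=
  [/\ smooth_vector hbar phi, smooth_vector hbar psi &
  exists phi' psi' : sfun R m r s,
    [/\ ae_eq_sfun phi phi', ae_eq_sfun psi psi',
        (forall I, smooth (phi' I)), (forall I, smooth (psi' I)) &
        forall (a : A) (z : spoint A m r s), sa_deg true a -> in_spoint z ->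
          schrodinger_U hbar eps (odd_elt e a) (superfun phi') z =
          superfun phi' z + cpx_real a * superfun psi' z]].

(* A general odd element of the Lie superalgebra is the combination of the
   odd coordinate directions with real coefficients X. *)
Definition Uodd (A : superalgebra R) (hbar : R) (eps : int)
    (X : @odd_dir r s -> R) phi psi : Prop :=
  exists psi_ : @odd_dir r s -> sfun R m r s,
    (forall e, Uodd1 A hbar eps e phi (psi_ e)) /\
    psi = \sum_e (X e)%:C%C *: psi_ e.

Definition schrodinger_irreducible (A : superalgebra R) (hbar : R)
    (eps : int) : Prop :=
  let Hoo := smooth_vector hbar in
  ~ exists F : set (sfun R m r s),
    [/\ closed_subspace F,
        exists phi, F phi /\ L2sq phi != 0%E,
        exists phi, HS phi /\ ~ F phi,
        forall g phi, F phi -> F (U0 hbar g phi) &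
        (forall X phi psi, (F `&` Hoo) phi -> Ueven hbar X phi psi ->
           (F `&` Hoo) psi) /\
        (forall X phi psi, (F `&` Hoo) phi -> Uodd A hbar eps X phi psi ->
           (F `&` Hoo) psi)].

End representation_space.

(* Main.v *)
Require Import Defs.
From HB Require Import structures.
From mathcomp Require Import all_boot all_order all_algebra.
From mathcomp Require Import all_classical all_reals all_analysis.
From mathcomp Require Import measurable_realfun complex ring lra.
Import Defs.
Import Order.TTheory GRing.Theory Num.Theory.
Import numFieldNormedType.Exports.

(** A closed subspace F invariant under the operators of the body group is stable under
    multiplication by the characters exp(i p.x), hence by all bounded measurable
    functions: the multipliers of F form an algebra closed under bounded pointwise limits,
    the iterates of (3y - y^3)/2 turn sin((x_i - a)/n) into its sign, and letting n grow
    yields the indicators of halfspaces.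

    Given phi <> 0 in F, cut down to a cube so that w, the integral of phi, is not 0, the
    tensor T = 1_Q (x) w is an average of the cut translates 1_Q phi(. + q) of phi.  If f in
    F nearly minimises the distance to T, then T - f is almost orthogonal to F, hence to T
    itself, so that T lies in F; no completeness is needed.  Multiplying and
    passing to the limit, g (x) w lies in F for a Gaussian g.  This is a smooth vector, so
    the odd operators apply to it and act on w as the multiplications by, and the
    derivations along, the r + s odd variables.  These generate all endomorphisms of the
    exterior algebra, so F contains g (x) w for all w, and by multiplication everything. *)

Set Implicit Arguments.
Unset Strict Implicit.
Unset Printing Implicit Defensive.
Local Open Scope classical_set_scope.
Local Open Scope ring_scope.

(** * Lebesgue measure on row vectors *)

(** The odd operators are defined through smooth representatives and Taylor expansions, so they say
    something only about vectors whose smoothness has been established, and nothing provides this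
    for a given element of F. The usual remedy, smoothing by convolution over the group, requires
    vector-valued integrals. Here one explicit smooth family is brought into F instead: the tensors
    g (x) w, on which the even and odd structures separate and everything can be computed. The
    average over translates is likewise used only weakly, through its inner products with a test
    vector.

    The Gaussian has no zeros. Division by it is an unbounded multiplication, which F allows as soon
    as the product is square-integrable, and this recovers each component of an arbitrary vector.

    The assumption hbar <> 0 enters twice: only then does the body group yield characters of all
    frequencies, and only then do the multiplications by odd variables occur in the odd operators
    with nonzero coefficients. *)

Section rV_measure.
Context {R : realType}.

Lemma measurable_rVD n (q : 'rV[R]_n) :
  measurable_fun [set: 'rV[R]_n] (fun x => x + q).
Proof.
apply: measurable_fun_rVP => i; under eq_fun do rewrite mxE.
by apply: measurable_funD => //; exact: measurable_coord.
Qed.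

Lemma measurable_rVD2 n :
  measurable_fun [set: 'rV[R]_n * 'rV[R]_n] (fun z => z.1 + z.2).
Proof.
apply: measurable_fun_rVP => i; under eq_fun do rewrite mxE.
apply: measurable_funD.
  by apply: (measurableT_comp (measurable_coord i)); exact: measurable_fst.
by apply: (measurableT_comp (measurable_coord i)); exact: measurable_snd.
Qed.

Lemma lebesgue_measure_shift (a : R) (A : set (measurableTypeR R)) :
  measurable A -> lebesgue_measure ((fun x : measurableTypeR R => x + a) @^-1` A) =
  lebesgue_measure A.
Proof.
move=> mA; have ms : measurable_fun [set: measurableTypeR R]
  (fun x : measurableTypeR R => (x + a : measurableTypeR R)).
  by apply: measurable_funD.
pose s : {mfun measurableTypeR R >-> measurableTypeR R} :=
  HB.pack (fun x : measurableTypeR R => (x + a : measurableTypeR R))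
  (isMeasurableFun.Build _ _ _ _ _ ms).
apply/esym.
apply: (@lebesgue_measure_unique _ (pushforward lebesgue_measure s)) => // X.
move=> [[b c] _ <-] /=; rewrite /pushforward.
have -> : s @^-1` `]b, c]%classic = `]b - a, c - a]%classic.
  by apply/seteqP; split=> x /=; rewrite !in_itv/= ltrBlDr lerBrDr.
rewrite !lebesgue_measure_itv/= !lte_fin ltrD2r.
by case: ifP => // _; rewrite -!EFinB; congr (_%:E); ring.
Qed.

(** Through [rVcons] a translation becomes a product of translations, and a product measure is
    determined by its values on rectangles. *)
Lemma lebesgue_rV_shift n (q : 'rV[R]_n) (A : set 'rV[R]_n) : measurable A ->
  lebesgue_rV n ((fun x => x + q) @^-1` A) = lebesgue_rV n A.
Proof.
elim: n q A => [|n IHn] q A mA.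
  congr (lebesgue_rV 0 _); apply/seteqP; split => x /=;
  by rewrite [x]thinmx0 [_ + _]thinmx0.
rewrite /= /cons_measure /pushforward.
pose u := rVuncons q.
pose T := (measurableTypeR R * 'rV[R]_n)%type.
pose s (z : T) : T := (z.1 + u.1 : measurableTypeR R, z.2 + u.2).
have ms : measurable_fun [set: T] s.
  apply: measurable_fun_pair.
    by apply: measurable_funD => //; exact: measurable_fst.
  apply: (measurableT_comp (measurable_rVD u.2)); exact: measurable_snd.
have -> : @rVcons R n @^-1` ((fun x => x + q) @^-1` A) = s @^-1` (@rVcons R n @^-1` A).
  apply/seteqP; split => -[a x] /=; rewrite (_ : _ + q = rVcons (s (a, x)))//;
  by apply/rowP => i; rewrite !mxE; case: unliftP => [j|] -> /=; rewrite ?mxE.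
have mB : measurable (@rVcons R n @^-1` A).
  by rewrite -[X in measurable X]setTI; exact: measurable_rVcons.
set B := _ @^-1` A in mB *.
pose s' : {mfun T >-> T} := HB.pack s (isMeasurableFun.Build _ _ _ _ _ ms).
apply/esym/(@product_measure_unique _ _ _ _ _ _ _
  (pushforward (lebesgue_measure \x lebesgue_rV n)%E s')) => //.
move=> C D mC mD; rewrite /pushforward /=.
transitivity ((lebesgue_measure \x lebesgue_rV n)%E
  (((fun x : measurableTypeR R => x + u.1) @^-1` C) `*`
   ((fun x => x + u.2) @^-1` D))) => //.
rewrite product_measure1E.
- by rewrite IHn//; congr (_ * _)%E; exact: lebesgue_measure_shift.
- by rewrite -[X in measurable X]setTI; apply: measurable_funD => //.
- by rewrite -[X in measurable X]setTI; apply: measurable_rVD.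
Qed.

Lemma ge0_integral_shift n (q : 'rV[R]_n) (f : 'rV[R]_n -> \bar R) :
  measurable_fun setT f -> (forall x, 0 <= f x)%E ->
  (\int[lebesgue_rV n]_x f (x + q)%R = \int[lebesgue_rV n]_x f x)%E.
Proof.
move=> mf f0.
have := @ge0_integral_pushforward _ _ _ _ R _ (measurable_rVD q) (lebesgue_rV n)
  setT f measurableT mf (fun y _ => f0 y).
rewrite preimage_setT => <-.
apply: eq_measure_integral => [_ A mA|? A mA _]; first exact: measurable_rVD.
exact: lebesgue_rV_shift.
Qed.

Lemma integrable_shift n (q : 'rV[R]_n) (f : 'rV[R]_n -> \bar R) :
  (lebesgue_rV n).-integrable setT f ->
  (lebesgue_rV n).-integrable setT (fun x => f (x + q)).
Proof.
move=> /integrableP[mf foo]; apply/integrableP; split.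
  exact: (measurableT_comp mf (measurable_rVD q)).
rewrite (ge0_integral_shift q (f := fun x => `|f x|%E))//.
exact: measurableT_comp.
Qed.

Lemma integral_shift n (q : 'rV[R]_n) (f : 'rV[R]_n -> \bar R) :
  (lebesgue_rV n).-integrable setT f ->
  (\int[lebesgue_rV n]_x f (x + q)%R = \int[lebesgue_rV n]_x f x)%E.
Proof.
move=> fi; have mf := measurable_int _ fi.
rewrite [LHS]integralE [RHS]integralE; congr (_ - _)%E.
  rewrite -[RHS](ge0_integral_shift q); last 2 first.
  - exact: measurable_funepos.
  - by move=> x; rewrite funepos_ge0.
  by apply: eq_integral => x _; rewrite !funeposE.
rewrite -[RHS](ge0_integral_shift q); last 2 first.
- exact: measurable_funeneg.
- by move=> x; rewrite funeneg_ge0.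
by apply: eq_integral => x _; rewrite !funenegE.
Qed.

(** The norm of the library on row vectors is the maximum norm; the sum of squares is what makes a
    Gaussian factor over the coordinates. *)
Definition sqn n (x : 'rV[R]_n) : R := \sum_i x ord0 i ^+ 2.

Lemma sqn_ge0 n (x : 'rV[R]_n) : 0 <= sqn x.
Proof. by apply: sumr_ge0 => i _; exact: sqr_ge0. Qed.

Lemma measurable_sqn n : measurable_fun [set: 'rV[R]_n] (@sqn n).
Proof.
apply: measurable_sum => i.
by apply: measurable_funX; exact: measurable_coord.
Qed.

(** By Tonelli the integral splits off a one-dimensional Gaussian integral at each step of the
    induction. *)
Lemma gauss_rV_lty n :
  (\int[lebesgue_rV n]_x (expR (- sqn x))%:E < +oo :> \bar R)%E.
Proof.
have m k : measurable_fun [set: 'rV[R]_k] (fun x => (expR (- sqn x))%:E).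
  apply/measurable_EFinP; apply: measurableT_comp => //.
  exact: (measurableT_comp _ (@measurable_sqn k)).
elim: n => [|n IHn].
  rewrite integral_dirac//; last exact: m.
  by rewrite diracE mem_set// mul1e ltry.
rewrite /= /cons_measure.
have /= -> := @ge0_integral_pushforward _ _ _ _ R _ (@measurable_rVcons R n)
  (lebesgue_measure \x lebesgue_rV n)%E
  setT (fun x => (expR (- sqn x))%:E) measurableT (m _) (fun y _ => expR_ge0 _).
rewrite preimage_setT.
have E (z : measurableTypeR R * 'rV[R]_n) : (expR (- sqn (rVcons z)))%:E =
   ((gauss_fun z.1)%:E * (expR (- sqn z.2))%:E)%E.
  rewrite -EFinM -expRD; congr (expR _)%:E.
  rewrite /sqn big_ord_recl mxE unlift_none/= opprD; congr (_ - _).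
  by apply: eq_bigr => i _; rewrite mxE liftK.
under eq_integral do rewrite /= E.
rewrite fubini_tonelli1; last 2 first.
- apply: emeasurable_funM.
    apply/measurable_EFinP; apply: (measurableT_comp measurable_gauss_fun).
    exact: measurable_fst.
  by apply: (measurableT_comp (m n)); exact: measurable_snd.
- by move=> x; rewrite mule_ge0// lee_fin ?expR_ge0// gauss_fun_ge0.
rewrite /fubini_F/=.
have i0 : (0 <= \int[lebesgue_rV n]_x (expR (- sqn x))%:E)%E.
  by apply: integral_ge0 => x _; rewrite lee_fin expR_ge0.
have eG x : (\int[lebesgue_rV n]_y ((gauss_fun x)%:E * (expR (- sqn y))%:E))%E =
    ((gauss_fun x)%:E * \int[lebesgue_rV n]_x (expR (- sqn x))%:E)%E.
  apply: ge0_integralZl => //; try exact: m.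
  by rewrite ?lee_fin gauss_fun_ge0.
under eq_integral do rewrite eG.
rewrite ge0_integralZr//.
- by rewrite integralT_gauss lte_mul_pinfty ?lee_fin ?sqrtr_ge0.
- by apply/measurable_EFinP; exact: measurable_gauss_fun.
- by move=> y _; rewrite lee_fin gauss_fun_ge0.
Qed.

Definition cube n (K : R) : set 'rV[R]_n :=
  [set x | forall i, (`[- K, K]%classic : set R) (x ord0 i)].

Lemma measurable_cube n K : measurable (@cube n K).
Proof.
rewrite (_ : cube _ = \bigcap_(i in [set: 'I_n])
  ((fun x : 'rV[R]_n => x ord0 i) @^-1` `[-K, K]%classic)); last first.
  by apply/seteqP; split=> x /= h i; [move=> _|]; exact: h.
apply: fin_bigcap_measurable => // i _.
rewrite -[X in measurable X]setTI; exact: (measurable_coord i).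
Qed.

Lemma cube_lty n K : (lebesgue_rV n (@cube n K) < +oo)%E.
Proof.
rewrite (@lebesgue_rV_box _ n (fun=> `[- K, K]%classic))//.
suff : (0 <= \prod_(i < n) lebesgue_measure (`[(- K)%R, K%R]%classic : set R) < +oo)%E.
  by case/andP.
elim/big_ind : _ => [|x y /andP[x0 xo] /andP[y0 yo]|i _].
- by rewrite lee01 ltry.
- by rewrite mule_ge0// lte_mul_pinfty// ge0_fin_numE.
- by rewrite measure_ge0 lebesgue_measure_itv/=; case: ifP => // _; rewrite -EFinB ltry.
Qed.

Lemma cubeP n (x : 'rV[R]_n) : exists K0, forall K, K0 <= K -> cube K x.
Proof.
exists (\sum_i `|x ord0 i|) => K hK i /=; rewrite in_itv/= -ler_norml.
by apply: le_trans hK; rewrite (bigD1 i)//= lerDl sumr_ge0.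
Qed.

(** Each coordinate generates its part of the sigma-algebra through open rays, since these generate
    the Borel sets of the line. No stability under intersections is asked of [P], because
    complements and countable unions already give it. *)
Lemma halfspace_sigma_ind n (P : set (set 'rV[R]_n)) :
  P setT -> (forall A, P A -> P (~` A)) ->
  (forall F : (set 'rV[R]_n)^nat, (forall k, P (F k)) -> P (\bigcup_k F k)) ->
  (forall i a, P [set x | a < x ord0 i]) ->
  forall A, measurable A -> P A.
Proof.
move=> PT PC PU Ph A mA.
suff : g_sigma_preimage (fun (i : 'I_n) (x : 'rV[R]_n) => x ord0 i) `<=` P by apply; exact: mA.
have P0 : P set0 by rewrite -setCT; exact: PC.
apply: smallest_sub.
  by split=> // B PB; rewrite setTD; exact: PC.
rewrite -bigcup_seq => B [i _ [Y mY <-]] /=; rewrite setTI.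
have : (RGenOInfty.G (R := R)).-sigma.-measurable Y by rewrite -RGenOInfty.measurableE.
suff : <<s RGenOInfty.G (R := R) >> `<=` [set Y | P ((fun x : 'rV[R]_n => x ord0 i) @^-1` Y)].
  by apply.
apply: smallest_sub.
  split => /=.
  - by rewrite preimage_set0.
  - by move=> C PB; rewrite setTD preimage_setC; exact: PC.
  - by move=> F PF; rewrite preimage_bigcup; exact: PU.
move=> _ [a ->] /=; have := Ph i a; congr (P _).
by apply/seteqP; split=> x /=; rewrite in_itv/= andbT.
Qed.

End rV_measure.

(** * Square-integrable superfunctions *)

Section L2.
Context {R : realType} {m r s : nat}.
Implicit Types phi psi : sfun R m r s.
Local Notation mu := (lebesgue_rV m).
Local Notation Re := complex.Re.
Local Notation Im := complex.Im.

(** The pointwise Hermitian product enters only through its real part, so that all estimates are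
    those of a real Euclidean space. *)
Definition pdot phi psi (x : 'rV[R]_m) : R :=
  \sum_I (Re (phi I x) * Re (psi I x) + Im (phi I x) * Im (psi I x)).

Definition msfun phi := (forall I, measurable_fun setT (fun x => Re (phi I x))) /\
  (forall I, measurable_fun setT (fun x => Im (phi I x))).

Lemma sfD phi psi I x : (phi + psi) I x = phi I x + psi I x. Proof. by []. Qed.
Lemma sfN phi I x : (- phi) I x = - phi I x. Proof. by []. Qed.
Lemma sfB phi psi I x : (phi - psi) I x = phi I x - psi I x. Proof. by []. Qed.
Lemma sfZ (c : R[i]) phi I x : (c *: phi) I x = c * phi I x. Proof. by []. Qed.
Lemma sf0 I x : (0 : sfun R m r s) I x = 0. Proof. by []. Qed.

Lemma cReM (a b : R[i]) : Re (a * b) = Re a * Re b - Im a * Im b.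
Proof. by case: a; case: b. Qed.
Lemma cImM (a b : R[i]) : Im (a * b) = Re a * Im b + Im a * Re b.
Proof. by case: a; case: b. Qed.
Lemma cReD (a b : R[i]) : Re (a + b) = Re a + Re b.
Proof. by case: a; case: b. Qed.
Lemma cImD (a b : R[i]) : Im (a + b) = Im a + Im b.
Proof. by case: a; case: b. Qed.
Lemma cReN (a : R[i]) : Re (- a) = - Re a.
Proof. by case: a. Qed.
Lemma cImN (a : R[i]) : Im (- a) = - Im a.
Proof. by case: a. Qed.
Definition ReImE := (cReM, cImM, cReD, cImD, cReN, cImN).

Lemma pdotC phi psi x : pdot phi psi x = pdot psi phi x.
Proof. by apply: eq_bigr => I _; ring. Qed.

Lemma pdotDl phi phi' psi x : pdot (phi + phi') psi x = pdot phi psi x + pdot phi' psi x.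
Proof. by rewrite -big_split; apply: eq_bigr => I _; rewrite sfD !ReImE/=; ring. Qed.

Lemma pdotNl phi psi x : pdot (- phi) psi x = - pdot phi psi x.
Proof. by rewrite -sumrN; apply: eq_bigr => I _; rewrite sfN !ReImE/=; ring. Qed.

Lemma pdotZl (c : R) phi psi x : pdot (c%:C%C *: phi) psi x = c * pdot phi psi x.
Proof. by rewrite mulr_sumr; apply: eq_bigr => I _; rewrite sfZ !ReImE/=; ring. Qed.

Lemma pdotDr phi psi psi' x : pdot phi (psi + psi') x = pdot phi psi x + pdot phi psi' x.
Proof. by rewrite pdotC pdotDl pdotC [pdot psi' _ _]pdotC. Qed.

Lemma pdotNr phi psi x : pdot phi (- psi) x = - pdot phi psi x.
Proof. by rewrite pdotC pdotNl pdotC. Qed.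

Lemma pdot_ge0 phi x : 0 <= pdot phi phi x.
Proof. by apply: sumr_ge0 => I _; rewrite addr_ge0// -expr2 sqr_ge0. Qed.

Lemma pdotE phi x : pdot phi phi x = \sum_I (Re (phi I x) ^+ 2 + Im (phi I x) ^+ 2).
Proof. by apply: eq_bigr => I _; rewrite !expr2. Qed.

Lemma pdotZ (c : R[i]) phi x :
  pdot (c *: phi) (c *: phi) x = (Re c ^+ 2 + Im c ^+ 2) * pdot phi phi x.
Proof. by rewrite mulr_sumr; apply: eq_bigr => I _; rewrite sfZ !ReImE/=; ring. Qed.

Lemma pdotD_le phi psi x :
  pdot (phi + psi) (phi + psi) x <= 2 * (pdot phi phi x + pdot psi psi x).
Proof.
have := pdot_ge0 (phi - psi) x; rewrite !(pdotDl, pdotDr, pdotNl, pdotNr) (pdotC psi phi); lra.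
Qed.

Lemma pdot_le phi psi x : `|pdot phi psi x| <= pdot phi phi x + pdot psi psi x.
Proof.
have := pdot_ge0 (phi - psi) x; have := pdot_ge0 (phi + psi) x.
have := pdot_ge0 phi x; have := pdot_ge0 psi x.
rewrite !(pdotDl, pdotDr, pdotNl, pdotNr) (pdotC psi phi) ler_norml; lra.
Qed.

Lemma pdot_coord phi I x : Re (phi I x) ^+ 2 + Im (phi I x) ^+ 2 <= pdot phi phi x.
Proof.
rewrite pdotE (bigD1 I)//= lerDl sumr_ge0// => J _.
by rewrite addr_ge0// sqr_ge0.
Qed.

Lemma msfunD phi psi : msfun phi -> msfun psi -> msfun (phi + psi).
Proof.
move=> [a b] [c d]; split=> I.
  by under eq_fun do rewrite sfD ReImE; exact: measurable_funD.
by under eq_fun do rewrite sfD !ReImE; exact: measurable_funD.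
Qed.

Lemma msfunZ (c : R[i]) phi : msfun phi -> msfun (c *: phi).
Proof.
move=> [a b]; split=> I.
  under eq_fun do rewrite sfZ !ReImE.
  by apply: measurable_funB; apply: measurable_funM.
under eq_fun do rewrite sfZ !ReImE.
by apply: measurable_funD; apply: measurable_funM.
Qed.

Lemma msfunB phi psi : msfun phi -> msfun psi -> msfun (phi - psi).
Proof. by move=> a b; apply: msfunD => //; rewrite -scaleN1r; exact: msfunZ. Qed.

Lemma measurable_pdot phi psi : msfun phi -> msfun psi -> measurable_fun setT (pdot phi psi).
Proof.
move=> [a b] [c d]; apply: measurable_sum => I.
by apply: measurable_funD; apply: measurable_funM.
Qed.

Lemma emeasurable_pdot phi psi : msfun phi -> msfun psi ->
  measurable_fun setT (fun x => (pdot phi psi x)%:E).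
Proof. by move=> ? ?; apply/measurable_EFinP; exact: measurable_pdot. Qed.

Lemma L2sqE phi : msfun phi -> L2sq phi = (\int[mu]_x (pdot phi phi x)%:E)%E.
Proof.
move=> [a b]; rewrite /L2sq -ge0_integral_sum//.
- by apply: eq_integral => x _; rewrite pdotE sumEFin.
- move=> I; apply/measurable_EFinP; apply: measurable_funD;
  by apply: measurable_funX.
- by move=> I x _; rewrite lee_fin addr_ge0// sqr_ge0.
Qed.

Lemma HSP phi : HS phi <-> msfun phi /\ (\int[mu]_x (pdot phi phi x)%:E < +oo)%E.
Proof.
split=> [[a b c]|[[a b] c]]; first by split; rewrite // -L2sqE//.
by split => //; rewrite L2sqE.
Qed.

Lemma HS_msfun phi : HS phi -> msfun phi. Proof. by move/HSP => []. Qed.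

Lemma pdot_integrable phi psi : HS phi -> HS psi ->
  mu.-integrable setT (fun x => (pdot phi psi x)%:E).
Proof.
move=> /HSP[mf fo] /HSP[mg go].
have I0 h : msfun h -> (\int[mu]_x (pdot h h x)%:E < +oo)%E ->
    mu.-integrable setT (fun x => (pdot h h x)%:E).
  move=> mh ho; apply/integrableP; split; first exact: emeasurable_pdot.
  by under eq_integral do rewrite gee0_abs ?lee_fin ?pdot_ge0//.
apply: le_integrable (integrableD measurableT (I0 _ mf fo) (I0 _ mg go)) => //.
- exact: emeasurable_pdot.
- move=> x _ /=; rewrite lee_fin (le_trans (pdot_le _ _ _))//.
  by rewrite ler_norm.
Qed.

Lemma HS_dom phi (G : 'rV[R]_m -> \bar R) : msfun phi ->
  mu.-integrable setT G -> (forall x, ((pdot phi phi x)%:E <= G x)%E) -> HS phi.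
Proof.
move=> mf iG le; apply/HSP; split => //.
have mG := measurable_int _ iG.
apply: (@le_lt_trans _ _ (\int[mu]_x G x)%E).
  apply: ge0_le_integral => //.
  - by move=> x _; rewrite lee_fin pdot_ge0.
  - exact: emeasurable_pdot.
by apply: integrable_lty.
Qed.

Lemma HSD phi psi : HS phi -> HS psi -> HS (phi + psi).
Proof.
move=> hf hg; apply: (@HS_dom _ (fun x => 2%:E * ((pdot phi phi x)%:E + (pdot psi psi x)%:E))%E).
- by apply: msfunD; exact: HS_msfun.
- by apply: integrableZl => //; apply: integrableD => //; exact: pdot_integrable.
- by move=> x; rewrite lee_fin; exact: pdotD_le.
Qed.

Lemma HSZ (c : R[i]) phi : HS phi -> HS (c *: phi).
Proof.
move=> hf; apply: (@HS_dom _ (fun x => (Re c ^+ 2 + Im c ^+ 2)%:E * (pdot phi phi x)%:E)%E).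
- by apply: msfunZ; exact: HS_msfun.
- by apply: integrableZl => //; exact: pdot_integrable.
- by move=> x; rewrite pdotZ lee_fin.
Qed.

Lemma HSN phi : HS phi -> HS (- phi).
Proof. by move=> h; rewrite -scaleN1r; exact: HSZ. Qed.

Lemma HSB phi psi : HS phi -> HS psi -> HS (phi - psi).
Proof. by move=> a b; apply: HSD => //; exact: HSN. Qed.

(* the real part of the Hermitian inner product *)
Definition ip phi psi : R := \int[mu]_x pdot phi psi x.

Lemma ipDl phi phi' psi : HS phi -> HS phi' -> HS psi ->
  ip (phi + phi') psi = ip phi psi + ip phi' psi.
Proof.
move=> a b c; rewrite -RintegralD//; try exact: pdot_integrable.
by apply: eq_Rintegral => x _; rewrite pdotDl.
Qed.

Lemma ipZl (c : R) phi psi : HS phi -> HS psi ->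
  ip (c%:C%C *: phi) psi = c * ip phi psi.
Proof.
move=> a b; rewrite -RintegralZl//; try exact: pdot_integrable.
by apply: eq_Rintegral => x _; rewrite pdotZl.
Qed.

Lemma ipC phi psi : ip phi psi = ip psi phi.
Proof. by apply: eq_Rintegral => x _; rewrite pdotC. Qed.

Lemma ipNl phi psi : HS phi -> HS psi -> ip (- phi) psi = - ip phi psi.
Proof.
move=> a b; rewrite -scaleN1r (_ : -1 = (-1)%:C%C) ?ipZl ?mulN1r//.
by rewrite rmorphN.
Qed.

Lemma ipDr phi psi psi' : HS phi -> HS psi -> HS psi' ->
  ip phi (psi + psi') = ip phi psi + ip phi psi'.
Proof. by move=> *; rewrite !(ipC phi) ipDl. Qed.

Lemma ipNr phi psi : HS phi -> HS psi -> ip phi (- psi) = - ip phi psi.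
Proof. by move=> *; rewrite !(ipC phi) ipNl. Qed.

Lemma ipZr (c : R) phi psi : HS phi -> HS psi ->
  ip phi (c%:C%C *: psi) = c * ip phi psi.
Proof. by move=> *; rewrite !(ipC phi) ipZl. Qed.

Lemma ip_ge0 phi : 0 <= ip phi phi.
Proof. by apply: Rintegral_ge0 => x _; exact: pdot_ge0. Qed.

Lemma L2sq_ip phi : HS phi -> L2sq phi = (ip phi phi)%:E.
Proof.
move=> hf; rewrite L2sqE; last exact: HS_msfun.
by rewrite fineK//; apply: integrable_fin_num => //; exact: pdot_integrable.
Qed.

Lemma ipD_le phi psi : HS phi -> HS psi ->
  ip (phi + psi) (phi + psi) <= 2 * (ip phi phi + ip psi psi).
Proof.
move=> a b; have := ip_ge0 (phi - psi).
have ? := HSN b.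
rewrite !(ipDl, ipDr, ipNl, ipNr)//; try exact: HSD.
rewrite (ipC psi phi); lra.
Qed.

(** Dominated convergence for the squared distances; every limit taken inside F, apart from that of
    the minimising sequence, goes through this criterion. *)
Lemma L2cvg_dom (u : nat -> sfun R m r s) phi (G : 'rV[R]_m -> \bar R) :
  (forall n, msfun (u n)) -> msfun phi -> mu.-integrable setT G ->
  (forall n x, ((pdot (u n - phi) (u n - phi) x)%:E <= G x)%E) ->
  (forall x, pdot (u n - phi) (u n - phi) x @[n --> \oo] --> (0 : R)) ->
  L2cvg \oo u phi.
Proof.
move=> mu' mphi iG le cv; rewrite /L2cvg.
have mB n := msfunB (mu' n) mphi.
have := @dominated_convergence _ _ _ mu setT measurableT
  (fun n x => (pdot (u n - phi) (u n - phi) x)%:E) (cst 0%E) G.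
case => //.
- by move=> n; exact: emeasurable_pdot.
- by apply: aeW => x _; apply: cvg_EFin; [exact: nearW|exact: cv].
- by apply: aeW => x n _; rewrite gee0_abs ?lee_fin ?pdot_ge0//; exact: le.
move=> _ _; rewrite integral0.
by under eq_fun do rewrite /= -L2sqE//.
Qed.

End L2.

(** * Multipliers of an invariant subspace *)

Section sign_iteration.
Context {R : realType}.

(** An odd polynomial that maps [-1, 1] to itself, with a repelling fixed point at 0 (slope 3/2) and
    attracting ones at 1 and -1 (slope 0). Being a polynomial, it acts on any algebra of
    functions. *)
Definition sgstep (y : R) : R := (3 * y - y ^+ 3) / 2.

Lemma sgstepN y : sgstep (- y) = - sgstep y.
Proof. by rewrite /sgstep; field. Qed.

Lemma iter_sgstepN n y : iter n sgstep (- y) = - iter n sgstep y.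
Proof. by elim: n => //= n ->; rewrite sgstepN. Qed.

Lemma iter_sgstep_gt0 n y : 0 < y <= 1 ->
  [/\ y <= iter n sgstep y, iter n sgstep y <= 1 &
      1 - iter n sgstep y <= (1 - y / 2) ^+ n].
Proof.
move=> /andP[y0 y1]; elim: n => [|n [le1 le2 le3]] /=.
  by rewrite expr0; split => //; lra.
set z := iter n sgstep y in le1 le2 le3 *.
(* Since z >= y, the second factor is at most 1 - y/2, whence the geometric rate. *)
have E : 1 - sgstep z = (1 - z) * (1 - (z + z ^+ 2) / 2) by rewrite /sgstep; field.
have z2 : 0 <= z ^+ 2 by exact: sqr_ge0.
have z21 : z ^+ 2 <= z by rewrite expr2 ler_piMl//; lra.
split.
- suff : 0 <= sgstep z - z by lra.
  rewrite (_ : sgstep z - z = z * (1 - z ^+ 2) / 2); last by rewrite /sgstep; field.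
  by rewrite divr_ge0// mulr_ge0//; lra.
- by suff : 0 <= 1 - sgstep z; [lra|]; rewrite E mulr_ge0//; lra.
- rewrite E [leRHS]exprS [leLHS]mulrC; apply: ler_pM; rewrite ?subr_ge0 //; lra.
Qed.

Lemma iter_sgstep_le1 n y : `|y| <= 1 -> `|iter n sgstep y| <= 1.
Proof.
wlog y0 : y / 0 <= y.
  move=> W; have [|/ltW] := leP 0 y; first exact: W.
  rewrite -oppr_ge0 => yN; rewrite -normrN => y1.
  by have := W _ yN y1; rewrite iter_sgstepN normrN.
move: y0; rewrite le_eqVlt => /predU1P[<- _|y0 y1].
  suff -> : iter n sgstep 0 = 0 by rewrite normr0.
  by elim: n => //= n ->; rewrite /sgstep; field.
have [|le1 le2 _] := @iter_sgstep_gt0 n y.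
  by rewrite y0/=; move: y1; rewrite gtr0_norm.
by rewrite ger0_norm// (le_trans _ le1)// ltW.
Qed.

Lemma cvg_iter_sgstep y : `|y| <= 1 -> iter n sgstep y @[n --> \oo] --> Num.sg y.
Proof.
wlog y0 : y / 0 <= y.
  move=> W; have [|/ltW] := leP 0 y; first exact: W.
  rewrite -oppr_ge0 => yN; rewrite -normrN => y1.
  rewrite -[X in _ --> X]opprK -sgrN.
  rewrite (_ : (fun n => _) = (fun n => - iter n sgstep (- y))).
    by apply: cvgN; exact: W.
  by apply/funext => n; rewrite iter_sgstepN opprK.
move: y0; rewrite le_eqVlt => /predU1P[<- _|y0 y1].
  rewrite sgr0; apply: cvg_near_cst; apply: nearW => n.
  by elim: n => //= n ->; rewrite /sgstep; field.
rewrite gtr0_sg//.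
have y1' : 0 < y <= 1 by rewrite y0/=; move: y1; rewrite gtr0_norm.
have h : (1 - y / 2) ^+ n @[n --> \oo] --> (0 : R).
  by apply: cvg_expr; rewrite ger0_norm; lra.
have h2 : 1 - (1 - y / 2) ^+ n @[n --> \oo] --> (1 : R).
  by rewrite -[X in _ --> X]subr0; apply: cvgB => //; exact: cvg_cst.
apply: (squeeze_cvgr _ h2 (cvg_cst (1 : R))); apply: nearW => n.
by have [_ -> le3] := iter_sgstep_gt0 n y1'; rewrite andbT; lra.
Unshelve. all: by end_near.
Qed.

End sign_iteration.

Section multipliers.
Context {R : realType} {m r s : nat}.
Local Notation mu := (lebesgue_rV m).
Local Notation Re := complex.Re.
Local Notation Im := complex.Im.
Implicit Types (phi psi : sfun R m r s) (u v : 'rV[R]_m -> R).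

Definition umul u phi : sfun R m r s := fun I x => (u x)%:C%C * phi I x.

Lemma pdot_umul u phi x :
  pdot (umul u phi) (umul u phi) x = u x ^+ 2 * pdot phi phi x.
Proof. by rewrite mulr_sumr; apply: eq_bigr => I _; rewrite /umul !ReImE/=; ring. Qed.

Lemma umulB u v phi : umul u phi - umul v phi = umul (u \- v) phi.
Proof.
by apply/funext => I; apply/funext => x; rewrite sfB /umul -mulrBl rmorphB.
Qed.

Lemma msfun_umul u phi : measurable_fun setT u -> msfun phi -> msfun (umul u phi).
Proof.
move=> mu' [a b]; split=> I.
  under eq_fun do rewrite /umul ReImE/= mul0r subr0.
  exact: measurable_funM.
under eq_fun do rewrite /umul ReImE/= mul0r addr0.
exact: measurable_funM.
Qed.

Context (F : set (sfun R m r s)) (cF : closed_subspace F).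

Lemma subspace_HS phi : F phi -> HS phi.
Proof. by case: cF => h _ _ _; exact: h. Qed.

Lemma subspace0 : F 0. Proof. by case: cF. Qed.

Lemma subspaceZD (c : R[i]) phi psi : F phi -> F psi -> F (c *: phi + psi).
Proof. by case: cF => _ _ h _; exact: h. Qed.

Lemma subspaceD phi psi : F phi -> F psi -> F (phi + psi).
Proof. by move=> a b; rewrite -[phi]scale1r; exact: subspaceZD. Qed.

Lemma subspaceZ (c : R[i]) phi : F phi -> F (c *: phi).
Proof. by move=> a; rewrite -[_ *: _]addr0; apply: subspaceZD => //; exact: subspace0. Qed.

Lemma subspace_sum (J : Type) (l : seq J) (P : pred J) (f : J -> sfun R m r s) :
  (forall j, P j -> F (f j)) -> F (\sum_(j <- l | P j) f j).
Proof.
by move=> h; elim/big_ind : _ => //; [exact: subspace0|exact: subspaceD].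
Qed.

Lemma subspace_closed (f : nat -> sfun R m r s) phi :
  (forall n, F (f n)) -> HS phi -> L2cvg \oo f phi -> F phi.
Proof. by case: cF => _ _ _; exact. Qed.

(** Measurability is included so that it passes to pointwise limits together with the invariance. *)
Definition multiplier u := measurable_fun setT u /\ forall phi, F phi -> F (umul u phi).

Lemma multiplier_cst c : multiplier (cst c).
Proof. by split=> [|phi Fp]; [exact: measurable_cst|exact: (subspaceZ c%:C%C Fp)]. Qed.

Lemma multiplier_lin c u v : multiplier u -> multiplier v -> multiplier (fun x => c * u x + v x).
Proof.
move=> [mu' hu] [mv hv]; split.
  by apply: measurable_funD => //; apply: measurable_funM.
move=> phi Fp; have := subspaceZD c%:C%C (hu _ Fp) (hv _ Fp).
congr F; apply/funext => I; apply/funext => x.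
by rewrite sfD sfZ /umul rmorphD rmorphM mulrDl mulrA.
Qed.

Lemma multiplier_mul u v : multiplier u -> multiplier v -> multiplier (fun x => u x * v x).
Proof.
move=> [mu' hu] [mv hv]; split; first exact: measurable_funM.
move=> phi Fp; have := hu _ (hv _ Fp).
congr F; apply/funext => I; apply/funext => x.
by rewrite /umul rmorphM mulrA.
Qed.

Lemma multiplier_eq u v : u =1 v -> multiplier u -> multiplier v.
Proof. by move=> /funext ->. Qed.

Lemma multiplier_scale c u : multiplier u -> multiplier (fun x => c * u x).
Proof.
by move=> h; apply: multiplier_eq (multiplier_lin c h (multiplier_cst 0)) => x; rewrite /= addr0.
Qed.

Lemma multiplier_add u v : multiplier u -> multiplier v -> multiplier (fun x => u x + v x).
Proof.
by move=> h k; apply: multiplier_eq (multiplier_lin 1 h k) => x; rewrite /= mul1r.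
Qed.

(* Dominated convergence, with dominating function [4 w^2 |phi|^2]. *)
Lemma umul_lim (f : nat -> 'rV[R]_m -> R) u (w : 'rV[R]_m -> R) phi :
  (forall n, measurable_fun setT (f n)) -> (forall n, F (umul (f n) phi)) -> msfun phi ->
  measurable_fun setT u -> 
  (forall n x, `|f n x| <= w x) -> (forall x, f n x @[n --> \oo] --> u x) ->
  HS (umul w phi) -> F (umul u phi).
Proof.
move=> mf Ff mphi mu' fw fu hw.
have uw x : `|u x| <= w x.
  rewrite -(cvg_lim (@Rhausdorff R) (cvg_norm (fu x))).
  apply: limr_le; first by apply/cvg_ex; eexists; exact: cvg_norm (fu x).
  by apply: nearW => n; exact: fw.
have pdotn phi' : HS phi' -> mu.-integrable setT (fun x => (pdot phi' phi' x)%:E).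
  by move=> h; exact: pdot_integrable.
have sqw (a b : R) : `|a| <= b -> a ^+ 2 <= b ^+ 2.
  by move=> h; rewrite -real_normK ?num_real// ler_sqr ?nnegrE// (le_trans _ h).
apply: (subspace_closed Ff).
  apply: HS_dom (pdotn _ hw) _; first exact: msfun_umul.
  by move=> x; rewrite lee_fin !pdot_umul ler_wpM2r ?pdot_ge0// sqw.
apply: (@L2cvg_dom _ _ _ _ _ _ (fun x => 4%:E * (pdot (umul w phi) (umul w phi) x)%:E)%E).
- by move=> n; exact: msfun_umul.
- exact: msfun_umul.
- by apply: integrableZl => //; exact: pdotn.
- move=> n x; rewrite umulB -EFinM lee_fin !pdot_umul mulrA ler_wpM2r ?pdot_ge0//=.
  rewrite (_ : 4 * w x ^+ 2 = (2 * w x) ^+ 2); last by ring.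
  apply: sqw; rewrite (le_trans (ler_normB _ _))//.
  by have := fw n x; have := uw x; lra.
- move=> x; under eq_fun do rewrite umulB pdot_umul.
  rewrite -(mul0r (pdot phi phi x)); apply: cvgM; last exact: cvg_cst.
  rewrite (_ : 0 = 0 * 0)//; last by rewrite mul0r.
  have h : (f n \- u) x @[n --> \oo] --> (0 : R).
    by rewrite -(subrr (u x)); apply: cvgB => //; exact: cvg_cst.
  by under eq_fun do rewrite expr2; exact: cvgM.
Qed.

Lemma multiplier_lim (f : nat -> 'rV[R]_m -> R) u (C : R) :
  (forall n, multiplier (f n)) -> (forall n x, `|f n x| <= C) ->
  (forall x, f n x @[n --> \oo] --> u x) -> multiplier u.
Proof.
move=> Mf fC fu.
have mu' : measurable_fun setT u.
  by apply: (measurable_fun_cvg (h := f)) => // n; exact: (Mf n).1.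
split=> // phi Fp; apply: (@umul_lim f u (cst C)) => //.
- by move=> n; exact: (Mf n).1.
- by move=> n; exact: (Mf n).2.
- exact/HS_msfun/subspace_HS.
- by apply: subspace_HS; exact: (multiplier_cst C).2.
Qed.

Context (hbar : R) (hb : hbar <> 0).
Hypothesis FU : forall g phi, F phi -> F (U0 hbar g phi).

(** The element (0, p, 0) of the body group multiplies by exp(-i hbar x.p); taking p = -(lam / hbar)
    e_i gives the required character. *)
Lemma cis_invariant i (lam : R) phi : F phi ->
  F (fun I x => cis (lam * x ord0 i) * phi I x).
Proof.
move=> Fp; have := FU (0, (- (lam / hbar)) *: delta_mx ord0 i, 0) Fp.
congr F; apply/funext => I; apply/funext => x; rewrite /U0/= subr0; congr (cis _ * _).
rewrite scaler0 sub0r add0r /dot (bigD1 i)//= big1 ?addr0; last first.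
  by move=> j ji; rewrite !mxE (negbTE ji) andbF !mulr0.
rewrite !mxE !eqxx/=; field; exact/eqP.
Qed.

Lemma multiplier_cos i (lam : R) : multiplier (fun x => cos (lam * x ord0 i)).
Proof.
split.
  apply: measurableT_comp; first by apply: continuous_measurable_fun; exact: continuous_cos.
  by apply: measurable_funM => //; exact: measurable_coord.
move=> phi Fp.
have := subspaceZ (2^-1)%:C%C (subspaceD (cis_invariant i lam Fp) (cis_invariant i (- lam) Fp)).
congr F; apply/funext => I; apply/funext => x; rewrite sfZ sfD /umul -mulrDl mulrA.
congr (_ * _); rewrite /cis mulNr cosN sinN.
apply/eqP; rewrite eq_complex !ReImE/=; apply/andP; split; apply/eqP; by field.
Qed.

Lemma multiplier_sin i (lam : R) : multiplier (fun x => sin (lam * x ord0 i)).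
Proof.
split.
  apply: measurableT_comp; first by apply: continuous_measurable_fun; exact: continuous_sin.
  by apply: measurable_funM => //; exact: measurable_coord.
move=> phi Fp.
(* The scalar is 1/(2i), applied to the difference of the two opposite characters. *)
have := subspaceZ (0 +i* (- 2^-1))%C
  (subspaceZD (-1) (cis_invariant i (- lam) Fp) (cis_invariant i lam Fp)).
congr F; apply/funext => I; apply/funext => x; rewrite sfZ sfD sfZ /umul.
rewrite mulrA -mulrDl mulrA.
congr (_ * _); rewrite /cis [- lam * _]mulNr cosN sinN.
apply/eqP; rewrite eq_complex !ReImE/=; apply/andP; split; apply/eqP; by field.
Qed.

Lemma multiplier_sg u : multiplier u -> (forall x, `|u x| <= 1) -> multiplier (fun x => Num.sg (u x)).
Proof.
move=> Mu u1; apply: (@multiplier_lim (fun n x => iter n sgstep (u x)) _ 1).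
- elim=> //= n IHn; apply: multiplier_eq (multiplier_lin (3 / 2) IHn
    (multiplier_scale (- 2^-1) (multiplier_mul IHn (multiplier_mul IHn IHn)))) => x.
  by rewrite /sgstep /=; field.
- by move=> n x; exact: iter_sgstep_le1.
- by move=> x; exact: cvg_iter_sgstep.
Qed.

(** The coordinate is unbounded, so the sign iteration does not apply to it directly. The sine of
    (x_i - a)/(n+1) is bounded by 1 and has the sign of x_i - a as soon as |x_i - a| < (n+1) pi; at
    each point the approximating signs are therefore eventually constant. *)
Lemma multiplier_sg_coord i (a : R) : multiplier (fun x => Num.sg (x ord0 i - a)).
Proof.
apply: (@multiplier_lim (fun n x => Num.sg (sin (n.+1%:R^-1 * (x ord0 i - a)))) _ 1).
- move=> n; apply: multiplier_sg; last first.
    by move=> x; rewrite ler_norml sin_geN1 sin_le1.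
  apply: multiplier_eq (multiplier_lin (cos (n.+1%:R^-1 * a)) (multiplier_sin i n.+1%:R^-1)
    (multiplier_scale (- sin (n.+1%:R^-1 * a)) (multiplier_cos i n.+1%:R^-1))) => x.
  by rewrite mulrBr sinB; ring.
- by move=> n x; rewrite normr_sg; case: (_ == 0) => /=; rewrite ?ler01 ?lexx.
- move=> x; set y := _ - a; apply: cvg_near_cst; near=> n.
  rewrite -/y; have n0 : 0 < (n.+1%:R : R)^-1 by rewrite invr_gt0.
  have ypi : `|n.+1%:R^-1 * y| < pi.
    rewrite normrM gtr0_norm// mulrC ltr_pdivrMr//.
    rewrite -ltr_pdivrMl ?pi_gt0//.
    rewrite (@lt_le_trans _ _ n%:R) ?ler_nat//; near: n.
    exact: nbhs_infty_gtr.
  have [y0|y0|->] := ltgtP y 0; last by rewrite mulr0 sin0.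
  + rewrite (ltr0_sg y0); apply: ltr0_sg.
    rewrite -oppr_gt0 -sinN; apply: sin_gt0_pi.
    have y0' : n.+1%:R^-1 * y < 0 by rewrite pmulr_rlt0.
    by rewrite oppr_gt0 y0' /=; move: ypi; rewrite ltr0_norm.
  + rewrite (gtr0_sg y0); apply: gtr0_sg; apply: sin_gt0_pi.
    have y0' : 0 < n.+1%:R^-1 * y by rewrite mulr_gt0.
    by rewrite y0' /=; move: ypi; rewrite gtr0_norm.
Unshelve. all: by end_near.
Qed.

Lemma multiplier_indic (A : set 'rV[R]_m) : measurable A -> multiplier (\1_A).
Proof.
move: A; apply: halfspace_sigma_ind.
- by apply: multiplier_eq (multiplier_cst 1) => x; rewrite indicT.
- move=> A MA; apply: multiplier_eq (multiplier_lin (-1) MA (multiplier_cst 1)) => x.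
  rewrite !indicE in_setC; case: (x \in A) => /=; lra.
(* The indicator of a finite union is a polynomial in the indicators of its members. *)
- move=> G MG; apply: (@multiplier_lim (fun n x => 1 - \prod_(k < n) (1 - \1_(G k) x)) _ 1).
  + have Mp n : multiplier (fun x => \prod_(k < n) (1 - \1_(G k) x)).
      elim: n => [|n IHn].
        by apply: multiplier_eq (multiplier_cst 1) => x; rewrite big_ord0.
      have H := multiplier_mul IHn (multiplier_lin (-1) (MG n) (multiplier_cst 1)).
      by apply: multiplier_eq H => x; rewrite big_ord_recr/= mulN1r addrC.
    move=> n; apply: multiplier_eq (multiplier_lin (-1) (Mp n) (multiplier_cst 1)) => x.
    by rewrite /= mulN1r addrC.
  + move=> n x; have : 0 <= \prod_(k < n) (1 - (\1_(G k) x : R)) <= (1 : R).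
      have G01 k : 0 <= 1 - (\1_(G k) x : R) <= (1 : R).
        by rewrite indicE; apply/andP; case: (_ \in _) => /=; split; lra.
      elim: n => [|n /andP[a0 a1]]; first by rewrite big_ord0 ler01 lexx.
      have /andP[b0 b1] := G01 n.
      by rewrite big_ord_recr/= mulr_ge0// mulr_ile1.
    by move=> /andP[? ?]; rewrite ler_norml; lra.
  + move=> x; rewrite indicE; case: (boolP (x \in _)).
      rewrite inE => -[k _ Gk]; apply: cvg_near_cst; near=> n.
      have kn : (k < n)%N by near: n; exact: nbhs_infty_gt.
      by rewrite (bigD1 (Ordinal kn))//= indicE mem_set// subrr mul0r subr0.
    move=> xG; apply: cvg_near_cst; apply: nearW => n.
    rewrite big1 ?subrr// => k _; rewrite indicE memNset ?subr0// => Gk.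
    by move/negP : xG; apply; rewrite inE; exists k.
(* The indicator of the open halfspace is (sg + sg^2)/2, which also has the right value 0 on the
   boundary hyperplane. *)
- move=> i a; have H := multiplier_sg_coord i a.
  apply: multiplier_eq (multiplier_lin (2^-1) H (multiplier_scale (2^-1) (multiplier_mul H H))) => x.
  rewrite indicE; case: (ltgtP a (x ord0 i)) => h.
  + rewrite mem_set//= gtr0_sg ?subr_gt0//; lra.
  + rewrite memNset//=; last by rewrite ltNge (ltW h).
    rewrite ltr0_sg ?subr_lt0//; lra.
  + by rewrite h subrr sgr0 memNset/= ?ltxx//; lra.
Unshelve. all: by end_near.
Qed.

Import HBNNSimple.

Lemma multiplier_ge0 u (C : R) : measurable_fun setT u -> (forall x, 0 <= u x <= C) -> multiplier u.
Proof.
move=> mu' uC.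
have mE : measurable_fun setT (EFin \o u) by exact/measurable_EFinP.
have u0 x : [set: 'rV[R]_m] x -> (0 <= (EFin \o u) x)%E.
  by move=> _; rewrite lee_fin; case/andP: (uC x).
have cvu x : nnsfun_approx measurableT mE n x @[n --> \oo] --> u x.
  have := cvg_nnsfun_approx measurableT mE u0 (x := x) I.
  by move/fine_cvg; apply: cvg_trans; apply: near_eq_cvg; apply: nearW.
have le n x : nnsfun_approx measurableT mE n x <= u x.
  rewrite -(cvg_lim (@Rhausdorff R) (cvu x)).
  apply: (@nondecreasing_cvgn_le _ (fun n => nnsfun_approx measurableT mE n x)).
    by move=> j k jk; have /lefP := nd_nnsfun_approx measurableT mE jk.
  by apply/cvg_ex; eexists; exact: cvu.
apply: (@multiplier_lim (fun n x => nnsfun_approx measurableT mE n x) u C) => //.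
(* A simple function is a finite combination of indicators of its level sets. *)
- move=> n; set g := nnsfun_approx _ _ _.
  apply: (@multiplier_eq (fun x => \sum_(y <- finmap.enum_fset (fset_set (range g)))
    (y * \1_(g @^-1` [set y]) x))).
    by move=> x; rewrite [RHS]fimfunE fsbig_finite.
  elim: (finmap.enum_fset _) => [|y l IHl].
    by apply: multiplier_eq (multiplier_cst 0) => x; rewrite big_nil.
  have my := @measurable_funPTI _ _ _ _ g [set y] (measurable_set1 y).
  have H := multiplier_lin y (multiplier_indic my) IHl.
  by apply: multiplier_eq H => x; rewrite big_cons.
- move=> n x; rewrite ger0_norm; last by exact: fun_ge0.
  by rewrite (le_trans (le n x))//; case/andP: (uC x).
Qed.

Lemma multiplier_bounded u (C : R) : measurable_fun setT u -> (forall x, `|u x| <= C) -> multiplier u.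
Proof.
move=> mu' uC.
have : multiplier (fun x => u x + C).
  apply: (@multiplier_ge0 _ (C + C)); first exact: measurable_funD.
  by move=> x; have := uC x; rewrite ler_norml => /andP[? ?]; lra.
move=> h; apply: multiplier_eq (multiplier_add h (multiplier_cst (- C))) => x /=; ring.
Qed.

(** The truncations of u to |u| <= n are bounded multipliers, and |u| |phi| is a square-integrable
    majorant. Allowing unbounded u is what later permits division by a Gaussian. *)
Lemma umul_invariant u phi : measurable_fun setT u -> F phi -> HS (umul u phi) ->
  F (umul u phi).
Proof.
move=> mu' Fp hs.
pose A n := [set x | `|u x| <= n%:R].
have mA n : measurable (A n).
  rewrite -[A n]setTI; apply: (measurable_fun_le (f := fun x => `|u x|) (g := cst n%:R)) => //.
  exact: measurableT_comp.
have mf n : measurable_fun setT (fun x => \1_(A n) x * u x).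
  by apply: measurable_funM => //; exact: measurable_indic.
apply: (@umul_lim (fun n x => \1_(A n) x * u x) u (fun x => `|u x|)) => //.
- move=> n; apply: (multiplier_bounded (C := n%:R) _ _).2 => // x.
  rewrite indicE; case: (boolP (x \in A n)) => [|_]; last by rewrite mul0r normr0.
  by rewrite inE mul1r.
- exact/HS_msfun/subspace_HS.
- move=> n x; rewrite indicE; case: (x \in _); rewrite ?mul1r// mul0r normr0.
  exact: normr_ge0.
- move=> x; apply: cvg_near_cst; near=> n; rewrite indicE mem_set/= ?mul1r//.
  by rewrite /A/=; near: n; exact: nbhs_infty_ger.
- have /HSP[_ fo] := hs; apply/HSP; split.
    by apply: msfun_umul; [exact: measurableT_comp|exact/HS_msfun/subspace_HS].
  move: fo; congr (_ < _)%E; apply: eq_integral => x _.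
  by rewrite !pdot_umul real_normK ?num_real.
Unshelve. all: by end_near.
Qed.

End multipliers.

(** * Near-orthogonality *)

Section near_orthogonality.
Context {R : realType} {m r s : nat}.
Local Notation mu := (lebesgue_rV m).
Local Notation Re := complex.Re.
Local Notation Im := complex.Im.
Implicit Types (phi psi eta : sfun R m r s) (u v : 'rV[R]_m -> R).
Context (F : set (sfun R m r s)) (cF : closed_subspace F).

(** The hypothesis says that T is controlled by the elements of F of squared norm at most M. With d
    the squared distance from T to F and f in F such that eta = T - f has |eta|^2 < d + t^2,
    comparison with f + t phi bounds 2 <phi, eta> by (1 + |phi|^2) t. Hence <T, eta> and -<f, eta>
    are at most of order t, and so is d, which their sum dominates. *)
Lemma near_orthogonal (T : sfun R m r s) (M C : R) : HS T -> 0 <= M -> 0 <= C ->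
  (forall eta e, HS eta -> 0 <= e ->
     (forall phi, F phi -> ip phi phi <= M -> ip phi eta <= e) -> ip T eta <= C * e) ->
  F T.
Proof.
move=> hT M0 C0 hC.
pose D := [set ip (T - f) (T - f) | f in F].
have D0 : has_inf D.
  split; first by exists (ip (T - 0) (T - 0)); exists 0 => //; case: cF.
  by exists 0 => _ [f _ <-]; exact: ip_ge0.
pose d := inf D.
have dle f : F f -> d <= ip (T - f) (T - f).
  by move=> Ff; apply: ge_inf; [exact: D0.2|exists f].
have HSF := subspace_HS cF.
have dnear (de : R) : 0 < de -> exists2 f, F f & ip (T - f) (T - f) < d + de.
  by move=> de0; have [_ [f Ff <-] lt] := inf_adherent de0 D0; exists f.
(* A common bound for M and for |f|^2, where f = T - eta with |eta|^2 <= d + 1. *)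
pose M' := M + 2 * (ip T T + (d + 1)).
have d0 : 0 <= d by apply: lb_le_inf; [exact: D0.1|move=> _ [f _ <-]; exact: ip_ge0].
have dC (t : R) : 0 < t <= 1 -> d <= (C + 1) * (1 + M') * t.
  move=> /andP[t0 t1].
  (* The defect is t^2 so that dividing by the step t still leaves a factor t. *)
  have [f Ff flt] := dnear (t ^+ 2) (exprn_gt0 _ t0).
  have heta : HS (T - f) by apply: HSB => //; exact: HSF.
  (* An opaque name keeps T - f in one piece while bilinearity expands the rest. *)
  have [eta etaE] : exists eta, eta = T - f by exists (T - f).
  rewrite -etaE in flt heta.
  have key phi : F phi -> 2 * ip phi eta <= (1 + ip phi phi) * t.
    move=> Fphi; have hphi := HSF _ Fphi.
    have := dle (f + t%:C%C *: phi) (subspaceD cF Ff (subspaceZ cF _ Fphi)).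
    rewrite opprD addrA -etaE.
    have htphi := HSZ t%:C%C hphi.
    have := HSN htphi => hN.
    rewrite ipDl ?ipDr ?ipNl ?ipNr ?ipZl ?ipZr//; try exact: HSB.
    rewrite (ipC eta phi) => le.
    have : t * (2 * ip phi eta) <= t * ((1 + ip phi phi) * t) by rewrite expr2 in flt; lra.
    by rewrite ler_pM2l.
  have e0 : 0 <= (1 + M) * t / 2 by rewrite divr_ge0// mulr_ge0//; lra.
  have Teta : ip T eta <= C * ((1 + M) * t / 2).
    apply: hC => // phi Fphi phiM; have := key _ Fphi.
    have : (1 + ip phi phi) * t <= (1 + M) * t by rewrite ler_pM2r//; lra.
    by lra.
  have ff : ip f f <= 2 * (ip T T + (d + 1)).
    have -> : f = T - eta by rewrite etaE opprB addrC subrK.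
    apply: (le_trans (ipD_le hT (HSN heta))); rewrite ipNl ?ipNr//; last exact: HSN.
    have : t ^+ 2 <= 1 by rewrite exprn_ile1// ltW.
    by lra.
  have feta : - (2 * ip f eta) <= (1 + ip f f) * t.
    have hf := HSF _ Ff.
    have FN : F (- f) by rewrite -scaleN1r; exact: subspaceZ.
    by have := key _ FN; rewrite !ipNl ?ipNr//; [lra|exact: HSN].
  have : d <= ip eta eta by rewrite etaE; exact: dle.
  rewrite {1}etaE ipDl//; [|exact: HSN (HSF _ Ff)].
  rewrite ipNl//; last exact: HSF.
  have ffM : (1 + ip f f) * t <= (1 + M') * t by rewrite ler_pM2r// /M'; lra.
  have MM : (1 + M) * t <= (1 + M') * t.
    by rewrite ler_pM2r// /M'; have := ip_ge0 T; lra.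
  have : C * ((1 + M) * t / 2) <= C * ((1 + M') * t).
    apply: ler_wpM2l => //; have : 0 <= (1 + M) * t by rewrite mulr_ge0//; lra.
    by lra.
  have M'0 : 0 <= (1 + M') * t.
    by rewrite mulr_ge0// ?(ltW t0)// /M'; have := ip_ge0 T; lra.
  by rewrite -mulrA mulrDl mul1r; lra.
have d00 : d = 0.
  apply/eqP; rewrite eq_le d0 andbT leNgt; apply/negP => dgt.
  pose B := (C + 1) * (1 + M').
  have B0 : 0 < B by rewrite mulr_gt0// /M'; have := ip_ge0 T; lra.
  (* With this t the bound B t is at most d/2, which contradicts d > 0. *)
  pose t := Num.min 1 (d / (2 * B)).
  have t0 : 0 < t by rewrite lt_min ltr01 divr_gt0// mulr_gt0.
  have t1 : t <= 1 by rewrite ge_min lexx.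
  have := dC t; rewrite t0 t1 => /(_ isT).
  have tB : t <= d / (2 * B) by rewrite ge_min lexx orbT.
  rewrite leNgt => /negP; apply; rewrite -/B.
  rewrite (@le_lt_trans _ _ (B * (d / (2 * B))))// ?ler_pM2l//.
  rewrite (_ : B * (d / (2 * B)) = d / 2); last by field; lra.
  by lra.
have /boolp.choice[f fP] (n : nat) : exists f : sfun R m r s,
    F f /\ ip (T - f) (T - f) < n.+1%:R^-1.
  have [|f Ff lt] := dnear n.+1%:R^-1; first by rewrite invr_gt0.
  by exists f; split => //; move: lt; rewrite d00 add0r.
apply: (subspace_closed cF (f := f)) => //; first by move=> n; exact: (fP n).1.
rewrite /L2cvg; under eq_fun => n.
  rewrite -opprB L2sq_ip; last by apply: HSN; apply: HSB => //; exact: HSF (fP n).1.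
  rewrite ipNl ?ipNr ?opprK; try (apply: HSN || idtac); try (apply: HSB => //; exact: HSF (fP n).1).
  over.
apply: cvg_EFin; first exact: nearW.
apply: (squeeze_cvgr _ (cvg_cst (0 : R)) (@cvg_harmonic R)).
by apply: nearW => n; rewrite ip_ge0/= ltW// (fP n).2.
Qed.

End near_orthogonality.

(** * Averages of translates and pure tensors *)

Section pure_tensors.
Context {R : realType} {m r s : nat}.
Local Notation mu := (lebesgue_rV m).
Local Notation Re := complex.Re.
Local Notation Im := complex.Im.
Implicit Types (phi psi eta : sfun R m r s) (u v : 'rV[R]_m -> R).
Context (F : set (sfun R m r s)) (cF : closed_subspace F).
Context (hbar : R) (hb : hbar <> 0).
Hypothesis FU : forall g phi, F phi -> F (U0 hbar g phi).

Definition tens u (w : {set 'I_(r + s)} -> R[i]) : sfun R m r s :=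
  fun I x => w I * (u x)%:C%C.

Lemma pdot_tens u w x :
  pdot (tens u w) (tens u w) x = u x ^+ 2 * \sum_I (Re (w I) ^+ 2 + Im (w I) ^+ 2).
Proof. by rewrite mulr_sumr; apply: eq_bigr => I _; rewrite !ReImE/=; ring. Qed.

Lemma msfun_tens u w : measurable_fun setT u -> msfun (tens u w).
Proof.
move=> mu'; split=> I.
  under eq_fun do rewrite /tens ReImE/= mulr0 subr0.
  exact: measurable_funM.
under eq_fun do rewrite /tens ReImE/= mulr0 add0r.
exact: measurable_funM.
Qed.

Lemma HS_tens u w : measurable_fun setT u ->
  (\int[mu]_x (u x ^+ 2)%:E < +oo)%E -> HS (tens u w).
Proof.
move=> mu' uo; apply: (@HS_dom _ _ _ _ _ (fun x =>
  (\sum_I (Re (w I) ^+ 2 + Im (w I) ^+ 2))%:E * (u x ^+ 2)%:E)%E).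
- exact: msfun_tens.
- apply: integrableZl => //; apply/integrableP; split.
    by apply/measurable_EFinP; exact: measurable_funX.
  by under eq_integral do rewrite gee0_abs ?lee_fin ?sqr_ge0//.
- by move=> x; rewrite -EFinM lee_fin pdot_tens mulrC.
Qed.

Lemma HS_tens_indic (A : set 'rV[R]_m) w : measurable A -> (mu A < +oo)%E -> HS (tens (\1_A) w).
Proof.
move=> mA Ao; apply: HS_tens; first exact: measurable_indic.
rewrite (_ : (fun x => _) = EFin \o \1_A); last first.
  by apply/funext => x /=; rewrite indicE; case: (_ \in _); rewrite /= ?expr1n ?expr0n.
by rewrite integral_indic// setIT.
Qed.

Lemma integrable_indic_lty (A : set 'rV[R]_m) : measurable A -> (mu A < +oo)%E ->
  mu.-integrable setT (fun x => (\1_A x : R)%:E).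
Proof.
move=> mA Ao; apply/integrableP; split.
  by apply/measurable_EFinP; exact: measurable_indic.
under eq_integral do rewrite gee0_abs ?lee_fin//.
by rewrite integral_indic// setIT.
Qed.

(** The integral of each component; it has its meaning for integrable components, in particular for
    a square-integrable phi supported in a cube. *)
Definition mean phi : {set 'I_(r + s)} -> R[i] := fun I =>
  ((\int[mu]_x Re (phi I x)) +i* (\int[mu]_x Im (phi I x)))%C.

Definition shiftf (q : 'rV[R]_m) phi : sfun R m r s := fun I x => phi I (x + q).

Lemma shiftf_invariant q phi : F phi -> F (shiftf q phi).
Proof.
move=> Fphi; have := FU (- q, 0, 0) Fphi; congr F.
apply/funext => I; apply/funext => x; rewrite /U0/= /shiftf opprK.
rewrite /dot add0r big1; last by move=> i _; rewrite [X in _ * X]mxE mulr0.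
by rewrite mulr0 /cis cos0 sin0 mul1r.
Qed.

Lemma cube_supp_integrable phi K I : HS phi ->
  (forall x, ~ cube K x -> forall J, phi J x = 0) ->
  mu.-integrable setT (fun x => (Re (phi I x))%:E) /\
  mu.-integrable setT (fun x => (Im (phi I x))%:E).
Proof.
move=> hphi supp; have [a b] := HS_msfun hphi.
have iG : mu.-integrable setT (fun x => (\1_(cube K) x)%:E + (pdot phi phi x)%:E)%E.
  apply: integrableD => //; last exact: pdot_integrable.
  by apply: integrable_indic_lty; [exact: measurable_cube|exact: cube_lty].
(* On the cube |c| <= 1 + c^2, and outside it c = 0. *)
have bnd (c : R) x : c ^+ 2 <= pdot phi phi x -> (~ cube K x -> c = 0) ->
  (`|c%:E| <= `|(\1_(cube K) x)%:E + (pdot phi phi x)%:E|)%E.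
  move=> c2 c0; rewrite -EFinD !abse_EFin lee_fin [leRHS]ger0_norm; last first.
    by rewrite addr_ge0 ?pdot_ge0.
  rewrite indicE; case: (boolP (x \in _)) => [_|]; last first.
    move/negP => xK; rewrite c0 ?normr0 ?addr_ge0 ?pdot_ge0//.
    by move=> xK'; apply: xK; rewrite inE.
  apply: le_trans (_ : 1 + c ^+ 2 <= _); last by rewrite lerD2l.
  rewrite -[c ^+ 2]real_normK ?num_real//.
  have := sqr_ge0 (`|c| - 1); rewrite sqrrB mulr1 expr1n => h.
  have := normr_ge0 c; have := sqr_ge0 `|c|; lra.
split; apply: le_integrable iG => //; try exact/measurable_EFinP.
- move=> x _; apply: bnd => [|/supp ->//].
  by apply: le_trans (pdot_coord phi I x); rewrite lerDl sqr_ge0.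
- move=> x _; apply: bnd => [|/supp ->//].
  by apply: le_trans (pdot_coord phi I x); rewrite lerDr sqr_ge0.
Qed.

Section mean_in.
Variables (phi : sfun R m r s) (K : R).
Hypotheses (Fphi : F phi) (supp : forall x, ~ cube K x -> forall J, phi J x = 0).
Variable L : R.

Let Q := @cube R m L.
(** If x lies in [Q] and x + q in the support cube of phi, then q lies in [D]; so only these q
    contribute to the average of the [Phi q]. *)
Let D := @cube R m (K + L).
Let T := tens (\1_Q) (mean phi).
Let Phi q := umul (\1_Q) (shiftf q phi).

Let FPhi q : F (Phi q).
Proof.
apply: (multiplier_indic cF hb FU _).2; first exact: measurable_cube.
exact: shiftf_invariant.
Qed.

Let hphi : HS phi. Proof. exact: (subspace_HS cF). Qed.

Let PhiD q : ~ D q -> Phi q = 0.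
Proof.
move=> nD; apply/funext => I; apply/funext => x; rewrite /Phi /umul /shiftf indicE.
case: (boolP (x \in Q)) => [|_]; last by rewrite mul0r.
rewrite inE => Qx; rewrite supp ?mulr0// => Kxq; apply: nD => i /=.
have := Qx i; have := Kxq i; rewrite /= !in_itv/= mxE => /andP[? ?] /andP[? ?].
by apply/andP; split; lra.
Qed.

Let H eta (z : 'rV[R]_m * 'rV[R]_m) : R := pdot (Phi z.1) eta z.2.

Let mH eta : HS eta -> measurable_fun setT (H eta).
Proof.
move=> /HS_msfun[a b]; have [a' b'] := HS_msfun hphi.
have e1 : H eta = fun z => \1_Q z.2 * \sum_I (Re (phi I (z.1 + z.2)) * Re (eta I z.2) +
    Im (phi I (z.1 + z.2)) * Im (eta I z.2)).
  apply/funext => z; rewrite mulr_sumr; apply: eq_bigr => I _.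
  by rewrite [z.1 + z.2]addrC /Phi /umul !ReImE/= /shiftf; ring.
rewrite e1; apply: measurable_funM.
  have mi : measurable_fun setT (\1_Q : 'rV[R]_m -> R).
    by apply: measurable_indic; exact: measurable_cube.
  exact: (measurableT_comp mi measurable_snd).
apply: measurable_sum => I; apply: measurable_funD; apply: measurable_funM.
- exact: (measurableT_comp (a' I) (@measurable_rVD2 R m)).
- exact: (measurableT_comp (a I) measurable_snd).
- exact: (measurableT_comp (b' I) (@measurable_rVD2 R m)).
- exact: (measurableT_comp (b I) measurable_snd).
Qed.

(** The first of two majorants for [H], which come from |<a, b>| <= |a|^2 + |b|^2. The integral over
    q is taken first, because translation invariance makes that of |phi(q + x)|^2 independent of
    x. *)
Let iG1 : (mu \x mu)%E.-integrable setT
  (fun z => (\1_Q z.2 * pdot phi phi (z.1 + z.2))%:E).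
Proof.
have mphi := HS_msfun hphi; have mQ : measurable Q by exact: measurable_cube.
have mi : measurable_fun setT (\1_Q : 'rV[R]_m -> R) by exact: measurable_indic.
have p0 x : (0 <= (pdot phi phi x)%:E)%E by rewrite lee_fin pdot_ge0.
apply/integrable21ltyP => /=.
  apply/measurable_EFinP; apply: measurable_funM.
    exact: (measurableT_comp mi measurable_snd).
  exact: (measurableT_comp (measurable_pdot mphi mphi) (@measurable_rVD2 R m)).
pose c := (\int[mu]_x (pdot phi phi x)%:E)%E.
have co : (c < +oo)%E by have /HSP[] := hphi.
have c0 : (0 <= c)%E by apply: integral_ge0.
have E x : (\int[mu]_q `|(\1_Q x * pdot phi phi (q + x))%:E| = (\1_Q x)%:E * c)%E.
  rewrite -[c](ge0_integral_shift x)//; last exact: emeasurable_pdot.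
  rewrite -ge0_integralZl//; last first.
    exact: (measurableT_comp (emeasurable_pdot mphi mphi) (measurable_rVD x)).
  apply: eq_integral => q _; rewrite -EFinM gee0_abs//.
  by rewrite lee_fin mulr_ge0// pdot_ge0.
under eq_integral do rewrite E.
rewrite ge0_integralZr//; last exact/measurable_EFinP.
rewrite integral_indic// setIT lte_mul_pinfty// ge0_fin_numE//; exact: cube_lty.
Qed.

(** The second majorant; the indicator of [D] is what keeps it integrable in q. *)
Let iG2 eta : HS eta -> (mu \x mu)%E.-integrable setT
  (fun z => (pdot eta eta z.2 * \1_D z.1)%:E).
Proof.
move=> heta; have meta := HS_msfun heta.
have mD : measurable D by exact: measurable_cube.
have mi : measurable_fun setT (\1_D : 'rV[R]_m -> R) by exact: measurable_indic.
have p0 x : (0 <= (pdot eta eta x)%:E)%E by rewrite lee_fin pdot_ge0.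
apply/integrable21ltyP => /=.
  apply/measurable_EFinP; apply: measurable_funM.
    exact: (measurableT_comp (measurable_pdot meta meta) measurable_snd).
  exact: (measurableT_comp mi measurable_fst).
have E x : (\int[mu]_q `|(pdot eta eta x * \1_D q)%:E| = (pdot eta eta x)%:E * mu D)%E.
  rewrite -[mu D]/(mu D) -[in mu D](setIT D) -(integral_indic mu measurableT mD).
  rewrite -ge0_integralZl//; last exact/measurable_EFinP.
  apply: eq_integral => q _; rewrite -EFinM gee0_abs//.
  by rewrite lee_fin mulr_ge0// pdot_ge0.
under eq_integral do rewrite E.
rewrite ge0_integralZr//; last exact: emeasurable_pdot.
have /HSP[_ fo] := heta.
rewrite muleC lte_mul_pinfty// ge0_fin_numE//; exact: cube_lty.
Qed.

Let iH eta : HS eta -> (mu \x mu)%E.-integrable setT (EFin \o H eta).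
Proof.
move=> heta; apply: le_integrable (integrableD _ iG1 (iG2 heta)) => //.
  by apply/measurable_EFinP; exact: mH.
move=> [q x] _ /=; rewrite lee_fin [leRHS]ger0_norm; last first.
  by rewrite addr_ge0// mulr_ge0// pdot_ge0.
rewrite /H/=; have [Dq|nDq] := pselect (D q); last first.
  rewrite PhiD// (_ : pdot 0 eta x = 0) ?normr0; last first.
    by rewrite /pdot big1// => I _; rewrite !sf0/= !mul0r addr0.
  by rewrite addr_ge0// mulr_ge0// pdot_ge0.
apply: le_trans (pdot_le _ _ _) _.
rewrite [q + x]addrC lerD//; last by rewrite indicE mem_set// mulr1.
rewrite pdot_umul indicE; case: (_ \in _) => /=.
  by rewrite expr1n.
by rewrite expr0n /= !mul0r.
Qed.

(** The weak form of T being the integral of the [Phi q]: after Fubini, the integral over q of phi(q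
    + x) is the mean of phi, whatever x is. *)
Let ip_T eta : HS eta -> ((ip T eta)%:E = \int[mu]_q (ip (Phi q) eta)%:E)%E.
Proof.
move=> heta.
have hT : HS T by apply: HS_tens_indic; [exact: measurable_cube|exact: cube_lty].
have -> : ((ip T eta)%:E = \int[mu]_x (pdot T eta x)%:E)%E.
  by rewrite fineK//; apply: integrable_fin_num => //; exact: pdot_integrable.
transitivity (\int[mu]_x \int[mu]_q (H eta (q, x))%:E)%E; last first.
  rewrite -(Fubini (iH heta)); apply: eq_integral => q _.
  rewrite fineK//; apply: integrable_fin_num => //; apply: pdot_integrable => //.
  exact: (subspace_HS cF (FPhi q)).
apply: eq_integral => x _.
have iR I : mu.-integrable setT (fun q => (Re (phi I (q + x)))%:E).
  exact: (integrable_shift x (cube_supp_integrable I hphi supp).1).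
have iI I : mu.-integrable setT (fun q => (Im (phi I (q + x)))%:E).
  exact: (integrable_shift x (cube_supp_integrable I hphi supp).2).
have HE q : (H eta (q, x))%:E = (\sum_I
   ((\1_Q x * Re (eta I x))%:E * (Re (phi I (q + x)))%:E +
    (\1_Q x * Im (eta I x))%:E * (Im (phi I (q + x)))%:E))%E.
  rewrite /H /pdot -sumEFin; apply: eq_bigr => I _.
  by rewrite -!EFinM -EFinD /Phi /umul !ReImE/= /shiftf [x + q]addrC; congr (_%:E); ring.
under eq_integral do rewrite HE.
rewrite integral_sum//; last first.
  by move=> I; apply: integrableD => //; exact: integrableZl.
rewrite /pdot -sumEFin; apply: eq_bigr => I _.
rewrite integralD//; try exact: integrableZl.
rewrite !integralZl// !(integral_shift x (f := fun q => (Re (phi I q))%:E))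
  ?(integral_shift x (f := fun q => (Im (phi I q))%:E)).
- rewrite /T /tens !ReImE/= /mean.
  rewrite -[X in (_ * X + _)%E]fineK; last first.
    apply: integrable_fin_num => //; exact: (cube_supp_integrable I hphi supp).1.
  rewrite -[X in (_ + _ * X)%E]fineK; last first.
    apply: integrable_fin_num => //; exact: (cube_supp_integrable I hphi supp).2.
  rewrite -!EFinM -EFinD; congr (_%:E).
  rewrite -/(Rintegral _ _ _) -/(Rintegral _ _ (fun x => Im (phi I x))); ring.
- exact: (cube_supp_integrable I hphi supp).2.
- exact: (cube_supp_integrable I hphi supp).1.
Qed.

Lemma tens_mean_invariant : F (tens (\1_(cube L)) (mean phi)).
Proof.
have hT : HS T by apply: HS_tens_indic; [exact: measurable_cube|exact: cube_lty].
have mD : measurable D by exact: measurable_cube.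
have Do : (mu D < +oo)%E by exact: cube_lty.
(* A cut translate has norm at most that of phi and vanishes for q outside [D]; integrating the
   bound e over [D] produces the factor [mu D]. *)
apply: (near_orthogonal cF (T := T) (M := ip phi phi) (C := fine (mu D))) => //.
- exact: ip_ge0.
- exact: fine_ge0.
move=> eta e heta e0 near.
rewrite -lee_fin (ip_T heta) mulrC EFinM fineK ?ge0_fin_numE//.
rewrite -[mu D]/(mu D) -[in mu D](setIT D) -(integral_indic mu measurableT mD).
rewrite -integralZl//; last exact: integrable_indic_lty.
apply: le_integral => //.
- have := integrable_fubini_F (iH heta); apply: eq_integrable => // q _.
  rewrite /fubini_F/= fineK//; apply: integrable_fin_num => //; apply: pdot_integrable => //.
  exact: (subspace_HS cF (FPhi q)).
- by apply: integrableZl => //; exact: integrable_indic_lty.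
move=> q _; rewrite -EFinM lee_fin indicE.
have [Dq|nDq] := pselect (D q); last first.
  rewrite PhiD// memNset// mulr0 (_ : ip 0 eta = 0)//.
  rewrite /ip (_ : pdot 0 eta = cst 0) ?Rintegral_cst ?mul0r//; apply/funext => x.
  by rewrite /pdot big1// => I _; rewrite !sf0/= !mul0r addr0.
rewrite mem_set// mulr1; apply: near => //.
rewrite -lee_fin.
rewrite -[leRHS](L2sq_ip hphi) -(L2sq_ip (subspace_HS cF (FPhi q))).
have mphi := HS_msfun hphi.
rewrite (L2sqE (HS_msfun hphi)) (L2sqE (HS_msfun (subspace_HS cF (FPhi q)))).
rewrite -(ge0_integral_shift q (f := fun x => (pdot phi phi x)%:E)); last 2 first.
- exact: emeasurable_pdot.
- by move=> x; rewrite lee_fin pdot_ge0.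
apply: ge0_le_integral => //; try by move=> x _; rewrite lee_fin pdot_ge0.
- by apply: emeasurable_pdot; exact: HS_msfun (subspace_HS cF (FPhi q)).
- exact: (measurableT_comp (emeasurable_pdot mphi mphi) (measurable_rVD q)).
- move=> x _; rewrite lee_fin pdot_umul indicE.
  case: (_ \in _) => /=; rewrite ?expr1n ?mul1r// expr0n/= mul0r.
  exact: pdot_ge0.
Qed.

End mean_in.

(** The mean of phi itself may vanish. Multiplying phi by the conjugate of a nonzero component
    [phi I0], cut down to a bounded set, turns that component into a nonnegative function of nonzero
    integral. *)
Lemma exists_mean_neq0 phi : F phi -> L2sq phi != 0%E ->
  exists w, (exists I, w I != 0) /\ forall L, F (tens (\1_(cube L)) w).
Proof.
move=> Fphi phi0; have hphi := subspace_HS cF Fphi.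
have mphi := HS_msfun hphi; have [mR mI] := mphi.
pose h I x := Re (phi I x) ^+ 2 + Im (phi I x) ^+ 2.
have h0 I x : 0 <= h I x by rewrite addr_ge0// sqr_ge0.
have mh I : measurable_fun setT (fun x => (h I x)%:E).
  by apply/measurable_EFinP; apply: measurable_funD; exact: measurable_funX.
have ih I : mu.-integrable setT (fun x => (h I x)%:E).
  apply: le_integrable (pdot_integrable hphi hphi) => // x _.
  by rewrite !abse_EFin lee_fin !ger0_norm ?pdot_ge0//; exact: pdot_coord.
have [I0 hI0] : exists I, (\int[mu]_x (h I x)%:E)%E <> 0%E.
  apply: contrapT => nex; move/eqP : phi0; apply; rewrite /L2sq big1// => I _.
  by apply: contrapT => ?; apply: nex; exists I.
(* Bounding phi on [B n] makes the multiplication by [phi I0] preserve square-integrability. *)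
pose B n := cube n%:R `&` [set x | pdot phi phi x <= n%:R].
have mB n : measurable (B n).
  apply: measurableI; first exact: measurable_cube.
  rewrite -[X in measurable X]setTI.
  by apply: (measurable_fun_le (f := pdot phi phi) (g := cst n%:R)) => //; exact: measurable_pdot.
have m1 n : measurable_fun setT (\1_(B n) : 'rV[R]_m -> R) by exact: measurable_indic.
have ile n x : 0 <= (\1_(B n) x : R) <= 1.
  by rewrite indicE; case: (_ \in _); rewrite /= ?ler01 ?lexx.
have [n hn] : exists n, (\int[mu]_x (\1_(B n) x * h I0 x)%:E)%E <> 0%E.
  apply: contrapT => nex; apply: hI0.
  have [] := @dominated_convergence _ _ _ mu setT measurableT
    (fun n x => (\1_(B n) x * h I0 x)%:E) (fun x => (h I0 x)%:E) (fun x => (h I0 x)%:E).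
  - move=> n; apply/measurable_EFinP; apply: measurable_funM => //.
    by move/measurable_EFinP : (mh I0).
  - exact: mh.
  - apply: aeW => x _; apply: cvg_near_cst.
    have [K0 xK] := cubeP x; near=> n.
    rewrite indicE mem_set/= ?mul1r//; split.
      by apply: xK; near: n; exact: nbhs_infty_ger.
    by rewrite /=; near: n; exact: nbhs_infty_ger.
  - exact: ih.
  - apply: aeW => x n _; have /andP[a b] := ile n x.
    by rewrite abse_EFin lee_fin ger0_norm ?mulr_ge0// ler_piMl.
  move=> _ _; rewrite (_ : [sequence _]_n = cst 0%E); last first.
    by apply/funext => n /=; apply: contrapT => ?; apply: nex; exists n.
  by move/(cvg_lim (@ereal_hausdorff _)); rewrite lim_cst//; exact: ereal_hausdorff.
pose u (f : R[i] -> R) x := \1_(B n) x * f (phi I0 x).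
have Fu (f : R[i] -> R) : measurable_fun setT (fun x => f (phi I0 x)) ->
    (forall z, f z ^+ 2 <= Re z ^+ 2 + Im z ^+ 2) -> F (umul (u f) phi).
  move=> mf fle; apply: (umul_invariant cF hb FU) => //.
    exact: measurable_funM.
  apply: (@HS_dom _ _ _ _ _ (fun x => n%:R%:E * (pdot phi phi x)%:E)%E).
  - by apply: msfun_umul => //; exact: measurable_funM.
  - by apply: integrableZl => //; exact: pdot_integrable.
  - move=> x; rewrite -EFinM lee_fin pdot_umul ler_wpM2r ?pdot_ge0// /u indicE.
    case: (boolP (x \in _)) => /=; last by rewrite mul0r expr0n.
    rewrite inE mul1r => -[_ /= le]; apply: le_trans le.
    exact: le_trans (fle _) (pdot_coord phi I0 x).
pose re (z : R[i]) := Re z; pose im (z : R[i]) := Im z.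
have FR : F (umul (u re) phi).
  by apply: Fu => [|z]; [exact: mR|rewrite lerDl sqr_ge0].
have FI : F (umul (u im) phi).
  by apply: Fu => [|z]; [exact: mI|rewrite lerDr sqr_ge0].
(* This is the conjugate of [phi I0] times phi on [B n], and 0 elsewhere. *)
pose phi' := (0 +i* (-1))%C *: umul (u im) phi + umul (u re) phi.
have Fphi' : F phi' by exact: subspaceZD.
have supp x : ~ cube n%:R x -> forall J, phi' J x = 0.
  move=> nx J; have u0 f : u f x = 0.
    by rewrite /u indicE memNset ?mul0r// => -[].
  by rewrite /phi' sfD sfZ /umul !u0 !mul0r mulr0 addr0.
exists (mean phi'); split; last by move=> L; exact: (tens_mean_invariant Fphi' supp).
exists I0; apply/eqP => /(congr1 re)/= E; apply: hn.
have E' : (fun x => Re (phi' I0 x)) = (fun x => \1_(B n) x * h I0 x).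
  by apply/funext => x; rewrite /phi' sfD sfZ /umul !ReImE/= /u /re /im /h; ring.
have iE : mu.-integrable setT (fun x => (\1_(B n) x * h I0 x)%:E).
  have := (cube_supp_integrable I0 (subspace_HS cF Fphi') supp).1.
  by congr (_.-integrable _ _); apply/funext => x; rewrite -(congr1 (@^~ x) E').
transitivity ((\int[mu]_x Re (phi' I0 x))%:E); last by rewrite [X in X%:E]E.
by rewrite E' /Rintegral fineK//; exact: integrable_fin_num.
Unshelve. all: by end_near.
Qed.

Lemma tens_limit u w : (forall L, F (tens (\1_(cube L)) w)) ->
  measurable_fun setT u -> (\int[mu]_x (u x ^+ 2)%:E < +oo)%E -> F (tens u w).
Proof.
move=> Fw mu' uo; have ht := HS_tens w mu' uo.
have E1 : umul (cst 1) (tens u w) = tens u w.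
  by apply/funext => I; apply/funext => x; rewrite /umul mul1r.
rewrite -E1.
apply: (umul_lim cF (f := fun n => \1_(cube n%:R)) (w := cst 1)) => //; last 4 first.
- exact: msfun_tens.
- by move=> n x; rewrite indicE ger0_norm//; case: (_ \in _) => /=.
- move=> x; apply: cvg_near_cst; have [K0 xK] := cubeP x; near=> n.
  rewrite indicE mem_set//; apply: xK; near: n; exact: nbhs_infty_ger.
- by rewrite E1.
- by move=> n; apply: measurable_indic; exact: measurable_cube.
(* The two scalar factors are exchanged: u, possibly unbounded, becomes the multiplier of a cut
   tensor known to lie in F. *)
- move=> n; have -> : umul \1_(cube n%:R) (tens u w) = umul u (tens \1_(cube n%:R) w).
    apply/funext => I; apply/funext => x.
    by rewrite /umul /tens mulrCA [RHS]mulrC -mulrA [X in _ * X]mulrC.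
  apply: (umul_invariant cF hb FU) => //.
  apply: HS_dom (pdot_integrable ht ht) _.
    apply: msfun_umul => //; apply: msfun_tens; apply: measurable_indic.
    exact: measurable_cube.
  move=> x; rewrite lee_fin pdot_umul !pdot_tens mulrA ler_wpM2r//.
    by apply: sumr_ge0 => I _; rewrite addr_ge0// sqr_ge0.
  rewrite indicE; case: (_ \in _) => /=; rewrite ?expr1n ?mulr1// expr0n mulr0.
  exact: sqr_ge0.
Unshelve. all: by end_near.
Qed.

End pure_tensors.

(** * The Gaussian is a smooth vector *)

Section line_derivatives.
Context {R : realType}.
Implicit Types (f g : R -> R) (t c d : R).

(** The rules of calculus are restated for functions written pointwise, so that derivatives of
    explicit formulas are assembled by unification and adjusted at the end by [der1_eq]. *)
Lemma der1D f g t c d : is_derive t (1 : R) f c -> is_derive t (1 : R) g d ->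
  is_derive t (1 : R) (fun x => f x + g x) (c + d).
Proof. by move=> hf hg; exact: is_deriveD. Qed.

Lemma der1M f g t c d : is_derive t (1 : R) f c -> is_derive t (1 : R) g d ->
  is_derive t (1 : R) (fun x => f x * g x) (f t * d + g t * c).
Proof. by move=> hf hg; exact: is_deriveM. Qed.

Lemma der1_cst (a : R) t : is_derive t (1 : R) (fun=> a) 0.
Proof. exact: is_derive_cst. Qed.

Lemma der1_eq f t c d : c = d -> is_derive t (1 : R) f c -> is_derive t (1 : R) f d.
Proof. by move=> ->. Qed.

Lemma der1Z (a : R) f t c : is_derive t (1 : R) f c -> is_derive t (1 : R) (fun x => a * f x) (a * c).
Proof. by move=> hf; apply: der1_eq (der1M (der1_cst a t) hf); rewrite mulr0 addr0. Qed.

Lemma der1_affine (a b : R) t : is_derive t (1 : R) (fun x => x * a + b) a.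
Proof.
apply: der1_eq (der1D (der1M (is_derive_id t (1 : R)) (der1_cst a t)) (der1_cst b t)).
by rewrite mulr0 add0r addr0 mulr1.
Qed.

Lemma der1_sum n (h : 'I_n -> R -> R) t (dh : 'I_n -> R) :
  (forall i, is_derive t (1 : R) (h i) (dh i)) ->
  is_derive t (1 : R) (fun x => \sum_(i < n) h i x) (\sum_(i < n) dh i).
Proof.
move=> H; rewrite (_ : (fun x => _) = \sum_(i < n) h i); first exact: is_derive_sum.
by apply/funext => x; rewrite fct_sumE.
Qed.

Lemma der1_comp (F : R -> R) (dF : R -> R) f t c : (forall y, is_derive y (1 : R) F (dF y)) ->
  is_derive t (1 : R) f c -> is_derive t (1 : R) (fun x => F (f x)) (dF (f t) * c).
Proof. by move=> hF hf; exact: is_derive1_comp. Qed.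

Lemma der1_MVT f (df : R -> R) : (forall t, is_derive t (1 : R) f (df t)) ->
  exists2 c, 0 < c < 1 & f 1 - f 0 = df c.
Proof.
move=> H; have [|c] := @MVT R f df 0 1 ltr01 (fun x _ => H x).
- apply: continuous_subspaceT => x.
  by apply/differentiable_continuous/derivable1_diffP; exact: (@ex_derive _ _ _ _ _ _ _ (H x)).
- by rewrite in_itv/= subr0 mulr1 => ? ?; exists c.
Qed.

End line_derivatives.

Section tame.
Context {R : realType} {m : nat} (hbar : R).
Local Notation rV := 'rV[R]_m.
Local Notation bh := (@bheis R m).
Implicit Types (h X : bh) (x : rV) (K : bh -> rV -> R).

(** The factor 2 gives room for translations: gam(x - q) is at most exp(2 |q|^2) exp(-|x|^2), by
    [sqn_shift_le]. *)
Definition gam x : R := expR (- (2 * sqn x)).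
Definition phase h x : R := hbar * (h.2 + dot (2^-1 *: h.1.1 - x) h.1.2).

(* The functions of the group element h and the point x spanned by the products of a
   monomial in their coordinates with the real or imaginary part of [U0 h gam x]: a class
   that contains the orbit of the Gaussian and is closed under derivation in h. *)
Inductive tame : (bh -> rV -> R) -> Prop :=
| tame_cos : tame (fun h x => cos (phase h x) * gam (x - h.1.1))
| tame_sin : tame (fun h x => sin (phase h x) * gam (x - h.1.1))
| tame_lin c K K' : tame K -> tame K' -> tame (fun h x => c * K h x + K' h x)
| tame_x i K : tame K -> tame (fun h x => x ord0 i * K h x)
| tame_q i K : tame K -> tame (fun h x => h.1.1 ord0 i * K h x)
| tame_p i K : tame K -> tame (fun h x => h.1.2 ord0 i * K h x).

Lemma tame_eq K K' : tame K -> (forall h x, K h x = K' h x) -> tame K'.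
Proof.
by move=> tK E; rewrite (_ : K' = K)//; apply/funext => h; apply/funext => x.
Qed.

Lemma tame0 : tame (fun _ _ => 0).
Proof.
by apply: tame_eq (tame_lin (-1) tame_cos tame_cos) _ => h x /=; rewrite mulN1r addNr.
Qed.

Lemma tameZ c K : tame K -> tame (fun h x => c * K h x).
Proof.
by move=> tK; apply: tame_eq (tame_lin c tK tame0) _ => h x /=; rewrite addr0.
Qed.

Lemma tameD K K' : tame K -> tame K' -> tame (fun h x => K h x + K' h x).
Proof.
by move=> t t'; apply: tame_eq (tame_lin 1 t t') _ => h x /=; rewrite mul1r.
Qed.

Lemma tame_sum (n : nat) (K : 'I_n -> bh -> rV -> R) : (forall i, tame (K i)) ->
  tame (fun h x => \sum_(i < n) K i h x).
Proof.
elim: n K => [|n IHn] K tK.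
  by apply: tame_eq tame0 _ => h x; rewrite big_ord0.
apply: tame_eq (tameD (tK ord0) (IHn _ (fun i => tK (lift ord0 i)))) _ => h x.
by rewrite big_ord_recl.
Qed.

(** The derivative along X, with A, B, C the partial derivatives in q, p and t. Keeping X outside
    them makes the linearity in X, and hence bounds proportional to |X|, visible. *)
Definition grad (A B : 'I_m -> bh -> rV -> R) (C : bh -> rV -> R) X h x : R :=
  \sum_i X.1.1 ord0 i * A i h x + \sum_i X.1.2 ord0 i * B i h x + X.2 * C h x.

Lemma tame_grad A B C X : (forall i, tame (A i)) -> (forall i, tame (B i)) ->
  tame C -> tame (grad A B C X).
Proof.
move=> tA tB tC; apply: tameD; last exact: tameZ.
by apply: tameD; apply: tame_sum => i; exact: tameZ.
Qed.

Let qE (t : R) X h i : (t *: X + h).1.1 ord0 i = t * X.1.1 ord0 i + h.1.1 ord0 i.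
Proof. by rewrite /= !mxE. Qed.
Let pE (t : R) X h i : (t *: X + h).1.2 ord0 i = t * X.1.2 ord0 i + h.1.2 ord0 i.
Proof. by rewrite /= !mxE. Qed.

Lemma der1_phase X h x t : is_derive t (1 : R) (fun t => phase (t *: X + h) x)
  (\sum_i X.1.1 ord0 i * (hbar / 2 * (t *: X + h).1.2 ord0 i) +
   \sum_i X.1.2 ord0 i * (hbar * (2^-1 * (t *: X + h).1.1 ord0 i - x ord0 i)) +
   X.2 * hbar).
Proof.
pose S := \sum_i X.1.1 ord0 i * (2^-1 * (t *: X + h).1.2 ord0 i) +
   \sum_i X.1.2 ord0 i * (2^-1 * (t *: X + h).1.1 ord0 i - x ord0 i).
apply: (@der1_eq _ _ _ (hbar * (X.2 + S))).
  rewrite mulrDr /S mulrDr !mulr_sumr addrC [hbar * X.2]mulrC; congr (_ + _ + _).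
    by apply: eq_bigr => i _; ring.
  by apply: eq_bigr => i _; ring.
apply: der1Z; apply: der1D; first exact: der1_affine.
rewrite /S -big_split /dot; apply: der1_sum => i.
have -> : (fun t => (2^-1 *: (t *: X + h).1.1 - x) ord0 i * (t *: X + h).1.2 ord0 i) =
  (fun t => (t * (2^-1 * X.1.1 ord0 i) + (2^-1 * h.1.1 ord0 i - x ord0 i)) *
     (t * X.1.2 ord0 i + h.1.2 ord0 i)).
  by apply/funext => u; rewrite /= !mxE; ring.
apply: der1_eq (der1M (der1_affine _ _ _) (der1_affine _ _ _)).
by rewrite /= !mxE; field.
Qed.

Lemma der1_gam X h x t : is_derive t (1 : R) (fun t => gam (x - (t *: X + h).1.1))
  (\sum_i X.1.1 ord0 i * (4 * (x ord0 i - (t *: X + h).1.1 ord0 i)) *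
   gam (x - (t *: X + h).1.1)).
Proof.
rewrite /gam.
have H : is_derive t (1 : R) (fun t => - (2 * sqn (x - (t *: X + h).1.1)))
  (\sum_i X.1.1 ord0 i * (4 * (x ord0 i - (t *: X + h).1.1 ord0 i))).
  have -> : (fun t => - (2 * sqn (x - (t *: X + h).1.1))) =
    (fun t => \sum_i (-2) * ((t * (- X.1.1 ord0 i) + (x ord0 i - h.1.1 ord0 i)) *
      (t * (- X.1.1 ord0 i) + (x ord0 i - h.1.1 ord0 i)))).
    apply/funext => u; rewrite /sqn mulr_sumr -sumrN; apply: eq_bigr => i _.
    by rewrite /= !mxE; ring.
  apply: der1_sum => i.
  apply: der1_eq (der1Z _ (der1M (der1_affine _ _ _) (der1_affine _ _ _))).
  by rewrite qE; ring.
apply: der1_eq (der1_comp (@is_derive_expR R) H).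
by rewrite mulrC mulr_suml.
Qed.

Let E1 (a b : 'I_m -> R) (k q : R) j :
  \sum_i a i * ((i == j)%:R * k + q * b i) = a j * k + q * (\sum_i a i * b i).
Proof.
under eq_bigr do rewrite mulrDr.
rewrite big_split/= (bigD1 j)//= eqxx mul1r big1 ?addr0; last first.
  by move=> i /negbTE ->; rewrite mul0r mulr0.
by rewrite mulr_sumr; congr (_ + _); apply: eq_bigr => i _; ring.
Qed.

Let E2 (a b : 'I_m -> R) (q : R) : \sum_i a i * (q * b i) = q * (\sum_i a i * b i).
Proof. by rewrite mulr_sumr; apply: eq_bigr => i _; ring. Qed.

Lemma tame_derive K : tame K -> exists A B C,
  [/\ forall i, tame (A i), forall i, tame (B i), tame C &
   forall X h x t, is_derive t (1 : R) (fun t => K (t *: X + h) x)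
     (grad A B C X (t *: X + h) x)].
Proof.
elim=> {K} [||c K K' tK [A [B [C [tA tB tC H]]]] tK' [A' [B' [C' [tA' tB' tC' H']]]]
  |j K tK [A [B [C [tA tB tC H]]]]|j K tK [A [B [C [tA tB tC H]]]]
  |j K tK [A [B [C [tA tB tC H]]]]].
(* The phase has partial derivatives hbar p_i / 2, hbar (q_i / 2 - x_i) and hbar in q_i, p_i and t;
   the Gaussian has 4 (x_i - q_i) times itself in q_i. *)
- exists (fun i h x => 4 * (x ord0 i * (cos (phase h x) * gam (x - h.1.1))) +
    ((-4) * (h.1.1 ord0 i * (cos (phase h x) * gam (x - h.1.1))) +
     (- (hbar / 2)) * (h.1.2 ord0 i * (sin (phase h x) * gam (x - h.1.1))))).
  exists (fun i h x => hbar * (x ord0 i * (sin (phase h x) * gam (x - h.1.1))) +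
    (- (hbar / 2)) * (h.1.1 ord0 i * (sin (phase h x) * gam (x - h.1.1)))).
  exists (fun h x => - hbar * (sin (phase h x) * gam (x - h.1.1))).
  split.
  + move=> i; apply: tame_lin; first exact/tame_x/tame_cos.
    apply: tame_lin; first exact/tame_q/tame_cos.
    exact/tameZ/tame_p/tame_sin.
  + move=> i; apply: tame_lin; first exact/tame_x/tame_sin.
    exact/tameZ/tame_q/tame_sin.
  + exact/tameZ/tame_sin.
  + move=> X h x t.
    apply: der1_eq (der1M (der1_comp (@is_derive_cos R) (der1_phase X h x t)) (der1_gam X h x t)).
    rewrite /grad; set c := cos _; set s := sin _; set g := gam _.
    rewrite !mulrDr !mulr_sumr !addrA -big_split/=; congr (_ + _ + _); last by ring.
      by apply: eq_bigr => i _; field.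
    by apply: eq_bigr => i _; field.
- exists (fun i h x => 4 * (x ord0 i * (sin (phase h x) * gam (x - h.1.1))) +
    ((-4) * (h.1.1 ord0 i * (sin (phase h x) * gam (x - h.1.1))) +
     ((hbar / 2)) * (h.1.2 ord0 i * (cos (phase h x) * gam (x - h.1.1))))).
  exists (fun i h x => - hbar * (x ord0 i * (cos (phase h x) * gam (x - h.1.1))) +
    ((hbar / 2)) * (h.1.1 ord0 i * (cos (phase h x) * gam (x - h.1.1)))).
  exists (fun h x => hbar * (cos (phase h x) * gam (x - h.1.1))).
  split.
  + move=> i; apply: tame_lin; first exact/tame_x/tame_sin.
    apply: tame_lin; first exact/tame_q/tame_sin.
    exact/tameZ/tame_p/tame_cos.
  + move=> i; apply: tame_lin; first exact/tame_x/tame_cos.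
    exact/tameZ/tame_q/tame_cos.
  + exact/tameZ/tame_cos.
  + move=> X h x t.
    apply: der1_eq (der1M (der1_comp (@is_derive_sin R) (der1_phase X h x t)) (der1_gam X h x t)).
    rewrite /grad; set c := cos _; set s := sin _; set g := gam _.
    rewrite !mulrDr !mulr_sumr !addrA -big_split/=; congr (_ + _ + _); last by ring.
      by apply: eq_bigr => i _; field.
    by apply: eq_bigr => i _; field.
- exists (fun i h x => c * A i h x + A' i h x), (fun i h x => c * B i h x + B' i h x),
    (fun h x => c * C h x + C' h x).
  split; try by [move=> i; exact: tame_lin|exact: tame_lin].
  move=> X h x t; apply: der1_eq (der1D (der1Z c (H X h x t)) (H' X h x t)).
  have E (a b d : 'I_m -> R) : \sum_i a i * (c * b i + d i) =
      c * (\sum_i a i * b i) + \sum_i a i * d i.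
    by rewrite mulr_sumr -big_split; apply: eq_bigr => i _ /=; ring.
  by rewrite /grad !E; ring.
- exists (fun i h x => x ord0 j * A i h x), (fun i h x => x ord0 j * B i h x),
    (fun h x => x ord0 j * C h x).
  split; try by [move=> i; exact: tame_x|exact: tame_x].
  move=> X h x t; apply: der1_eq (der1Z (x ord0 j) (H X h x t)).
  rewrite /grad !mulrDr !mulr_sumr; congr (_ + _ + _); try by ring.
    by apply: eq_bigr => i _; ring.
  by apply: eq_bigr => i _; ring.
- exists (fun i h x => (i == j)%:R * K h x + h.1.1 ord0 j * A i h x),
   (fun i h x => h.1.1 ord0 j * B i h x), (fun h x => h.1.1 ord0 j * C h x).
  split.
  + by move=> i; apply: tame_lin => //; exact: tame_q.
  + by move=> i; exact: tame_q.
  + exact: tame_q.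
  move=> X h x t.
  have E : (fun t => (t *: X + h).1.1 ord0 j) = (fun t => t * X.1.1 ord0 j + h.1.1 ord0 j).
    by apply/funext => u; rewrite qE.
  have D : is_derive t (1 : R) (fun t => (t *: X + h).1.1 ord0 j) (X.1.1 ord0 j).
    by rewrite E; exact: der1_affine.
  apply: der1_eq (der1M D (H X h x t)).
  by rewrite /grad (E1 _ _ _ _ j) !E2; ring.
- exists (fun i h x => h.1.2 ord0 j * A i h x),
   (fun i h x => (i == j)%:R * K h x + h.1.2 ord0 j * B i h x),
   (fun h x => h.1.2 ord0 j * C h x).
  split.
  + by move=> i; exact: tame_p.
  + by move=> i; apply: tame_lin => //; exact: tame_p.
  + exact: tame_p.
  move=> X h x t.
  have E : (fun t => (t *: X + h).1.2 ord0 j) = (fun t => t * X.1.2 ord0 j + h.1.2 ord0 j).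
    by apply/funext => u; rewrite pE.
  have D : is_derive t (1 : R) (fun t => (t *: X + h).1.2 ord0 j) (X.1.2 ord0 j).
    by rewrite E; exact: der1_affine.
  apply: der1_eq (der1M D (H X h x t)).
  by rewrite /grad (E1 _ _ _ _ j) !E2; ring.
Qed.

End tame.

(** * Gaussian majorants, locally uniform in the group element *)

Section tame_bounds.
Context {R : realType} {m : nat} (hbar : R).
Local Notation rV := 'rV[R]_m.
Local Notation bh := (@bheis R m).
Local Notation tame := (@tame R m hbar).
Implicit Types (h X : bh) (x : rV) (K : bh -> rV -> R).

Lemma coord_le_norm (x : rV) i : `|x ord0 i| <= `|x|.
Proof.
rewrite [leRHS]/Num.norm /= mx_normrE; apply/bigmax_geP; right => /=.
by exists (ord0, i).
Qed.

Lemma bheis_norm h : [/\ forall i, `|h.1.1 ord0 i| <= `|h|,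
  forall i, `|h.1.2 ord0 i| <= `|h| & `|h.2| <= `|h|].
Proof.
rewrite prod_normE /=.
have h1 : `|h.1| <= Num.max `|h.1| `|h.2| by rewrite le_max lexx.
split; last by rewrite le_max lexx orbT.
- move=> i; apply: le_trans (coord_le_norm _ _) (le_trans _ h1).
  by rewrite prod_normE le_max lexx.
- move=> i; apply: le_trans (coord_le_norm _ _) (le_trans _ h1).
  by rewrite prod_normE le_max lexx orbT.
Qed.

Lemma tame_measurable K h : tame K -> measurable_fun setT (K h).
Proof.
have mg : measurable_fun setT (fun x : rV => gam (x - h.1.1)).
  rewrite /gam; apply: measurableT_comp => //.
  under eq_fun do rewrite -mulNr; apply: measurable_funM => //.
  exact: (measurableT_comp (@measurable_sqn R m) (measurable_rVD (- h.1.1))).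
have mp : measurable_fun setT (phase hbar h).
  apply: measurable_funM => //; apply: measurable_funD => //.
  apply: measurable_sum => i; apply: measurable_funM => //.
  under eq_fun do rewrite !mxE.
  by apply: measurable_funB => //; exact: measurable_coord.
elim=> {K} [||c K K' _ mK _ mK'|i K _ mK|i K _ mK|i K _ mK].
- apply: measurable_funM => //; apply: measurableT_comp => //.
  by apply: continuous_measurable_fun; exact: continuous_cos.
- apply: measurable_funM => //; apply: measurableT_comp => //.
  by apply: continuous_measurable_fun; exact: continuous_sin.
- by apply: measurable_funD => //; exact: measurable_funM.
- by apply: measurable_funM => //; exact: measurable_coord.
- exact: measurable_funM.
- exact: measurable_funM.
Qed.

Lemma sqn_shift_le (x q : rV) : sqn x <= 2 * sqn (x - q) + 2 * sqn q.
Proof.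
rewrite /sqn !mulr_sumr -big_split; apply: ler_sum => i _ /=; rewrite !mxE.
set a := x ord0 i; set b := q ord0 i.
by have := sqr_ge0 (a - 2 * b); rewrite !expr2; lra.
Qed.

(** All rates dl < 1 are treated together, because each factor x_i consumes a little of the decay:
    the induction hypothesis is then needed at a larger rate. *)
Lemma tame_bound K (M dl : R) : tame K -> 0 <= M -> 0 < dl < 1 ->
  exists2 C, 0 <= C & forall h x, `|h| <= M -> `|K h x| <= C * expR (- (dl * sqn x)).
Proof.
move=> tK M0; elim: tK dl => {K} [||c K K' _ IH _ IH'|i K _ IH|i K _ IH|i K _ IH] dl dl01.
(* The norm of h bounds each of its coordinates, so that |q|^2 <= m M^2. *)
1,2: exists (expR (2 * (m%:R * M ^+ 2))); first exact: expR_ge0.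
1,2: move=> h x hM; have [nq _ _] := bheis_norm h.
1,2: rewrite normrM -[leRHS]mul1r; apply: ler_pM => //.
1: by rewrite ler_norml cos_geN1 cos_le1.
2: by rewrite ler_norml sin_geN1 sin_le1.
1,2: rewrite ger0_norm ?expR_ge0// /gam -expRD ler_expR.
1,2: have := sqn_shift_le x h.1.1; have := sqn_ge0 x => S0 Sx.
1,2: have : dl * sqn x <= sqn x by rewrite ler_piMl//; case/andP: dl01; lra.
1,2: suff : sqn h.1.1 <= m%:R * M ^+ 2 by lra.
1,2: rewrite /sqn mulr_natl -[X in _ *+ X]card_ord -sumr_const; apply: ler_sum => i _.
1,2: rewrite -real_normK ?num_real// ler_sqr ?nnegrE//; exact: le_trans hM.
- have [C C0 HC] := IH _ dl01; have [C' C'0 HC'] := IH' _ dl01.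
  exists (`|c| * C + C'); first by rewrite addr_ge0// mulr_ge0.
  move=> h x hM; rewrite mulrDl (le_trans (ler_normD _ _))// lerD ?HC'//.
  by rewrite normrM -mulrA ler_wpM2l// HC.
(* The rate dl + e is still below 1, and exp(e |x|^2) absorbs x_i because |x_i| <= (1 + 1/e)(1 + e
   |x|^2). *)
- pose e := (1 - dl) / 2; have [dl0 dl1] := andP dl01.
  have e0 : 0 < e by rewrite /e; lra.
  have [|C C0 HC] := IH (dl + e); first by apply/andP; rewrite /e; split; lra.
  exists ((1 + e^-1) * C); first by rewrite mulr_ge0// addr_ge0// invr_ge0 ltW.
  move=> h x hM; rewrite normrM -mulrA.
  rewrite (_ : - (dl * sqn x) = e * sqn x + - ((dl + e) * sqn x)); last by ring.
  rewrite expRD mulrCA [X in _ <= X](_ : _ = ((1 + e^-1) * expR (e * sqn x)) *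
    (C * expR (- ((dl + e) * sqn x)))); last by ring.
  apply: ler_pM => //; last exact: HC.
  apply: (@le_trans _ _ ((1 + e^-1) * (1 + e * sqn x))); last first.
    by rewrite ler_wpM2l ?expR_ge1Dx// addr_ge0// invr_ge0 ltW.
  have y2 : x ord0 i ^+ 2 <= sqn x.
    by rewrite /sqn (bigD1 i)//= lerDl sumr_ge0// => j _; exact: sqr_ge0.
  rewrite mulrDl mul1r [e^-1 * _]mulrDr mulr1 mulKf ?gt_eqF//.
  have ei : 0 <= e^-1 by rewrite invr_ge0 ltW.
  have es : 0 <= e * sqn x by apply: mulr_ge0; [exact: ltW|exact: sqn_ge0].
  rewrite -real_normK ?num_real// in y2.
  have := sqr_ge0 (`|x ord0 i| - 1); rewrite sqrrB mulr1 expr1n.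
  have := normr_ge0 (x ord0 i); lra.
- have [C C0 HC] := IH _ dl01; exists (M * C); first exact: mulr_ge0.
  move=> h x hM; rewrite normrM -mulrA; have [nq _ _] := bheis_norm h.
  by apply: ler_pM => //; [exact: le_trans hM|exact: HC].
- have [C C0 HC] := IH _ dl01; exists (M * C); first exact: mulr_ge0.
  move=> h x hM; rewrite normrM -mulrA; have [_ np _] := bheis_norm h.
  by apply: ler_pM => //; [exact: le_trans hM|exact: HC].
Qed.

(** Its square is the integrable Gaussian exp(-|x|^2). *)
Definition half_gauss x : R := expR (- (2^-1 * sqn x)).

Lemma tame_halfbound K (M : R) : tame K -> 0 <= M ->
  exists2 C, 0 <= C & forall h x, `|h| <= M -> `|K h x| <= C * half_gauss x.
Proof. by move=> tK M0; apply: tame_bound => //; apply/andP; split; lra. Qed.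

Lemma common_bound (J : finType) (K : J -> bh -> rV -> R) (M : R) :
  (forall j, tame (K j)) -> 0 <= M ->
  exists2 C, 0 <= C & forall j h x, `|h| <= M -> `|K j h x| <= C * half_gauss x.
Proof.
move=> tK M0.
have /boolp.choice[c cP] (j : J) : exists C, 0 <= C /\
    forall h x, `|h| <= M -> `|K j h x| <= C * half_gauss x.
  by have [C C0 HC] := tame_halfbound (tK j) M0; exists C.
exists (\sum_j c j); first by apply: sumr_ge0 => j _; exact: (cP j).1.
move=> j h x hM; apply: le_trans ((cP j).2 h x hM) _.
rewrite ler_wpM2r ?expR_ge0// (bigD1 j)//= lerDl sumr_ge0// => i _.
exact: (cP i).1.
Qed.

Lemma grad_bound A B C (M : R) : (forall i, tame (A i)) -> (forall i, tame (B i)) ->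
  tame C -> 0 <= M -> exists2 c, 0 <= c & forall X h x, `|h| <= M ->
    `|grad A B C X h x| <= `|X| * (c * half_gauss x).
Proof.
move=> tA tB tC M0.
have [a a0 Ha] := common_bound tA M0; have [b b0 Hb] := common_bound tB M0.
have [d d0 Hd] := tame_halfbound tC M0.
exists (m%:R * a + m%:R * b + d); first by rewrite !addr_ge0// mulr_ge0.
move=> X h x hM; have [nq np nt] := bheis_norm X.
have sm (y : 'I_m -> R) (K : 'I_m -> bh -> rV -> R) e : (forall i, `|y i| <= `|X|) ->
    (forall i, `|K i h x| <= e * half_gauss x) ->
    `|\sum_i y i * K i h x| <= `|X| * (m%:R * e * half_gauss x).
  move=> hy hK; apply: le_trans (ler_norm_sum _ _ _) _.
  rewrite -mulrA mulrCA mulr_natl -[X in _ *+ X]card_ord -sumr_const.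
  by apply: ler_sum => i _; rewrite normrM; apply: ler_pM.
rewrite /grad; apply: le_trans (ler_normD _ _) _.
rewrite mulrDl mulrDr lerD//; last by rewrite normrM; apply: ler_pM => //; exact: Hd.
apply: le_trans (ler_normD _ _) _; rewrite mulrDl mulrDr lerD//; apply: sm => // i.
  exact: Ha.
exact: Hb.
Qed.

Lemma tame_lip K (M : R) : tame K -> 0 <= M -> exists2 c, 0 <= c &
  forall X h x, `|h| + `|X| <= M -> `|K (X + h) x - K h x| <= `|X| * (c * half_gauss x).
Proof.
move=> tK M0; have [A [B [C [tA tB tC H]]]] := tame_derive tK.
have [c c0 Hc] := grad_bound tA tB tC M0; exists c => // X h x hM.
have [t /andP[t0 t1]] := der1_MVT (H X h x); rewrite scale1r scale0r add0r => ->.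
apply: Hc; apply: le_trans hM; apply: le_trans (ler_normD _ _) _.
by rewrite addrC lerD2l normrZ gtr0_norm// ler_piMl// ltW.
Qed.

(** A first-order estimate whose error carries a Gaussian in x: pointwise derivatives thereby become
    derivatives in the Hilbert norm. *)
Lemma tame_quotient K X : tame K -> exists2 K', tame K' &
  (forall h x, is_derive (0 : R) (1 : R) (fun t => K (t *: X + h) x) (K' h x)) /\
  forall M, 0 <= M -> exists2 c, 0 <= c & forall t h x, t != 0 -> `|t| <= 1 ->
    `|h| + `|X| <= M ->
    `|t^-1 * (K (t *: X + h) x - K h x) - K' h x| <= `|t| * (c * half_gauss x).
Proof.
move=> tK; have [A [B [C [tA tB tC H]]]] := tame_derive tK.
have tG := tame_grad X tA tB tC.
exists (grad A B C X) => //; split.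
  by move=> h x; have := H X h x 0; rewrite scale0r add0r.
move=> M M0; have [c c0 Hc] := tame_lip tG M0.
exists (`|X| * c); first exact: mulr_ge0.
move=> t h x t0 t1 hM.
(* Mean value theorem for [K]; [Hc] is the same for its derivative. *)
have [u /andP[u0 u1]] := der1_MVT (H (t *: X) h x).
rewrite scale1r scale0r add0r => ->.
have -> : grad A B C (t *: X) (u *: (t *: X) + h) x =
    t * grad A B C X (u *: (t *: X) + h) x.
  rewrite /grad !mulrDr !mulr_sumr; congr (_ + _ + _).
  - by apply: eq_bigr => i _; rewrite /= !mxE mulrA.
  - by apply: eq_bigr => i _; rewrite /= !mxE mulrA.
  - by rewrite mulrA.
rewrite mulKf//.
have nX : `|u *: (t *: X)| <= `|t| * `|X|.
  by rewrite !normrZ gtr0_norm// ler_piMl ?mulr_ge0// ltW.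
apply: le_trans (Hc _ _ _ _) _.
  by apply: le_trans hM; rewrite lerD2l; apply: le_trans nX _; rewrite ler_piMl.
rewrite -[(_ * c) * _]mulrA [leRHS]mulrA; apply: ler_wpM2r => //.
by rewrite mulr_ge0// expR_ge0.
Qed.

End tame_bounds.

(** * From tame families to smooth vectors and smooth functions *)

Section tame_smooth.
Context {R : realType} {m r s : nat} (hbar : R).
Local Notation rV := 'rV[R]_m.
Local Notation bh := (@bheis R m).
Local Notation tame := (@tame R m hbar).
Local Notation mu := (lebesgue_rV m).
Local Notation Re := complex.Re.
Local Notation Im := complex.Im.
Implicit Types (h X : bh) (x : rV) (K : bool * {set 'I_(r + s)} -> bh -> rV -> R).

Lemma fin_const (J : finType) (P : J -> R -> Prop) :
  (forall j, exists2 c, 0 <= c & P j c) ->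
  (forall j c c', c <= c' -> P j c -> P j c') ->
  exists2 c, 0 <= c & forall j, P j c.
Proof.
move=> H mono.
have /boolp.choice[c cP] (j : J) : exists c, 0 <= c /\ P j c.
  by have [c c0 Pc] := H j; exists c.
exists (\sum_j c j); first by apply: sumr_ge0 => j _; exact: (cP j).1.
move=> j; apply: mono (cP j).2; rewrite (bigD1 j)//= lerDl sumr_ge0// => i _.
exact: (cP i).1.
Qed.

Lemma half_gauss_ge0 x : 0 <= half_gauss x. Proof. exact: expR_ge0. Qed.

(** Such a bound makes the squared Hilbert norm at most a constant times b^2, so that convergence in
    the Hilbert space reduces to pointwise estimates. *)
Definition small (phi : sfun R m r s) (b : R) := forall I x,
  `|Re (phi I x)| <= b * half_gauss x /\ `|Im (phi I x)| <= b * half_gauss x.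

Let N : R := #|{set 'I_(r + s)}|%:R.
Let G : \bar R := (\int[mu]_x (expR (- sqn x))%:E)%E.

Let Goo : (G < +oo)%E. Proof. exact: gauss_rV_lty. Qed.
Let G0 : (0 <= G)%E.
Proof. by apply: integral_ge0 => x _; rewrite lee_fin expR_ge0. Qed.
Let mg : measurable_fun [set: rV] (fun x => (expR (- sqn x))%:E).
Proof.
apply/measurable_EFinP; apply: measurableT_comp => //.
under eq_fun do rewrite -mulN1r; apply: measurable_funM => //.
exact: measurable_sqn.
Qed.

Lemma small_pdot phi b x : small phi b -> pdot phi phi x <= N * (2 * b ^+ 2) * expR (- sqn x).
Proof.
move=> sm; rewrite pdotE.
have e : expR (- sqn x) = half_gauss x ^+ 2.
  by rewrite /half_gauss -expRM_natl; congr expR; field.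
have sq a : `|a| <= b * half_gauss x -> a ^+ 2 <= b ^+ 2 * expR (- sqn x).
  move=> h; rewrite e -exprMn -real_normK ?num_real// ler_sqr ?nnegrE//.
  exact: le_trans h.
rewrite -mulrA /N mulr_natl -sumr_const; apply: ler_sum => I _.
have [/sq a /sq d] := sm I x; lra.
Qed.

Lemma small_L2sq phi b : msfun phi -> small phi b ->
  (L2sq phi <= (N * (2 * b ^+ 2))%:E * G)%E.
Proof.
move=> mphi sm; rewrite L2sqE// -ge0_integralZl//; last by rewrite lee_fin mulr_ge0// mulr_ge0// sqr_ge0.
apply: ge0_le_integral => //; try by move=> x _; rewrite lee_fin pdot_ge0.
- exact: emeasurable_pdot.
- by apply: emeasurable_funM.
- by move=> x _; rewrite -EFinM lee_fin small_pdot.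
Qed.

Lemma small_HS phi b : msfun phi -> small phi b -> HS phi.
Proof.
move=> mphi sm; apply/HSP; split => //; rewrite -L2sqE//.
apply: le_lt_trans (small_L2sq mphi sm) _.
by rewrite lte_mul_pinfty// lee_fin mulr_ge0// mulr_ge0// sqr_ge0.
Qed.

Lemma small_L2cvg {T : Type} (F : set_system T) {FF : Filter F}
    (u : T -> sfun R m r s) phi (b : T -> R) :
  (forall t, msfun (u t)) -> msfun phi ->
  (\forall t \near F, small (u t - phi) (b t)) -> b t @[t --> F] --> (0 : R) ->
  L2cvg F u phi.
Proof.
move=> mu' mphi sm b0; rewrite /L2cvg.
have mB t := msfunB (mu' t) mphi.
apply: (@squeeze_cvge _ _ _ _ (cst 0%E) _ (fun t => ((N * (2 * b t ^+ 2))%:E * G)%E)).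
- near=> t; apply/andP; split; last by apply: small_L2sq => //; near: t.
  by rewrite L2sqE//; apply: integral_ge0 => x _; rewrite lee_fin pdot_ge0.
- exact: cvg_cst.
- have -> : (fun t => ((N * (2 * b t ^+ 2))%:E * G)%E) =
      (fun t => (N * (2 * b t ^+ 2) * fine G)%:E).
    by apply/funext => t; rewrite [RHS]EFinM fineK// ge0_fin_numE.
  apply: cvg_EFin; first exact: nearW.
  have : N * (2 * (b t * b t)) * fine G @[t --> F] --> N * (2 * (0 * 0)) * fine G.
    by apply: cvgMl; apply: cvgMr; apply: cvgMr; exact: cvgM.
  by rewrite !(mulr0, mul0r).
Unshelve. all: by end_near.
Qed.

Definition cplx K h : sfun R m r s := fun I x => (K (true, I) h x +i* K (false, I) h x)%C.

Lemma msfun_cplx K h : (forall j, tame (K j)) -> msfun (cplx K h).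
Proof. by move=> tK; split=> I; exact: tame_measurable (tK _). Qed.

Lemma HS_cplx K h : (forall j, tame (K j)) -> HS (cplx K h).
Proof.
move=> tK; have [c c0 Hc] := common_bound tK (normr_ge0 h).
apply: (@small_HS _ c); first exact: msfun_cplx.
by move=> I x; split; exact: Hc.
Qed.

Lemma cplx_continuous K g : (forall j, tame (K j)) -> L2cvg (nbhs g) (cplx K) (cplx K g).
Proof.
move=> tK.
have [||c c0 Hc] := @fin_const _ (fun j c => forall X x, `|g| + `|X| <= `|g| + 1 ->
  `|K j (X + g) x - K j g x| <= `|X| * (c * half_gauss x)).
- move=> j; have [|c c0 Hc] := @tame_lip _ _ hbar (K j) (`|g| + 1) (tK j).
    by rewrite addr_ge0.
  by exists c => // X x; exact: Hc.
- move=> j c c' cc' Hc X x hX; apply: le_trans (Hc X x hX) _.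
  by rewrite ler_wpM2l// ler_wpM2r// half_gauss_ge0.
apply: (@small_L2cvg _ _ _ _ _ (fun h => `|h - g| * c)).
- by move=> h; exact: msfun_cplx.
- exact: msfun_cplx.
- near=> h => I x.
  have hg : `|g| + `|h - g| <= `|g| + 1.
    rewrite lerD2l distrC; apply: ltW; near: h.
    by have := @nbhsx_ballx _ _ g 1 ltr01; rewrite -ball_normE.
  by split; rewrite -mulrA; [have := Hc (true, I) _ x hg|have := Hc (false, I) _ x hg];
    rewrite subrK.
- rewrite -(mul0r c); apply: cvgM; last exact: cvg_cst.
  rewrite -(normr0 bh) -(subrr g); apply: cvg_norm; apply: cvgB => //; exact: cvg_cst.
Unshelve. all: by end_near.
Qed.

(** The derivative of a tame family is again tame, so the induction on the order closes. *)
Lemma cplx_L2Ck k K : (forall j, tame (K j)) -> L2Ck k (cplx K).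
Proof.
elim: k K => [|k IHk] K tK; split=> //; try by move=> g; exact: HS_cplx.
- by move=> g; exact: cplx_continuous.
- by move=> g; exact: cplx_continuous.
move=> X.
have /boolp.choice[K' K'P] (j : bool * {set 'I_(r + s)}) : exists K' : bh -> rV -> R, tame K' /\
  forall M, 0 <= M -> exists2 c, 0 <= c & forall t h x, t != 0 -> `|t| <= 1 ->
    `|h| + `|X| <= M ->
    `|t^-1 * (K j (t *: X + h) x - K j h x) - K' h x| <= `|t| * (c * half_gauss x).
  by have [K' tK' [_ H]] := tame_quotient X (tK j); exists K'.
have tK' j := (K'P j).1.
exists (cplx K'); split; last exact: IHk.
move=> g.
have [||c c0 Hc] := @fin_const _ (fun j c => forall t x, t != 0 -> `|t| <= 1 ->
    `|t^-1 * (K j (t *: X + g) x - K j g x) - K' j g x| <= `|t| * (c * half_gauss x)).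
- move=> j; have [|c c0 Hc] := (K'P j).2 (`|g| + `|X|); first by rewrite addr_ge0.
  by exists c => // t x t0 t1; exact: Hc.
- move=> j c c' cc' Hc t x t0 t1; apply: le_trans (Hc t x t0 t1) _.
  by rewrite ler_wpM2l// ler_wpM2r// half_gauss_ge0.
apply: (@small_L2cvg _ _ _ _ _ (fun t => `|t| * c)).
- by move=> t; apply: msfunZ; apply: msfunB; exact: msfun_cplx.
- exact: msfun_cplx.
- near=> t => I x.
  have t0 : t != 0 by near: t; exact: nbhs_dnbhs_neq.
  have t1 : `|t| <= 1.
    by near: t; apply: dnbhs0_le.
  split; rewrite -mulrA.
    have := Hc (true, I) t x t0 t1; congr (`|_| <= _).
    by rewrite sfB sfZ sfB /cplx !ReImE/=; ring.
  have := Hc (false, I) t x t0 t1; congr (`|_| <= _).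
  by rewrite sfB sfZ sfB /cplx !ReImE/=; ring.
- rewrite -[X in _ --> X](mul0r c); apply: cvgM; last exact: cvg_cst.
  have h : `|t| @[t --> (0 : R)^'] --> `|0 : R| by apply: cvg_norm; exact: nbhs_dnbhs.
  by rewrite normr0 in h.
Unshelve. all: by end_near.
Qed.

Lemma smooth_vector_tens w : smooth_vector hbar (tens (@gam R m) w : sfun R m r s).
Proof.
move=> k; pose K (j : bool * {set 'I_(r + s)}) h x :=
  if j.1 then Re (w j.2) * (cos (phase hbar h x) * gam (x - h.1.1)) +
    (- Im (w j.2)) * (sin (phase hbar h x) * gam (x - h.1.1))
  else Re (w j.2) * (sin (phase hbar h x) * gam (x - h.1.1)) +
    Im (w j.2) * (cos (phase hbar h x) * gam (x - h.1.1)).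
rewrite (_ : (fun g => _) = cplx K); last first.
  apply/funext => h; apply/funext => I; apply/funext => x.
  rewrite /U0 /tens /cplx /K /= /phase /cis; case: (w I) => a b.
  by apply/eqP; rewrite eq_complex !ReImE/=; apply/andP; split; apply/eqP; ring.
apply: cplx_L2Ck => -[[|] I]; rewrite /K /=.
  apply: tame_lin; [exact: tame_cos|apply: tameZ; exact: tame_sin].
by apply: tame_lin; [exact: tame_sin|apply: tameZ; exact: tame_cos].
Qed.

Lemma derive_line (f : rV -> R) y v (d : R) :
  is_derive (0 : R) (1 : R) (fun t => f (t *: v + y)) d -> derivable f y v /\ 'D_v f y = d.
Proof.
have E : (fun t : R => t^-1 *: (((fun t => f (t *: v + y)) \o shift 0) (t *: 1) -
    f (0 *: v + y))) = (fun t => t^-1 *: ((f \o shift y) (t *: v) - f y)).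
  by apply/funext => t; rewrite /= addr0 scale0r add0r [t *: 1]mulr1.
by case; rewrite /derivable /derive E.
Qed.

(** At this translation and at x = 0, a tame function becomes a function of y alone, and the
    Gaussian reappears as [gam y]. Regularity in the group element thus yields the classical
    smoothness of the Gaussian without a second computation. *)
Let pt (y : rV) : bh := (- y, 0, 0).

Let pt_norm y : `|pt y| = `|y|.
Proof.
rewrite prod_normE /= prod_normE /= !normr0 normrN.
by rewrite !max_l.
Qed.

Let ptD y y' : pt y + pt y' = pt (y + y').
Proof. by rewrite /pt opprD; congr (_, _, _); rewrite addr0. Qed.

Let ptZ t y : t *: pt y = pt (t *: y).
Proof. by rewrite /pt -scalerN; congr (_, _, _); rewrite scaler0. Qed.

Lemma tame_continuous (K0 : bh -> rV -> R) : tame K0 -> continuous (fun y : rV => K0 (pt y) 0).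
Proof.
move=> tK y0; have [|c c0 Hc] := @tame_lip _ _ hbar K0 (`|y0| + 1) tK.
  by rewrite addr_ge0.
pose b := c * half_gauss (0 : rV) + 1.
have b0 : 0 < b by rewrite ltr_wpDl// mulr_ge0// half_gauss_ge0.
have F0 : Filter (nbhs y0) by exact: nbhs_filter.
apply/(@cvgrPdist_lt _ _ _ (nbhs y0) F0) => e e0.
have nb (d : R) : 0 < d -> nbhs y0 [set y | `|y0 - y| < d].
  by move=> d0; have := @nbhsx_ballx _ _ y0 d d0; rewrite -ball_normE.
apply: filterS2 (nb _ ltr01) (nb _ (divr_gt0 e0 b0)) => y /=.
rewrite distrC => y1 ye.
have := Hc (pt (y - y0)) (pt y0) 0; rewrite !pt_norm ptD subrK => H.
rewrite distrC.
apply: le_lt_trans (H _) _; first by rewrite lerD2l ltW.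
apply: (@le_lt_trans _ _ (`|y - y0| * b)).
  by rewrite ler_wpM2l// /b lerDl.
by rewrite -ltr_pdivlMr.
Qed.

Lemma tame_Ck k (K0 : bh -> rV -> R) : tame K0 -> Ck k (fun y : rV => K0 (pt y) 0).
Proof.
elim: k K0 => [|k IHk] K0 tK; split=> //; try exact: tame_continuous.
move=> v; have [K' tK' [H _]] := tame_quotient (pt v) tK.
have D y : derivable (fun y => K0 (pt y) 0) y v /\
    'D_v (fun y => K0 (pt y) 0) y = K' (pt y) 0.
  apply: derive_line; have := H (pt y) 0.
  by under eq_fun do rewrite ptZ ptD.
split; first by move=> y; exact: (D y).1.
by rewrite (_ : 'D_v _ = (fun y => K' (pt y) 0)); [exact: IHk|apply/funext => y; exact: (D y).2].
Qed.

Lemma gam_Ck k : Ck k (@gam R m).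
Proof.
rewrite (_ : @gam R m = (fun y => cos (phase hbar (pt y) 0) * gam (0 - (pt y).1.1))).
  exact: (tame_Ck _ (tame_cos hbar)).
apply/funext => y; rewrite /phase /pt /= opprK add0r add0r.
rewrite /dot big1 ?mulr0 ?cos0 ?mul1r// => i _.
by rewrite [X in _ * X]mxE mulr0.
Qed.

End tame_smooth.

(** * The complexified superalgebra *)

Section mderive_scale.
Context {R : realType} {m : nat}.
Implicit Types f : 'rV[R]_m -> R.

Lemma mderive_scale al (c : R) f : (forall k, Ck k f) ->
  mderive al (fun y => c * f y) = (fun y => c * mderive al f y).
Proof.
move=> sf; rewrite /mderive.
have step (v : 'rV[R]_m) g : (forall k, Ck k g) ->
    'D_v (fun y => c * g y) = (fun y => c * 'D_v g y) /\ (forall k, Ck k ('D_v g)).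
  move=> sg; have dg x : derivable g x v by have [_ /(_ v)[d _]] := sg 1%N; exact: d.
  split; last by move=> k; have [_ /(_ v)[_]] := sg k.+1.
  by apply/funext => x; rewrite -[LHS]/('D_v (c \*: g) x) deriveZ.
suff : foldr (fun i g => iter (al i) (fun h => 'D_(delta_mx ord0 i) h) g)
    (fun y => c * f y) (enum 'I_m) =
    (fun y => c * foldr (fun i g => iter (al i) (fun h => 'D_(delta_mx ord0 i) h) g)
       f (enum 'I_m) y) /\
  forall k, Ck k (foldr (fun i g => iter (al i) (fun h => 'D_(delta_mx ord0 i) h) g)
       f (enum 'I_m)) by case.
elim: (enum 'I_m) => //= i l [-> IH2].
elim: (al i) => //= n [-> IHn]; exact: step.
Qed.

End mderive_scale.

Section superalgebra.
Context {R : realType} (A : superalgebra R).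
Implicit Types (x y z : cpx A) (a : A) (b : bool) (w : R[i]).
Local Notation Re := complex.Re.
Local Notation Im := complex.Im.
Local Notation const := (cpx_const A).

Lemma cpxD x y : x + y = (x.1 + y.1, x.2 + y.2). Proof. by []. Qed.
Lemma cpxN x : - x = (- x.1, - x.2). Proof. by []. Qed.
Lemma cpxM x y : x * y = (x.1 * y.1 - x.2 * y.2, x.1 * y.2 + x.2 * y.1).
Proof. by []. Qed.

Lemma constM v w : const (v * w) = const v * const w.
Proof.
rewrite cpxM /cpx_const /= cReM cImM; congr (_, _).
  by rewrite scalerBl -!scalerAl !mul1r !scalerA.
by rewrite scalerDl -!scalerAl !mul1r !scalerA.
Qed.

Lemma constD v w : const (v + w) = const v + const w.
Proof. by rewrite cpxD /cpx_const cReD cImD !scalerDl. Qed.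

Lemma constN v : const (- v) = - const v.
Proof. by rewrite cpxN /cpx_const cReN cImN !scaleNr. Qed.

Lemma const0 : const 0 = 0.
Proof. by rewrite /cpx_const /= !scale0r. Qed.

Lemma const1 : const 1 = 1.
Proof. by rewrite /cpx_const /= scale1r scale0r. Qed.

Lemma constC w x : const w * x = x * const w.
Proof.
by rewrite !cpxM /cpx_const /= !mulr_algl !mulr_algr; congr (_, _); rewrite addrC.
Qed.

Lemma constAC w x y : x * (const w * y) = const w * (x * y).
Proof. by rewrite mulrA -constC mulrA. Qed.

Lemma const_inj0 w x : w != 0 -> const w * x = 0 -> x = 0.
Proof.
move=> w0 e; have := congr1 (fun z => const w^-1 * z) e.
by rewrite /= mulr0 mulrA -constM mulVf// const1 mul1r.
Qed.

(** Holds without any finiteness: a sum with infinite support is 0 by convention, and a nonzero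
    constant, being invertible, leaves the support unchanged. *)
Lemma fsum_const (J : choiceType) w (f : J -> cpx A) :
  \sum_(j \in [set: J]) const w * f j = const w * \sum_(j \in [set: J]) f j.
Proof.
have [->|w0] := eqVneq w 0.
  by rewrite const0 mul0r fsbig1// => j _; rewrite mul0r.
have E : finite_support 0 setT (fun j => const w * f j) = finite_support 0 setT f.
  rewrite /finite_support !unlock; congr (finmap.enum_fset (fset_set _)).
  apply/seteqP; split => j [_ /= h]; split => //= h'; apply: h.
    by rewrite h' mulr0.
  exact: const_inj0 h'.
by rewrite E big_distrr.
Qed.

Definition cdeg b x := sa_deg b x.1 /\ sa_deg b x.2.

Lemma cdeg_real b a : sa_deg b a -> cdeg b (cpx_real a).
Proof. by split => //; exact: sa_deg0. Qed.

Lemma cdegM b b' x y : cdeg b x -> cdeg b' y -> cdeg (b (+) b') (x * y).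
Proof.
move=> [x1 x2] [y1 y2]; rewrite cpxM; split; [apply: sa_degB|apply: sa_degD];
exact: sa_degM.
Qed.

Lemma cdeg_const w : cdeg false (const w).
Proof. by split; apply: sa_degZ; exact: sa_deg1. Qed.

Lemma cdeg_constM b w x : cdeg b x -> cdeg b (const w * x).
Proof. by move=> h; rewrite -[b]addFb; apply: cdegM => //; exact: cdeg_const. Qed.

Lemma cdegD b x y : cdeg b x -> cdeg b y -> cdeg b (x + y).
Proof. by move=> [? ?] [? ?]; split; exact: sa_degD. Qed.

Lemma cdeg0 b : cdeg b 0. Proof. by split; exact: sa_deg0. Qed.

Lemma cdeg_comm b b' x y : cdeg b x -> cdeg b' y ->
  x * y = (-1) ^+ (b && b') * (y * x).
Proof.
move=> [x1 x2] [y1 y2]; rewrite [x * y]cpxM [y * x]cpxM.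
rewrite (sa_supercomm x1 y1) (sa_supercomm x2 y2) (sa_supercomm x1 y2) (sa_supercomm x2 y1).
case: (b && b'); rewrite ?expr1 ?expr0 ?mul1r ?mulN1r.
  by rewrite cpxN /=; congr (_, _); rewrite [RHS]opprD // addrC.
by congr (_, _); rewrite addrC.
Qed.

Lemma cdeg_even x b y : cdeg false x -> cdeg b y -> x * y = y * x.
Proof. by move=> hx hy; rewrite (cdeg_comm hx hy) expr0 mul1r. Qed.

Lemma cdeg_odd x y : cdeg true x -> cdeg true y -> x * y = - (y * x).
Proof. by move=> hx hy; rewrite (cdeg_comm hx hy) expr1 mulN1r. Qed.

Lemma cdeg_sq x : cdeg true x -> x * x = 0.
Proof.
move=> hx; have /eqP := cdeg_odd hx hx.
rewrite -addr_eq0 -mulr2n -[_ *+ 2]mulr_natl => /eqP h.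
apply: (@const_inj0 2%:R); first by rewrite pnatr_eq0.
by rewrite (_ : const 2%:R = 2%:R)// !mulr2n constD const1.
Qed.

Lemma cpx_bodyM x y : cpx_body (x * y) = cpx_body x * cpx_body y.
Proof.
by rewrite /cpx_body cpxM /= rmorphB rmorphD !rmorphM.
Qed.

Lemma cpx_exp_nil x : cpx_body x = 0 -> x * x = 0 -> cpx_exp x = 1 + x.
Proof.
move=> x0 xx; rewrite /cpx_exp x0 /= const0 expR0 /cis cos0 sin0 mul1r.
rewrite (_ : const (1 +i* 0)%C = 1) ?mul1r; last exact: const1.
(* From index 2 on, every term contains x * x = 0. *)
rewrite -(@fsbig_widen _ _ 0 +%R `I_2 setT)//; last first.
  move=> [|[|k]] [_ /= h]; try by exfalso; apply: h.
  by rewrite subr0 exprS exprS [x * (x * _)]mulrA xx mul0r mulr0.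
rewrite -fsbig_ord !big_ord_recl big_ord0 /= addr0 subr0 /bump/= expr0 expr1.
by rewrite fact0 factS fact0 invr1 const1 !mul1r.
Qed.

Lemma taylor_scale {m : nat} w (g : 'rV[R]_m -> R) (q : 'I_m -> A) :
  (forall k, Ck k g) ->
  taylor (fun u : 'rV[R]_m => w * (g u)%:C%C) q =
  const w * taylor (fun u : 'rV[R]_m => (g u)%:C%C) q.
Proof.
move=> sg; rewrite /taylor -fsum_const; apply: eq_fsbigr => al _.
rewrite mulrA -constM [w * _]mulrA; congr (const (_ * _) * _).
(* The zero imaginary part is written as a multiple of g, so that [mderive_scale] covers it too. *)
have c0 : (fun u : 'rV[R]_m => Im (g u)%:C%C) = (fun u => 0 * g u).
  by apply/funext => u; rewrite mul0r.
rewrite /mderiveC c0.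
have -> : (fun u => Re (w * (g u)%:C%C)) = (fun u => Re w * g u).
  by apply/funext => u; rewrite !ReImE/= mulr0 subr0.
have -> : (fun u => Im (w * (g u)%:C%C)) = (fun u => Im w * g u).
  by apply/funext => u; rewrite !ReImE/= mulr0 add0r.
rewrite !mderive_scale//; apply/eqP; rewrite eq_complex !ReImE/= mul0r.
by rewrite !mulr0 subr0 add0r !eqxx.
Qed.

Lemma taylor_even {m : nat} (f : 'rV[R]_m -> R[i]) (q : 'I_m -> A) :
  (forall i, sa_deg false (q i)) -> cdeg false (taylor f q).
Proof.
move=> hq; rewrite /taylor; elim/big_ind : _ => [|x y|al _].
- exact: cdeg0.
- exact: cdegD.
apply: cdeg_constM; apply: cdeg_real.
have M (x y : A) : sa_deg false x -> sa_deg false y -> sa_deg false (x * y : A).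
  by move=> hx hy; rewrite -(addFb false); exact: sa_degM.
elim/big_ind : _ => // [|i _]; first exact: sa_deg1.
elim: (al i) => [|n IHn]; first exact: sa_deg1.
rewrite exprS; apply: M => //; apply: sa_degB => //.
by apply: sa_degZ; exact: sa_deg1.
Qed.

End superalgebra.

(** * Monomials in odd variables *)

Section monomials.
Context {R : realType} (A : superalgebra R) {n : nat}.
Implicit Types (x y z : cpx A) (w : {set 'I_n} -> R[i]) (th : 'I_n -> cpx A).
Implicit Types (I J : {set 'I_n}) (c : 'I_n).
Local Notation const := (cpx_const A).

Definition mono th I : cpx A := \prod_(i in I) th i.

(** Odd variables do not commute, so the order of the factors matters; indexing them by natural
    numbers, with 1 for absent variables, allows the product to be cut at a given position. *)
Definition factor th I (k : nat) : cpx A :=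
  if insub k is Some i then if i \in I then th i else 1 else 1.

Definition indic_nat I (k : nat) : nat :=
  if insub k is Some i then i \in I else 0%N.

(* the number of elements of I below c: exponent of the sign when the c-th odd
   variable moves to its place in the monomial *)
Definition nbelow c I : nat := (\sum_(0 <= k < c) indic_nat I k)%N.

Lemma mono_nat th I : mono th I = \prod_(0 <= k < n) factor th I k.
Proof.
rewrite /mono big_mkcond big_mkord; apply: eq_bigr => i _.
by rewrite /factor valK.
Qed.

Lemma mono_split th I c : mono th I =
  (\prod_(0 <= k < c) factor th I k) * ((if c \in I then th c else 1) *
   \prod_(c.+1 <= k < n) factor th I k).
Proof.
rewrite mono_nat (@big_cat_nat _ _ _ c)//=; last exact: ltnW.
by rewrite [X in _ * X]big_ltn// {2}/factor valK.
Qed.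

Lemma factor_congr th th' I I' c (k : nat) :
  (forall i, i != c -> th i = th' i /\ (i \in I) = (i \in I')) ->
  k != c :> nat -> factor th I k = factor th' I' k.
Proof.
move=> H kc; rewrite /factor; case: insubP => // i _ ik.
have ic : i != c by apply: contraNneq kc => <-; rewrite -ik.
by have [-> ->] := H _ ic.
Qed.

Lemma nbelow_congr I I' c : (forall i, i != c -> (i \in I) = (i \in I')) ->
  nbelow c I = nbelow c I'.
Proof.
move=> H; rewrite /nbelow !big_mkord; apply: eq_bigr => k _.
rewrite /indic_nat; case: insubP => // i _ ik; rewrite H//.
by apply: contraTneq (ltn_ord k) => ic; rewrite -ik ic ltnn.
Qed.

Lemma mono_split_congr th th' I I' c :
  (forall i, i != c -> th i = th' i /\ (i \in I) = (i \in I')) ->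
  mono th' I' = (\prod_(0 <= k < c) factor th I k) *
    ((if c \in I' then th' c else 1) * \prod_(c.+1 <= k < n) factor th I k).
Proof.
move=> H; rewrite (mono_split th' I' c); congr (_ * (_ * _)).
  rewrite !big_mkord; apply: eq_bigr => k _; apply/esym/(factor_congr H).
  by rewrite neq_ltn ltn_ord.
apply: eq_big_nat => k /andP[ck _]; apply/esym/(factor_congr H).
by rewrite neq_ltn ck orbT.
Qed.

Lemma odd_pass th I b (j : nat) : (forall i, cdeg true (th i)) -> cdeg true b ->
  b * (\prod_(0 <= k < j) factor th I k) =
  (-1) ^+ (\sum_(0 <= k < j) indic_nat I k)%N * ((\prod_(0 <= k < j) factor th I k) * b).
Proof.
move=> hth hb; elim: j => [|j IHj].
  by rewrite !big_geq// expr0 mulr1 !mul1r.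
rewrite !big_nat_recr//= mulrA IHj exprD -!mulrA; congr (_ * _).
have comm s' : GRing.comm ((-1 : cpx A) ^+ s') (\prod_(0 <= k < j) factor th I k).
  exact/commr_sym/commrX/commrN1.
rewrite [RHS]mulrA comm -mulrA; congr (_ * _).
rewrite /factor /indic_nat; case: insubP => [i _ _|_]; last by rewrite expr0 !mul1r mulr1.
case: ifP => _; last by rewrite expr0 !mul1r mulr1.
by rewrite expr1 mulN1r cdeg_odd.
Qed.

Context (th : 'I_n -> cpx A) (hth : forall i, cdeg true (th i)).

Lemma mul_mono c I : th c * mono th I =
  if c \in I then 0 else (-1) ^+ nbelow c I * mono th (c |: I).
Proof.
rewrite (mono_split th I c) mulrA odd_pass// -!mulrA mulrA.
case: ifP => cI.
  by rewrite [th c * (th c * _)]mulrA cdeg_sq// mul0r mulr0.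
rewrite mul1r -mulrA (@mono_split_congr th th I (c |: I) c); last first.
  by move=> i ic; rewrite in_setU1 (negbTE ic).
by rewrite finset.setU11.
Qed.

(** Each variable occurs at most once in a monomial, so the dependence on it is exactly affine; the
    sign comes from moving b to the front. *)
Lemma mono_shift c b I : cdeg true b ->
  mono (fun i => th i - (if i == c then b else 0)) I =
  mono th I - (if c \in I then (-1) ^+ nbelow c I * (b * mono th (I :\ c)) else 0).
Proof.
move=> hb.
rewrite (@mono_split_congr th (fun i => th i - (if i == c then b else 0)) I I c); last first.
  by move=> i ic; rewrite (negbTE ic) subr0.
rewrite (mono_split th I c) eqxx; case: ifP => cI; last by rewrite subr0.
rewrite mulrBl mulrBr; congr (_ - _).
rewrite (@mono_split_congr th th I (I :\ c) c); last first.
  by move=> i ic; rewrite in_setD1 ic.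
rewrite finset.setD11 mul1r [b * (_ * _)]mulrA odd_pass// -/(nbelow c I) -!mulrA [RHS]mulrA.
by rewrite -exprD addnn -mul2n exprM sqrrN !expr1n mul1r.
Qed.

(** Together with [derop]: left multiplication by, and left derivation along, the c-th odd variable,
    expressed on coefficients. *)
Definition mulop c w J : R[i] :=
  if c \in J then (-1) ^+ nbelow c J * w (J :\ c) else 0.

Definition derop c w J : R[i] :=
  if c \in J then 0 else (-1) ^+ nbelow c J * w (c |: J).

Definition spin w : cpx A := \sum_I const (w I) * mono th I.

Lemma const_sign k (w0 : R[i]) : const ((-1) ^+ k * w0) = (-1) ^+ k * const w0.
Proof.
by rewrite -signr_odd -[in RHS]signr_odd; case: odd; rewrite ?expr1 ?expr0 ?mulN1r ?mul1r ?constN.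
Qed.

Lemma nbelowU c I : nbelow c (c |: I) = nbelow c I.
Proof. by apply: nbelow_congr => i ic; rewrite in_setU1 (negbTE ic). Qed.

Lemma nbelowD c I : nbelow c (I :\ c) = nbelow c I.
Proof. by apply: nbelow_congr => i ic; rewrite in_setD1 ic. Qed.

Lemma mul_spin c w : th c * spin w = spin (mulop c w).
Proof.
rewrite /spin mulr_sumr (bigID (fun I => c \in I))/= big1 ?add0r; last first.
  by move=> I cI; rewrite constAC mul_mono cI mulr0.
rewrite [RHS](bigID (fun J => c \in J))/= [X in _ = _ + X]big1 ?addr0; last first.
  by move=> J /negbTE cJ; rewrite /mulop cJ const0 mul0r.
(* Adding c is a bijection from the sets without c to the sets with c. *)
rewrite [RHS](reindex_onto (fun I => c |: I) (fun J => J :\ c)); last first.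
  by move=> J cJ; rewrite finset.setD1K.
apply: eq_big => [I|I cI].
  rewrite finset.setU11 /=; apply/idP/eqP => [cI|<-]; first by rewrite finset.setU1K.
  by rewrite finset.setD11.
rewrite constAC mul_mono (negbTE cI) /mulop finset.setU11 finset.setU1K// nbelowU const_sign.
by rewrite -signr_odd; case: odd; rewrite ?expr1 ?expr0 ?mulN1r ?mul1r ?mulrN ?mulNr.
Qed.

Lemma shift_spin c b w : cdeg true b ->
  \sum_I const (w I) * mono (fun i => th i - (if i == c then b else 0)) I =
  spin w - b * spin (derop c w).
Proof.
move=> hb; rewrite /spin mulr_sumr -[RHS]addr0.
under eq_bigr do rewrite mono_shift// mulrBr.
rewrite sumrB addr0; congr (_ - _).
rewrite (bigID (fun I => c \in I))/= [X in _ + X]big1 ?addr0; last first.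
  by move=> I /negbTE cI; rewrite cI mulr0.
rewrite [RHS](bigID (fun J => c \in J))/= [X in _ = X + _]big1 ?add0r; last first.
  by move=> J cJ; rewrite /derop cJ const0 mul0r mulr0.
rewrite [LHS](reindex_onto (fun I => c |: I) (fun J => J :\ c)); last first.
  by move=> J cJ; rewrite finset.setD1K.
apply: eq_big => [I|I /andP[_ cI]].
  rewrite finset.setU11 /=; apply/eqP/idP => [<-|cI]; first by rewrite finset.setD11.
  by rewrite finset.setU1K.
have cI' : c \notin I by rewrite -(eqP cI) finset.setD11.
rewrite finset.setU11 finset.setU1K// nbelowU /derop (negbTE cI') const_sign -signr_odd.
by case: odd; rewrite ?expr1 ?expr0 ?mulN1r ?mul1r ?mulrN ?mulNr ?mulrN constAC.
Qed.

End monomials.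

(** * Odd operators on Gaussian tensors *)

Section odd_operators.
Context {R : realType} (A : superalgebra R) {m r s : nat} (hbar : R) (eps : int).
Implicit Types (w : {set 'I_(r + s)} -> R[i]) (a : A) (z : spoint A m r s).
Implicit Types (c : 'I_(r + s)) (e : @odd_dir r s).
Local Notation const := (cpx_const A).
Local Notation Re := complex.Re.
Local Notation Im := complex.Im.

Definition theta z (i : 'I_(r + s)) : cpx A :=
  match fintype.split i with
  | inl j => cpx_real (pqo z j)
  | inr c => pzeta z c
  end.

Definition gauss_val z : cpx A := taylor (fun y : 'rV[R]_m => (gam y)%:C%C) (pq z).

Lemma superfun_tens w z :
  superfun (tens (@gam R m) w) z = gauss_val z * spin (theta z) w.
Proof.
rewrite /superfun /spin mulr_sumr; apply: eq_bigr => I _.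
rewrite -[X in X * _ = _]/(taylor (fun y => w I * (gam y)%:C%C) (pq z)).
rewrite taylor_scale; last exact: gam_Ck 0.
by rewrite -/(gauss_val z) constAC mulrA.
Qed.

Lemma theta_odd z : in_spoint z -> forall i, cdeg true (theta z i).
Proof.
by move=> [_ h1 h2] i; rewrite /theta; case: fintype.split => j; [exact: cdeg_real|exact: h2].
Qed.

Lemma smooth_tens w I : smooth (tens (@gam R m) w I : 'rV[R]_m -> R[i]).
Proof.
have Z (d : R) k (f : 'rV[R]_m -> R) : Ck k f -> Ck k (fun y => d * f y).
  have cZ (h : 'rV[R]_m -> R) : continuous h -> continuous (fun y => d * h y).
    by move=> ch y; apply: continuousM; [exact: cst_continuous|exact: ch].
  elim: k f => [|k IHk] f [cf df]; first by split=> //; exact: cZ.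
  split; [exact: cZ|move=> v]; have [dv Cv] := df v; split.
    by move=> y; apply: derivableM => //; exact: derivable_cst.
  rewrite (_ : 'D_v _ = fun y => d * 'D_v f y); first exact: IHk.
  by apply/funext => y; rewrite -[LHS]/('D_v (d \*: f) y) deriveZ.
move=> k; split.
  rewrite (_ : (fun x => _) = (fun y => Re (w I) * gam y)); first exact/Z/gam_Ck.
  by apply/funext => y; rewrite /tens !ReImE/= mulr0 subr0.
rewrite (_ : (fun x => _) = (fun y => Im (w I) * gam y)); first exact/Z/gam_Ck.
by apply/funext => y; rewrite /tens !ReImE/= mulr0 add0r.
Qed.

Lemma spinB (th : 'I_(r + s) -> cpx A) (la nu : R[i]) w w' :
  spin th (fun J => la * w J - nu * w' J) = const la * spin th w - const nu * spin th w'.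
Proof.
rewrite /spin !mulr_sumr -sumrB; apply: eq_bigr => I _.
by rewrite constD constN !constM mulrBl !mulrA.
Qed.

(* With T the c-th odd variable, exp (la a T) = 1 + la a T and the shift T - nu a gives
   U(a e) = 1 + a (la T - nu d/dT), the cross term being a multiple of a T a = 0. *)
Lemma Uodd1_tens e c (la nu : R[i]) w :
  (forall a z, sa_deg true a -> in_spoint z ->
     schrodinger_phase hbar eps (odd_elt e a) z = const la * (cpx_real a * theta z c)) ->
  (forall a z i, theta (spoint_sub z (odd_elt e a)) i =
     theta z i - (if i == c then const nu * cpx_real a else 0)) ->
  Uodd1 A hbar eps e (tens (@gam R m) w)
    (tens (@gam R m) (fun J => la * mulop c w J - nu * derop c w J)).
Proof.
move=> Hphase Hsub; split; try exact: smooth_vector_tens.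
exists (tens (@gam R m) w), (tens (@gam R m) (fun J => la * mulop c w J - nu * derop c w J)).
split; try by [exact: smooth_tens|move=> I; exact: aeW].
move=> a z ha hz; rewrite /schrodinger_U (Hphase _ _ ha hz).
have hth := theta_odd hz; have ra : cdeg true (cpx_real a) by exact: cdeg_real.
set T := theta z c; set ca := cpx_real a.
have aa : ca * ca = 0 by exact: cdeg_sq.
have aTa : ca * T * ca = 0.
  by rewrite -mulrA (cdeg_odd (hth c) ra) mulrN mulrA aa mul0r oppr0.
rewrite cpx_exp_nil; last 2 first.
- rewrite !cpx_bodyM (_ : cpx_body ca = 0) ?mul0r ?mulr0//.
  by rewrite /cpx_body /ca /= sa_body_odd// rmorph0.
- rewrite constAC -mulrA [X in _ * (_ * X)](_ : _ = 0) ?mulr0//.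
  by rewrite mulrA aTa mul0r.
rewrite !superfun_tens.
have -> : gauss_val (spoint_sub z (odd_elt e a)) = gauss_val z.
  by rewrite /gauss_val; congr taylor; apply/funext => i; rewrite /= subr0.
have -> : spin (theta (spoint_sub z (odd_elt e a))) w =
    spin (theta z) w - const nu * ca * spin (theta z) (derop c w).
  rewrite -shift_spin//; last exact: cdeg_constM.
  rewrite /spin; apply: eq_bigr => I _; congr (_ * mono _ _).
  by apply/funext => i; exact: Hsub.
set g := gauss_val z; set S := spin _ w; set D := spin _ (derop c w).
have gE : cdeg false g by apply: taylor_even; case: hz.
have gc x : cdeg true x -> x * g = g * x by move=> hx; rewrite (cdeg_even gE hx).
rewrite spinB -mul_spin// -/D -/S -/T.
rewrite mulrDl mul1r !mulrBr -addrA; congr (_ + _).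
have nuca : cdeg true (const nu * ca) by exact: cdeg_constM.
have Mb : const la * (ca * T) * (const nu * ca) = 0.
  by rewrite constAC -mulrA [ca * T * ca]aTa !mulr0.
have E1 : const la * (ca * T) * (g * (const nu * ca * D)) = 0.
  by rewrite [g * _]mulrA -(gc _ nuca) -[const nu * ca * g * D]mulrA mulrA Mb mul0r.
rewrite E1 subr0 addrC; congr (_ - _).
  rewrite [g * (const la * _)]constAC [ca * (const la * _)]constAC -mulrA; congr (_ * _).
  by rewrite -mulrA; congr (_ * _); rewrite !mulrA gc//; exact: hth.
rewrite [g * (const nu * D)]constAC [ca * (const nu * _)]constAC -mulrA constAC.
by congr (_ * _); rewrite !mulrA gc.
Qed.

End odd_operators.

Section odd_directions.
Context {R : realType} (A : superalgebra R) {m r s : nat} (hbar : R) (eps : int).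
Implicit Types (w : {set 'I_(r + s)} -> R[i]) (a : A) (z : spoint A m r s).
Local Notation const := (cpx_const A).

Lemma cpx_realB (x y : A) : cpx_real (x - y) = cpx_real x - cpx_real y.
Proof. by rewrite /cpx_real cpxD cpxN /= oppr0 addr0. Qed.

Lemma cpx_conj0 : cpx_conj (0 : cpx A) = 0.
Proof. by rewrite /cpx_conj /= oppr0. Qed.

Let thetaE z i : theta z i = match fintype.split i with
    | inl j => cpx_real (pqo z j) | inr c => pzeta z c end.
Proof. by []. Qed.

Lemma Uodd1_q j w : Uodd1 A hbar eps (inl (inl j)) (tens (@gam R m) w)
  (tens (@gam R m) (fun J => 0 * mulop (lshift s j) w J - 1 * derop (lshift s j) w J)).
Proof.
apply: Uodd1_tens => [a z ha hz|a z i].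
  rewrite const0 mul0r /schrodinger_phase /= add0r.
  rewrite big1 ?add0r; last by move=> i _; rewrite mulr0.
  rewrite big1 ?add0r; last by move=> i _; rewrite mulr0.
  rewrite big1 ?mulr0 ?addr0; last by move=> i _; rewrite cpx_conj0 mulr0.
  by [].
rewrite !thetaE -(splitK i); case: (fintype.split i) => k; rewrite unsplitK /=.
  rewrite eq_lshift const1 mul1r cpx_realB; congr (_ - _).
  by case: eqP.
by rewrite eq_rlshift !subr0.
Qed.

Lemma Uodd1_p j w : Uodd1 A hbar eps (inl (inr j)) (tens (@gam R m) w)
  (tens (@gam R m) (fun J => (0 +i* hbar)%C * mulop (lshift s j) w J - 0 * derop (lshift s j) w J)).
Proof.
apply: Uodd1_tens => [a z ha hz|a z i].
  rewrite /schrodinger_phase /= add0r; congr (_ * _).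
  rewrite big1 ?add0r; last by move=> i _; rewrite mulr0.
  rewrite [X in _ + _ * X]big1 ?mulr0 ?addr0; last by move=> i _; rewrite cpx_conj0 mulr0.
  rewrite (bigD1 j)//= eqxx big1 ?addr0; last first.
    by move=> k /negbTE ->; rewrite mulr0.
  rewrite scaler0 sub0r thetaE (_ : fintype.split (lshift s j) = inl j); last exact: unsplitK (inl j).
  have [_ hpq _] := hz.
  (* The phase contains minus the variable times a, which is a times the variable. *)
  have := cdeg_odd (cdeg_real (hpq j)) (cdeg_real ha).
  move=> /(congr1 -%R); rewrite opprK => <-.
  by rewrite /cpx_real cpxM cpxN /= !(mulr0, mul0r, subr0, addr0) oppr0 mulNr.
rewrite !thetaE -(splitK i); case: (fintype.split i) => k; rewrite unsplitK /=.
  by rewrite const0 mul0r subr0; case: ifP; rewrite subr0.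
by rewrite eq_rlshift !subr0.
Qed.

(** Treats both halves of the xi directions at once: zeta_c = u a, with u = 1 for xi^c and u = i for
    xi^(c+s). *)
Lemma Uodd1_xi_gen (c' : 'I_(s + s)) (c : 'I_s) (u : R[i]) w :
  (forall a, hzeta (odd_elt (m := m) (r := r) (inr c') a) c = const u * cpx_real a) ->
  (forall a k, k != c -> hzeta (odd_elt (m := m) (r := r) (inr c') a) k = 0) ->
  Uodd1 A hbar eps (inr c') (tens (@gam R m) w) (tens (@gam R m) (fun J =>
   ((0 +i* hbar)%C * ((eps%:~R / 2) * conjc u)) * mulop (rshift r c) w J -
   u * derop (rshift r c) w J)).
Proof.
move=> Hc Hk; apply: Uodd1_tens => [a z ha hz|a z i].
  rewrite /schrodinger_phase.
  rewrite [ht _]/= add0r big1 ?add0r; last by move=> i _; rewrite mulr0.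
  rewrite big1 ?add0r; last by move=> i _; rewrite mulr0.
  rewrite !constM -!mulrA; congr (_ * (_ * (_ * _))).
  rewrite (bigD1 c)//= [X in _ + X]big1 ?addr0; last first.
    by move=> k /(Hk a) ->; rewrite cpx_conj0 mulr0.
  rewrite Hc thetaE (_ : fintype.split (rshift r c) = inr c); last exact: unsplitK (inr c).
  have -> : cpx_conj (const u * cpx_real a) = const (conjc u) * cpx_real a.
    case: u {Hc} => u1 u2.
    by rewrite /cpx_conj /cpx_real !cpxM /= !(mulr0, subr0, add0r, addr0) scaleNr mulNr.
  have ra := cdeg_real ha; have [_ _ hzc] := hz.
  rewrite constAC; congr (_ * _).
  (* The term quadratic in zeta contains a * a = 0; only the one linear in zeta_0 survives. *)
  have pc := hzc c; rewrite mulrBl (cdeg_odd pc ra) opprK.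
  by rewrite -!mulrA (cdeg_sq ra) !mulr0 add0r.
rewrite !thetaE -(splitK i); case: (fintype.split i) => k; rewrite unsplitK /=.
  by rewrite eq_lrshift subr0 subr0.
rewrite eq_rshift; case: eqP => [->|/eqP kc]; first by rewrite Hc.
by rewrite Hk.
Qed.

End odd_directions.

(** * Irreducibility *)

Section spin_module.
Context {R : realType} {n : nat}.
Implicit Types (w : {set 'I_n} -> R[i]) (I J : {set 'I_n}) (c : 'I_n).
Context (W : ({set 'I_n} -> R[i]) -> Prop).
Hypothesis WZD : forall (d : R[i]) w w', W w -> W w' -> W (fun J => d * w J + w' J).
Hypothesis Wmul : forall c w, W w -> W (mulop c w).
Hypothesis Wder : forall c w, W w -> W (derop c w).

Let sgn_sq k : (-1) ^+ k * ((-1) ^+ k) = 1 :> R[i].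
Proof. by rewrite -exprD addnn -mul2n exprM sqrrN !expr1n. Qed.

Definition basis I J : R[i] := (J == I)%:R.

Let W0 w : W w -> W (fun=> 0).
Proof.
move=> Ww; have := WZD (-1) Ww Ww; congr W; apply/funext => J.
by rewrite mulN1r addNr.
Qed.

Let WZ (d : R[i]) w : W w -> W (fun J => d * w J).
Proof.
move=> Ww; have := WZD d Ww (W0 Ww); congr W; apply/funext => J.
by rewrite addr0.
Qed.

(* [mulop c \o derop c] and [derop c \o mulop c] are the projections onto the spans of
   the monomials that contain, resp. do not contain, the variable c. *)
Let project (I : {set 'I_n}) (l : seq 'I_n) w : W w ->
  W (fun J => if all (fun c => (c \in J) == (c \in I)) l then w J else 0).
Proof.
move=> Ww; elim: l => [//|c l IHl] /=.
case: (boolP (c \in I)) => cI.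
  have := Wmul c (Wder c IHl); congr W; apply/funext => J.
  rewrite /mulop /derop; case: (boolP (c \in J)) => cJ //=.
  by rewrite finset.setD11 nbelowD mulrA sgn_sq mul1r finset.setD1K.
have := Wder c (Wmul c IHl); congr W; apply/funext => J.
rewrite /mulop /derop; case: (boolP (c \in J)) => cJ //=.
by rewrite finset.setU11 nbelowU mulrA sgn_sq mul1r finset.setU1K.
Qed.

Let basis_of w I : W w -> w I != 0 -> W (basis I).
Proof.
move=> Ww wI; have := WZ (w I)^-1 (project I (enum 'I_n) Ww).
congr W; apply/funext => J; rewrite /basis.
case: (altP allP) => h.
  have -> : J = I.
    by apply/setP => c; apply/eqP; apply: h; rewrite mem_enum.
  by rewrite eqxx mulVf.
rewrite mulr0; case: eqP => // JI; exfalso; move/negP : h; apply.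
by apply/allP => c _; rewrite JI.
Qed.

Let lower c I : c \in I -> W (basis I) -> W (basis (I :\ c)).
Proof.
move=> cI /(Wder c)/(WZ ((-1) ^+ nbelow c I)); congr W; apply/funext => J.
rewrite /derop /basis; case: (boolP (c \in J)) => cJ.
  rewrite mulr0; case: eqP => // JI; move: cJ.
  by rewrite JI finset.setD11.
case: (eqVneq J (I :\ c)) => [->|JI].
  by rewrite nbelowD finset.setD1K// eqxx mulr1 sgn_sq.
case: eqP => [E|_]; last by rewrite !mulr0.
by move/eqP : JI; case; rewrite -E finset.setU1K.
Qed.

Let raise c I : c \notin I -> W (basis I) -> W (basis (c |: I)).
Proof.
move=> cI /(Wmul c)/(WZ ((-1) ^+ nbelow c I)); congr W; apply/funext => J.
rewrite /mulop /basis; case: (boolP (c \in J)) => cJ; last first.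
  rewrite mulr0; case: eqP => // JI; move: cJ.
  by rewrite JI finset.setU11.
case: (eqVneq J (c |: I)) => [->|JI].
  by rewrite nbelowU finset.setU1K// eqxx mulr1 sgn_sq.
case: eqP => [E|_]; last by rewrite !mulr0.
by move/eqP : JI; case; rewrite -E finset.setD1K.
Qed.

(** Projecting on all variables isolates one monomial of w; derivations lower it to the constant 1,
    from which multiplications raise every other monomial. *)
Lemma spin_irreducible w I : W w -> w I != 0 -> forall J, W (basis J).
Proof.
move=> Ww wI J; have := basis_of Ww wI.
have down k : forall I, #|I| = k -> W (basis I) -> W (basis finset.set0).
  elim: k => [I'|k IHk I' cI']; first by move/eqP; rewrite cards_eq0 => /eqP ->.
  have /card_gt0P[c cI] : (0 < #|I'|)%N by rewrite cI'.
  move=> /(lower cI); apply: IHk.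
  by move: cI'; rewrite (cardsD1 c) cI add1n => -[].
move=> /(down _ _ erefl).
have up k : forall J, #|J| = k -> W (basis finset.set0) -> W (basis J).
  elim: k => [J'|k IHk J' cJ']; first by move/eqP; rewrite cards_eq0 => /eqP ->.
  have /card_gt0P[c cJ] : (0 < #|J'|)%N by rewrite cJ'.
  move=> Wb; rewrite -(finset.setD1K cJ); apply: raise; first by rewrite finset.setD11.
  by apply: IHk => //; move: cJ'; rewrite (cardsD1 c) cJ add1n => -[].
exact: up.
Qed.

End spin_module.

Section irreducibility.
Context {R : realType} (A : superalgebra R) {m r s : nat} (hbar : R) (eps : int).
Hypotheses (hb : hbar <> 0) (he : eps = 1 \/ eps = -1).
Local Notation mu := (lebesgue_rV m).
Local Notation Re := complex.Re.
Local Notation Im := complex.Im.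
Context (F : set (sfun R m r s)) (cF : closed_subspace F).
Hypothesis FU : forall g phi, F phi -> F (U0 hbar g phi).
Hypothesis Fodd : forall X phi psi, (F `&` smooth_vector hbar) phi ->
  Uodd A hbar eps X phi psi -> (F `&` smooth_vector hbar) psi.

Let W w := F (tens (@gam R m) w).

Let WZD (d : R[i]) w w' : W w -> W w' -> W (fun J => d * w J + w' J).
Proof.
move=> Ww Ww'; have := subspaceZD cF d Ww Ww'; congr F.
apply/funext => I; apply/funext => x.
by rewrite sfD sfZ /tens mulrDl mulrA.
Qed.

Let alpha : R[i] := (0 +i* hbar)%C * (eps%:~R / 2).

Let alpha0 : alpha != 0.
Proof.
rewrite /alpha !mulf_neq0//.
- by apply/eqP => -[] /hb.
- by case: he => ->; rewrite ?mulrN1z ?oppr_eq0 oner_eq0.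
Qed.

(** [Uodd] asks for the images under all odd directions at once, even for a combination with a
    single nonzero coefficient, so one total family is fixed. *)
Let odd_image w (d : @odd_dir r s) : sfun R m r s := match d with
  | inl (inl j) => tens (@gam R m) (fun J =>
      0 * mulop (lshift s j) w J - 1 * derop (lshift s j) w J)
  | inl (inr j) => tens (@gam R m) (fun J =>
      (0 +i* hbar)%C * mulop (lshift s j) w J - 0 * derop (lshift s j) w J)
  | inr c' => match fintype.split c' with
    | inl c => tens (@gam R m) (fun J =>
        (0 +i* hbar)%C * ((eps%:~R / 2) * conjc 1) * mulop (rshift r c) w J -
        1 * derop (rshift r c) w J)
    | inr c => tens (@gam R m) (fun J =>
        (0 +i* hbar)%C * ((eps%:~R / 2) * conjc 'i%C) * mulop (rshift r c) w J -
        'i%C * derop (rshift r c) w J)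
    end
  end.

Let odd_imageP w d : Uodd1 A hbar eps d (tens (@gam R m) w) (odd_image w d).
Proof.
case: d => [[j|j]|c'] /=; [exact: Uodd1_q|exact: Uodd1_p|].
rewrite -{1}(splitK c'); case: (fintype.split c') => c /=.
  apply: Uodd1_xi_gen => [a|a k kc]; rewrite /hzeta /=.
    by rewrite eqxx eq_rlshift const1 mul1r.
  by rewrite eq_lshift (negbTE kc) eq_rlshift.
apply: Uodd1_xi_gen => [a|a k kc]; rewrite /hzeta /=.
  rewrite eqxx eq_lrshift cpxM /cpx_const /cpx_real /=.
  by rewrite scale0r scale1r !(mul0r, mul1r, mulr0, subrr, add0r, subr0, oppr0).
by rewrite eq_rshift (negbTE kc) eq_lrshift.
Qed.

Let W_op w d : W w -> F (odd_image w d).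
Proof.
move=> Ww; have Fw : (F `&` smooth_vector hbar) (tens (@gam R m) w).
  by split => //; exact: smooth_vector_tens.
have [] := Fodd (X := fun e => if e == d then 1 else 0) (psi := odd_image w d) Fw.
  exists (odd_image w); split; first exact: odd_imageP.
  rewrite (bigD1 d)//= eqxx scale1r big1 ?addr0// => e /negbTE ->.
  by rewrite scale0r.
by [].
Qed.

Let Wmulder c w : W w -> W (mulop c w) /\ W (derop c w).
Proof.
move=> Ww.
have WZ (d : R[i]) w' : W w' -> W (fun J => d * w' J).
  move=> h; have := WZD d h (WZD (-1) h h); congr W; apply/funext => J.
  by rewrite mulN1r addNr addr0.
rewrite -(splitK c); case: (fintype.split c) => j /=.
  split.
    have := WZ (0 +i* hbar)%C^-1 _ (W_op (inl (inr j)) Ww); congr W.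
    apply/funext => J; rewrite mul0r subr0 mulrA mulVf ?mul1r//.
    by apply/eqP => -[] /hb.
  have := WZ (-1) _ (W_op (inl (inl j)) Ww); congr W.
  by apply/funext => J; rewrite mul0r sub0r mul1r mulrN mulN1r opprK.
have c1 : conjc 1 = 1 :> R[i] by apply/eqP; rewrite eq_complex /= oppr0 !eqxx.
have ci : conjc 'i%C = - 'i%C :> R[i] by apply/eqP; rewrite eq_complex /= oppr0 !eqxx.
have W1 : W (fun J => alpha * mulop (rshift r j) w J - derop (rshift r j) w J).
  have := W_op (inr (lshift s j)) Ww; congr F.
  rewrite /odd_image (unsplitK (inl j)) /W; congr tens; apply/funext => J.
  by rewrite c1 mulr1 mul1r.
have W2 : W (fun J => alpha * - 'i%C * mulop (rshift r j) w J - 'i%C * derop (rshift r j) w J).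
  have := W_op (inr (rshift s j)) Ww; congr F.
  rewrite /odd_image (unsplitK (inr j)) /W; congr tens; apply/funext => J.
  by rewrite ci mulrA.
(* With T the variable and D the derivation along it, the two directions give alpha T - D and -i
   alpha T - i D; i times the first minus the second is 2 i alpha T. *)
have Wm : W (mulop (rshift r j) w).
  have := WZ (2 * 'i%C * alpha)^-1 _ (WZD 'i%C W1 (WZ (-1) _ W2)); congr W.
  apply/funext => J; set x := mulop _ _ _; set y := derop _ _ _.
  rewrite [X in _ * X](_ : _ = (2 * 'i%C * alpha) * x); last by rewrite /alpha; ring.
  rewrite mulKf//; apply: mulf_neq0 alpha0; apply: mulf_neq0.
    by rewrite pnatr_eq0.
  by apply/eqP => -[] /eqP; rewrite oner_eq0.
split => //.
have := WZ (-1) _ (WZD (- alpha) Wm W1); congr W; apply/funext => J.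
by rewrite /alpha; ring.
Qed.

Let measurable_sqnZ (d : R) : measurable_fun [set: 'rV[R]_m] (fun x => d * sqn x).
Proof. by apply: measurable_funM => //; exact: measurable_sqn. Qed.

Let gam_measurable : measurable_fun setT (@gam R m).
Proof.
apply: measurableT_comp => //; under eq_fun do rewrite -mulNr.
exact: measurable_sqnZ.
Qed.

Let gam_int : (\int[mu]_x (@gam R m x ^+ 2)%:E < +oo)%E.
Proof.
apply: le_lt_trans (gauss_rV_lty m); apply: ge0_le_integral => //.
- by move=> x _; rewrite lee_fin sqr_ge0.
- by apply/measurable_EFinP; apply: measurable_funX; exact: gam_measurable.
- apply/measurable_EFinP; apply: measurableT_comp => //.
  by under eq_fun do rewrite -mulN1r; exact: measurable_sqnZ.
- by move=> x _; rewrite lee_fin /gam -expRM_natl ler_expR; have := sqn_ge0 x; lra.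
Qed.


Lemma invariant_full phi0 : F phi0 -> L2sq phi0 != 0%E -> forall phi, HS phi -> F phi.
Proof.
move=> Fphi0 phi00.
have [w0 [[I0 wI0] Fw0]] := exists_mean_neq0 cF hb FU Fphi0 phi00.
have Ww0 : W w0 by apply: (tens_limit cF hb FU).
have Wb := spin_irreducible WZD (fun c w Ww => (Wmulder c Ww).1)
  (fun c w Ww => (Wmulder c Ww).2) Ww0 wI0.
move=> phi hphi; have [mR mI] := HS_msfun hphi.
have part (f : R[i] -> R) I : measurable_fun setT (fun x => f (phi I x)) ->
    (forall z, f z ^+ 2 <= Re z ^+ 2 + Im z ^+ 2) ->
    F (tens (fun x => f (phi I x)) (basis I)).
  move=> mf fle.
  (* Division by the Gaussian, through a multiplier that need not be bounded. *)
  have E : umul (fun x => f (phi I x) * expR (2 * sqn x)) (tens (@gam R m) (basis I)) =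
      tens (fun x => f (phi I x)) (basis I).
    apply/funext => J; apply/funext => x; rewrite /umul /tens mulrCA -rmorphM.
    by rewrite /gam -mulrA -expRD subrr expR0 mulr1.
  rewrite -E; apply: (umul_invariant cF hb FU); last 2 first.
    - exact: Wb.
    - rewrite E; apply: HS_tens => //.
      have /HSP[_] := hphi; apply: le_lt_trans; apply: ge0_le_integral => //;
        try by move=> x _; rewrite lee_fin ?sqr_ge0 ?pdot_ge0.
      * by apply/measurable_EFinP; exact: measurable_funX.
      * by apply: emeasurable_pdot; exact: HS_msfun.
      * by move=> x _; rewrite lee_fin; exact: le_trans (fle _) (pdot_coord phi I x).
    apply: measurable_funM => //.
    exact: (measurableT_comp (@measurable_expR R) (measurable_sqnZ 2)).
have -> : phi = \sum_I ('i%C *: tens (fun x => Im (phi I x)) (basis I) +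
    tens (fun x => Re (phi I x)) (basis I)).
  apply/funext => J; apply/funext => x.
  rewrite [RHS](_ : _ = \sum_I (('i%C *: tens (fun x => Im (phi I x)) (basis I) +
    tens (fun x => Re (phi I x)) (basis I)) J x)); last by rewrite !fct_sumE.
  rewrite (bigD1 J)//= big1 ?addr0; last first.
    move=> I IJ; rewrite sfD sfZ /tens /basis eq_sym (negbTE IJ).
    by rewrite !mul0r mulr0 addr0.
  rewrite sfD sfZ /tens /basis eqxx !mul1r; case: (phi J x) => a b.
  by apply/eqP; rewrite eq_complex !ReImE/=; apply/andP; split; apply/eqP; ring.
apply: (subspace_sum cF) => I _; apply: (subspaceZD cF).
  by apply: (part (fun z => Im z)) => [|z]; [exact: mI|rewrite lerDr sqr_ge0].
by apply: (part (fun z => Re z)) => [|z]; [exact: mR|rewrite lerDl sqr_ge0].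
Qed.

End irreducibility.

Theorem theorem5p13 (R : realType) (A : superalgebra R) (m k l : nat)
    (eps : int) (r s : nat) (hbar : R) :
  ~~ odd (k + l) ->
  eps = 1 \/ eps = -1 ->
  2 * eps * s%:Z = k%:Z - l%:Z ->
  (2 * r + 2 * s = k + l)%N ->
  hbar <> 0 ->
  @schrodinger_irreducible R m r s A hbar eps.
Proof.
move=> _ he _ _ hb Hoo [F [cF [phi0 [Fphi0 phi00]] [phi [hphi nF]] FU [_ Fodd]]].
by apply: nF; exact: (invariant_full hb he cF FU Fodd Fphi0 phi00 hphi).
Qed.
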